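(* Let $(\mathcal H,B)$ be an abstract Wiener space and let $h>0$. The Weyl calculus $F\mapsto Op_h^{Weyl}(F)$ is not positive: there exist a positive symbol $F:\mathcal H^2\to\mathbb R$ belonging to the Calderón–Vaillancourt classes (i.e. $F\in S_m(\mathfrak B,\varepsilon)$ with $m\ge 2$, for some Hilbert basis $\mathfrak B$ of $\mathcal H$ consisting of vectors of $B'$ and some square summable sequence $\varepsilon$ of nonnegative real numbers) and admitting a stochastic extension with respect to both $\mu_{B^2,h}$ and $\mu_{B^2,h/2}$ (so that $Op_h^{Weyl}(F)$ is defined), and a function $\tilde g\in L^2(B,\mu_{B,h/2})$, such that $$\langle Op_h^{Weyl}(F)\tilde g,\tilde g\rangle_{L^2(B,\mu_{B,h/2})}<0.$$
   Context: **Wiener space.** $\mathcal H$ is a real, separable, infinite dimensional Hilbert space with scalar product $\cdot$ and norm $|\ |$. $\mathcal F(X)$ is the set of finite dimensional subspaces of $X$. On a Euclidean space $E$ of dimension $d$, $\mu_{E,s}$ is the Gaussian measure $(2\pi s)^{-d/2}e^{-|y|^2/2s}dy$, $s>0$. For $E\in\mathcal F(\mathcal H)$, $P_E$ is the orthogonal projection on $E$; for a Borel set $A\subset E$, the cylinder $C=\{x\in\mathcal H: P_E(x)\in A\}$ has protomeasure $\mu_{\mathcal H,s}(C)=\mu_{E,s}(A)$. Let $\|\ \|$ be another norm on $\mathcal H$ which is measurable: for all $\epsilon>0$ there is $E_\epsilon\in\mathcal F(\mathcal H)$ such that $\mu_{\mathcal H,s}(\{x:\|P_F(x)\|>\epsilon\})<\epsilon$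 for all $F\in\mathcal F(\mathcal H)$ with $F\perp E_\epsilon$. $B$ is the completion of $\mathcal H$ for $\|\ \|$, and $B'\subset\mathcal H\subset B$ (with $\mathcal H$ identified with its dual; inclusions continuous and dense). $(\mathcal H,B)$ is called an abstract Wiener space. $\mu_{B,s}$ is the probability measure on the Borel $\sigma$-algebra of $B$ such that $\mu_{B,s}(\{x\in B:((y_i,x)_{B',B})_{i\le n}\in A\})=\mu_{\mathcal H,s}(\{x\in\mathcal H:(y_i\cdot x)_{i\le n}\in A\})$ for $y_1,\dots,y_n\in B'$ and Borel $A\subset\mathbb R^n$. For $a\in B'$, $\ell_a(x)=(a,x)_{B',B}$; $a\mapsto \ell_a$ extends by density to a linear map $\mathcal H\to L^2(B,\mu_{B,s})$ with $\|\ell_a\|_{L^2}=\sqrt s|a|$. For $E\in\mathcal F(\mathcal H)$ with orthonormal basis $(u_j)$, $\tilde\pi_E(y)=\sum_j\ell_{u_j}(y)u_j$ for $y\in B$. $(\mathcal H^2,B^2)$ is also an abstract Wiener space, with measures $\mu_{B^2,s}=\mu_{B,s}\otimes\mu_{B,s}$. **Stochastic extension.** For $1\le p<\infty$, a function $f$ on $\mathcal H$ has the stochastic extension $\tilde f\in L^p(B,\mu_{B,s})$ in $L^p(B,\mu_{B,s})$ if for every increasing sequence $(E_n)$ in $\mathcal F(\mathcal H)$ with dense union, $f\circ\tilde\pi_{E_n}\in L^p(B,\mu_{B,s})$ and $f\circ\tilde\pi_{E_n}\to\tilde f$ in $L^p(B,\mu_{B,s})$. The same definition applies to $(\mathcal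 H^2,B^2)$. In the definition of the operator below, extensions are taken in $L^2$. **Quadratic form.** For $E$ of dimension $d$, $\gamma_{E,h/2}f(y)=(\pi h)^{-d/4}e^{-|y|^2/2h}f(y)$. $\mathcal S_{E,h/2}$ is the space of complex functions $\varphi$ on $E$ with $\gamma_{E,h/2}\varphi$ rapidly decreasing (Schwartz class). $\mathcal D_{B',h/2}$ is the set of functions $\tilde f=\varphi\circ\tilde\pi_E$ on $B$ with $E\in\mathcal F(B')$, $\varphi\in\mathcal S_{E,h/2}$; it is dense in $L^2(B,\mu_{B,h/2})$. For $\hat f,\hat g\in\mathcal S_{E,h/2}$, $$W_{h,E}(\hat f,\hat g)(z,\zeta)=e^{|\zeta|^2/h}\int_E e^{-2i\zeta\cdot t/h}\hat f(z+t)\overline{\hat g(z-t)}e^{-|t|^2/h}(\pi h)^{-d/2}dt,$$ and for $\tilde f=\hat f\circ\tilde\pi_E,\ \tilde g=\hat g\circ\tilde\pi_E$, $W_{h,B}(\tilde f,\tilde g)(z,\zeta)=W_{h,E}(\hat f,\hat g)(\tilde\pi_E(z),\tilde\pi_E(\zeta))$ on $B^2$ (independent of $E$). For a bounded Borel function $\tilde F$ on $B^2$ and $\tilde f,\tilde g\in\mathcal D_{B',h/2}$, $Q_h^{Weyl}(\tilde F)(\tilde f,\tilde g)=\int_{B^2}\tilde F\,W_{h,B}(\tilde f,\tilde g)\,d\mu_{B^2,h/2}$. **Symbol classes.** A multiindex is a map $\mathbb N^*\to\mathbb N$ with finitely many nonzero values; its depth is its maximal value. Let $\mathfrak B=(e_j)_{j\ge1}$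 be a Hilbert basis of $\mathcal H$ with all $e_j\in B'$, $u_j=(e_j,0)$, $v_j=(0,e_j)$, $m\ge0$ an integer, $\varepsilon=(\varepsilon_j)_{j\ge1}$ nonnegative reals. $S_m(\mathfrak B,\varepsilon)$ is the set of bounded continuous $F:\mathcal H^2\to\mathbb C$ for which there is $M\ge0$ such that for all multiindices $\alpha,\beta$ of depth at most $m$, $\partial_u^\alpha\partial_v^\beta F=\big[\prod_j\partial_{u_j}^{\alpha_j}\partial_{v_j}^{\beta_j}\big]F$ is well defined, continuous on $\mathcal H^2$, and $|\partial_u^\alpha\partial_v^\beta F(x,\xi)|\le M\prod_j\varepsilon_j^{\alpha_j+\beta_j}$ for all $(x,\xi)\in\mathcal H^2$. **Operator.** If $F\in S_2(\mathfrak B,\varepsilon)$ with $\varepsilon$ square summable and $F$ has a stochastic extension $\tilde F$ with respect to both $\mu_{B^2,h}$ and $\mu_{B^2,h/2}$, then (known theorem) there is a bounded operator $Op_h^{Weyl}(F)$ on $L^2(B,\mu_{B,h/2})$, unique by density, with $\langle Op_h^{Weyl}(F)\tilde f,\tilde g\rangle=Q_h^{Weyl}(\tilde F)(\tilde f,\tilde g)$ for all $\tilde f,\tilde g\in\mathcal D_{B',h/2}$. *)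

(* Defs.v *)
From HB Require Import structures.
From mathcomp Require Import all_boot all_order all_algebra complex.
From mathcomp Require Import all_classical all_reals all_analysis.

Set Implicit Arguments.
Unset Strict Implicit.
Unset Printing Implicit Defensive.

Import Order.TTheory GRing.Theory Num.Theory.
Import numFieldNormedType.Exports.

Local Open Scope classical_set_scope.
Local Open Scope ring_scope.

Section product_probability.
Context d1 d2 (T1 : measurableType d1) (T2 : measurableType d2) (R : realType).
Variables (P : probability T1 R) (Q : probability T2 R).

Definition product_probability : set (T1 * T2) -> \bar R := (P \x Q)%E.

HB.instance Definition _ := Measure.on product_probability.

Lemma product_probability_setT : product_probability setT = 1%E.
Proof.
rewrite /product_probability -setXTT product_measure1E//.
by rewrite [X in (X * _)%E]probability_setT [X in (_ * X)%E]probability_setT mule1.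
Qed.

HB.instance Definition _ :=
  Measure_isProbability.Build _ _ _ product_probability product_probability_setT.

End product_probability.

Section gaussian.
Context {R : realType}.
Local Notation RT := (measurableTypeR R).

Definition tuple_cons n (p : RT * n.-tuple RT) : n.+1.-tuple RT :=
  [tuple of p.1 :: p.2].

Lemma measurable_tuple_cons n :
  measurable_fun [set: RT * n.-tuple RT] (@tuple_cons n).
Proof. exact: measurable_cons. Qed.

HB.instance Definition _ n :=
  isMeasurableFun.Build _ _ _ _ (@tuple_cons n) (@measurable_tuple_cons n).

(* For s > 0 this is (2 pi s)^(-n/2) exp(-|t|^2/(2s)) dt, written as a product
   of one-dimensional Gaussians; the second parameter of [normal_prob] is the
   standard deviation. *)
Fixpoint gaussian (s : R) n : probability (n.-tuple RT) R :=
  if n is n'.+1 then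
    distribution (product_probability (normal_prob 0 (Num.sqrt s)) (gaussian s n'))
      (@tuple_cons n')
  else dirac [tuple].

End gaussian.

(* A finite dimensional subspace of V is represented by an orthonormal basis
   u : seq V, the subspace itself being [fspan u]. *)

Section subspaces.
Context {R : realType} {V : lmodType R}.

Definition lincomb (u : seq V) (t : (size u).-tuple (measurableTypeR R)) : V :=
  \sum_(i < size u) (tnth t i : R) *: u`_i.

Definition fspan (u : seq V) : set V := range (lincomb (u := u)).

Variable dot : V -> V -> R.

Definition orthonormal_seq (u : seq V) : Prop :=
  forall i j, (i < size u)%N -> (j < size u)%N -> dot u`_i u`_j = (i == j)%:R.

(* The measure mu_{E,s}, E = fspan u; it does not depend on the choice of the
   orthonormal basis u of E. It is also the protomeasure mu_{H,s} of the
   cylinder of base A. *)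
Definition gaussian_span (s : R) (u : seq V) (A : set V) : \bar R :=
  gaussian s (size u) (lincomb (u := u) @^-1` A).

End subspaces.

Definition borelType (B : ptopologicalType) := g_sigma_algebraType (@open B).

Section wiener.
Context {R : realType} {H B : completeNormedModType R}.
Variables (dot : H -> H -> R) (inc : H -> B).

Record hilbert_axioms : Prop := {
  dotC : forall x y, dot x y = dot y x ;
  dot_linear : forall y, scalar (dot ^~ y) ;
  dot_norm : forall x, dot x x = `|x| ^+ 2 ;
  hilbert_separable : exists2 D : set H, countable D & dense D ;
  hilbert_infinite_dim : forall u : seq H, fspan u <> setT }.

(* The measurable norm on H is x |-> `|inc x|. *)
Definition measurable_norm (s : R) : Prop :=
  forall eps : R, 0 < eps -> exists2 e : seq H, orthonormal_seq dot e &
    forall f : seq H, orthonormal_seq dot f ->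
      (forall x y, x \in e -> y \in f -> dot x y = 0) ->
      (gaussian_span s f [set y | (eps < `|inc y|)%R] < eps%:E)%E.

End wiener.

(* [dual_pair dot inc a phi] : a belongs to B' (seen inside H) and phi is the
   corresponding continuous linear form (a, .)_{B',B} on B. *)
Definition dual_pair {R : realType} {V W : normedModType R}
    (dot : V -> V -> R) (inc : V -> W) (a : V) (phi : W -> R) : Prop :=
  [/\ scalar phi, continuous phi & forall x, phi (inc x) = dot a x].

Definition in_dual {R : realType} {V W : normedModType R}
    (dot : V -> V -> R) (inc : V -> W) : set V :=
  [set a | exists phi, dual_pair dot inc a phi].

Section wiener.
Context {R : realType} {H B : completeNormedModType R}.
Variables (dot : H -> H -> R) (inc : H -> B).

Definition wiener_measure (s : R) (mu : probability (borelType B) R) : Prop :=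
  forall n (y : 'I_n -> H) (phi : 'I_n -> B -> R) (u : seq H)
    (A : set (n.-tuple (measurableTypeR R))),
  (forall i, dual_pair dot inc (y i) (phi i)) ->
  orthonormal_seq dot u -> (forall i, fspan u (y i)) -> measurable A ->
  mu [set x | A [tuple phi i x | i < n]] =
  gaussian_span s u [set z | A [tuple dot (y i) z | i < n]].

(* B is the completion of H for the norm x |-> `|inc x| because it is complete
   and contains inc(H) as a dense subspace. *)
Record abstract_wiener (mu : R -> probability (borelType B) R) : Prop := {
  aw_hilbert : hilbert_axioms dot ;
  aw_linear : linear inc ;
  aw_injective : injective inc ;
  aw_measurable_norm : forall s : R, 0 < s -> measurable_norm dot inc s ;
  aw_dense : dense (range inc) ;
  aw_continuous : continuous inc ;
  aw_dual_dense : dense (in_dual dot inc) ;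
  aw_measure : forall s : R, 0 < s -> wiener_measure s (mu s) }.

End wiener.

(* Stated for a space V with scalar product dot, a measured space (T, mu)
   and a pairing relation dual a phi (a in the dual, phi = (a, .) as a function
   on T), to be used both for (H, B) and for (H^2, B^2). *)

Section stochastic_extension.
Context {R : realType} {V : normedModType R} (dot : V -> V -> R).
Context {d} {T : measurableType d} (dual : V -> (T -> R) -> Prop).
Variable mu : {measure set T -> \bar R}.

(* ell_a is (a, .) itself if a is in the dual, and otherwise a representative of
   the L^2(mu) limit of (b_n, .) for b_n in the dual tending to a. *)
Definition is_ell (a : V) (l : T -> R) : Prop :=
  dual a l \/
  (~ (exists phi, dual a phi) /\ measurable_fun setT l /\
   exists (b : nat -> V) (phi : nat -> T -> R),
     [/\ forall n, dual (b n) (phi n), b @ \oo --> a &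
         Lnorm mu 2%:E (fun x => (phi n x - l x)%:E) @[n --> \oo] --> 0%E]).

Definition ell (a : V) : T -> R := xget (cst 0) (is_ell a).

(* \tilde\pi_E for E = fspan u, u orthonormal *)
Definition tpi (u : seq V) (y : T) : V :=
  \sum_(i < size u) ell u`_i y *: u`_i.

(* ft is the stochastic extension of f in L^p(T, mu), for 1 <= p. *)
Definition stochastic_extension (p : R) (f : V -> R) (ft : T -> R) : Prop :=
  ft \in Lfun mu p%:E /\
  forall E : nat -> seq V,
    (forall n, orthonormal_seq dot (E n)) ->
    (forall n, fspan (E n) `<=` fspan (E n.+1)) ->
    dense (\bigcup_n fspan (E n)) ->
    (forall n, f \o tpi (E n) \in Lfun mu p%:E) /\
    Lnorm mu p%:E (fun x => (f (tpi (E n) x) - ft x)%:E) @[n --> \oo] --> 0%E.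

End stochastic_extension.

Section derivatives.
Context {R : realType} {V : normedModType R}.

(* partials [:: v1; ...; vk] f = D_v1 (... (D_vk f)) *)
Definition partials (w : seq V) (f : V -> R) : V -> R :=
  foldr (fun v (g : V -> R) => 'D_v g) f w.

Fixpoint has_partials (w : seq V) (f : V -> R) : Prop :=
  if w is v :: w' then
    has_partials w' f /\ forall x, derivable (partials w' f) x v
  else True.

End derivatives.

Section symbols.
Context {R : realType} {H : completeNormedModType R}.
Variable dot : H -> H -> R.

Definition hilbert_basis (e : nat -> H) : Prop :=
  (forall i j, dot (e i) (e j) = (i == j)%:R) /\
  dense (\bigcup_n fspan (mkseq e n)).

(* The directions of d_u^alpha d_v^beta, alpha and beta vanishing from N on. *)
Definition multi_directions (e : nat -> H) (N : nat) (alpha beta : nat -> nat) :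
    seq (H * H) :=
  flatten [seq nseq (alpha j) (e j, 0) ++ nseq (beta j) (0, e j) | j <- iota 0 N].

(* The real-valued members of the class S_m(e, eps). *)
Definition symbol_class (m : nat) (e : nat -> H) (eps : nat -> R)
    (F : H * H -> R) : Prop :=
  [/\ continuous F, exists M : R, forall z, `|F z| <= M &
  exists2 M : R, 0 <= M & forall (N : nat) (alpha beta : nat -> nat),
    (forall j, (N <= j)%N -> alpha j = 0%N /\ beta j = 0%N) ->
    (forall j, (alpha j <= m)%N /\ (beta j <= m)%N) ->
    let w := multi_directions e N alpha beta in
    [/\ has_partials w F, continuous (partials w F) &
      forall z, `|partials w F z| <=
        M * \prod_(j < N) eps j ^+ (alpha j + beta j)]].

End symbols.

Section complex_L2.
Context {R : realType} {d} {T : measurableType d}.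
Variable mu : {measure set T -> \bar R}.
Local Notation C := (complex R).

Definition cintegral (f : T -> C) : C :=
  Complex (\int[mu]_x complex.Re (f x)) (\int[mu]_x complex.Im (f x)).

Definition cL2 (f : T -> C) : Prop :=
  @complex.Re R \o f \in Lfun mu 2%:E /\ @complex.Im R \o f \in Lfun mu 2%:E.

Definition cL2norm (f : T -> C) : \bar R :=
  Lnorm mu 2%:E (fun x => (@complex.ComplexField.Normc.normc R (f x))%:E).

Definition cL2inner (f g : T -> C) : C := cintegral (fun x => f x * (g x)^*).

(* Bounded operators on L^2(mu) are represented by maps between functions,
   linear up to mu-negligible sets. *)
Definition cL2_bounded_operator (A : (T -> C) -> (T -> C)) : Prop :=
  [/\ forall f, cL2 f -> cL2 (A f),
      forall (c : C) f g, cL2 f -> cL2 g ->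
        {ae mu, forall x, A (fun x => c * f x + g x) x = c * A f x + A g x} &
      exists c : R, forall f, cL2 f -> (cL2norm (A f) <= c%:E * cL2norm f)%E].

End complex_L2.

Section weyl.
Context {R : realType} {H B : completeNormedModType R}.
Variables (dot : H -> H -> R) (inc : H -> B).
Variable mu : R -> probability (borelType B) R.
Local Notation C := (complex R).
Local Notation BT := (borelType B).

Definition dot2 (x y : H * H) : R := dot x.1 y.1 + dot x.2 y.2.

Definition inc2 (x : H * H) : B * B := (inc x.1, inc x.2).

Definition mu2 (s : R) : probability (BT * BT)%type R :=
  product_probability (mu s) (mu s).

Definition tpiB (s : R) (u : seq H) : BT -> H :=
  tpi (T := BT) (dual_pair dot inc) (mu s) u.

Definition stochastic_extension2 (s p : R) (F : H * H -> R) (Ft : B * B -> R) :=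
  stochastic_extension dot2 (T := (BT * BT)%type) (dual_pair dot2 inc2)
    (mu2 s) p F Ft.

(* Schwartz functions on E = fspan u ; only directions and points of E are
   involved, so that f is used only on E. *)
Definition schwartz_on (u : seq H) (f : H -> R) : Prop :=
  forall w : seq H, {in w, forall v, fspan u v} ->
    (forall x v, fspan u x -> fspan u v -> derivable (partials w f) x v) /\
    forall N : nat, exists M : R, forall x, fspan u x ->
      (1 + dot x x) ^+ N * `|partials w f x| <= M.

(* gamma_{E,h/2} and the space S_{E,h/2}, E = fspan u *)
Definition gamma_half (h : R) (u : seq H) (phi : H -> C) (y : H) : C :=
  ((pi * h) `^ (- (size u)%:R / 4) * expR (- dot y y / (2 * h)))%:C%C * phi y.

Definition S_half (h : R) (u : seq H) (phi : H -> C) : Prop :=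
  schwartz_on u (@complex.Re R \o gamma_half h u phi) /\
  schwartz_on u (@complex.Im R \o gamma_half h u phi).

Definition expi (x : R) : C := Complex (cos x) (sin x).

(* W_{h,E}(phi, psi) for E = fspan u: the weight exp(-|t|^2/h) (pi h)^(-d/2) dt
   of the integral over E is mu_{E,h/2}. *)
Definition wignerE (h : R) (u : seq H) (phi psi : H -> C) (z zeta : H) : C :=
  (expR (dot zeta zeta / h))%:C%C *
  cintegral (gaussian (h / 2) (size u)) (fun c => let t := lincomb c in
    expi (- 2 * dot zeta t / h) * phi (z + t) * (psi (z - t))^*).

Definition wignerB (h : R) (u : seq H) (phi psi : H -> C) (x : B * B) : C :=
  wignerE h u phi psi (tpiB (h / 2) u x.1) (tpiB (h / 2) u x.2).

Definition weyl_form (h : R) (Ft : B * B -> R) (u : seq H) (phi psi : H -> C) : C :=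
  cintegral (mu2 (h / 2)) (fun x => (Ft x)%:C%C * wignerB h u phi psi x).

(* A pair of elements of D_{B',h/2} can always be written with the same
   subspace E = fspan u of B', as in the definition of W_{h,B}. *)
Definition is_weyl_operator (h : R) (Ft : B * B -> R)
    (A : (B -> C) -> (B -> C)) : Prop :=
  cL2_bounded_operator (mu (h / 2)) A /\
  forall (u : seq H) (phi psi : H -> C),
    orthonormal_seq dot u -> {in u, forall a, in_dual dot inc a} ->
    S_half h u phi -> S_half h u psi ->
    cL2inner (mu (h / 2)) (A (phi \o tpiB (h / 2) u)) (psi \o tpiB (h / 2) u) =
    weyl_form h Ft u phi psi.

End weyl.

(* Main.v *)
From HB Require Import structures.
Require Import Defs.
From mathcomp Require Import all_boot all_order all_algebra complex.
From mathcomp Require Import ring lra.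
From mathcomp Require Import all_classical all_reals all_analysis.
From mathcomp Require Import measurable_realfun lebesgue_integral random_variable normal_distribution.
Import Order.TTheory GRing.Theory Num.Theory.
Import numFieldNormedType.Exports.
Local Open Scope classical_set_scope.
Local Open Scope ring_scope.

Set Implicit Arguments.
Unset Strict Implicit.
Unset Printing Implicit Defensive.

(** Write [x1], [xi1] for the first coordinates of a point [(x, xi)] of [H * H]
    in a Hilbert basis made of vectors of [B']. The symbol is
      F (x, xi) = delta + (1 + cos (a x1)) * (1 + cos (a xi1)),  a ^ 2 = 4 / h,
    with a small [delta > 0]. It is positive, and it is a finite sum of waves
    [c * cos (al x1 + be xi1)], all of whose derivatives are bounded and vanish
    as soon as one direction is not along the first basis vector [e]; hence it
    lies in every class [S_m] with the sequence eps = (1, 0, 0, ...).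

    The Weyl quantization of the exponential exp (i (al x1 + be xi1)) is the
    unitary Weyl translation
      (T f) y = exp (i (al L y + al be h / 2)) exp (- be L y - h be^2 / 2) f (y + h be e),
    where [L] is the linear functional on [B] given by [e]; the operator of [F]
    is the corresponding combination of translations. On the first Hermite
    function [g = L], the Cameron-Martin formula and the Gaussian integrals of
    [cos] and [x^2 cos] give
      Re <T g, g> = (h / 2) (1 - (h / 2) (al^2 + be^2)) exp (- (h / 4) (al^2 + be^2)),
    which is negative for large frequencies: the Wigner function of [g] is negative
    near the origin. With [a^2 = 4 / h] and [x = exp (-1)] the sum over the waves is
    (h / 2) (delta + (1 - 3 x) (1 + x)). As exp 1 < 3 this is negative for small
    [delta].

    Three facts carry the proof. (1) [weyl_operatorP]: the combination of
    translations satisfies the defining identity of the Weyl operator. For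
    cylindrical functions this is an inversion formula for a Gaussian Fourier
    transform ([wigner_inversion], [wigner_phase_space_integral]), extended to
    waves in a direction [e] outside of the subspace [E] of the cylinder by
    splitting [e] into a component in [E] and an independent one
    ([master_formula]), and compared with the Cameron-Martin shift
    ([cameron_martin], [translation_inner]). All integrals are kept real: a phase
    [th] replaces the real and imaginary parts, because sin y = cos (y - pi / 2).
    (2) [cameron_martin] itself: a finite Borel measure on [B] is determined by its
    values on cylinders ([borel_measure_unique]), because the norm of [B] is a
    countable supremum of functionals of [B'] ([norming_functionals]); on
    cylinders the formula is a change of variable for finite dimensional
    Gaussians. (3) [cos_symbol_extension]: a linear form extends to an element of
    L^2 by completeness ([riesz_fischer]), with an L^2 norm controlled by the norm of
    the vector ([ell_limit_small]), and a sum of waves is a Lipschitz function of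
    two linear forms. *)

(** * Integration against a density and affine changes of variable *)

Section density.
Context d (T : measurableType d) (R : realType).
Variables (mu nu : {measure set T -> \bar R}) (g : T -> R).
Hypothesis g0 : forall x, 0 <= g x.
Hypothesis mg : measurable_fun setT g.
Hypothesis nuE : forall A, measurable A -> nu A = (\int[mu]_(x in A) (g x)%:E)%E.

Import HBNNSimple.

(** True for indicators by the definition of the density, hence for simple
    functions by linearity and for all nonnegative functions by monotone
    convergence. *)
Lemma ge0_integral_density (f : T -> \bar R) :
  measurable_fun setT f -> (forall x, 0 <= f x)%E ->
  (\int[nu]_x f x = \int[mu]_x (f x * (g x)%:E))%E.
Proof.
move=> mf f0.
pose f_ := nnsfun_approx measurableT mf.
transitivity (lim (\int[nu]_x (f_ n x)%:E @[n --> \oo])%E).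
  rewrite -monotone_convergence//=.
  - apply: eq_integral => ? /[!inE] xD; apply/esym/cvg_lim => //=.
    exact: cvg_nnsfun_approx.
  - by move=> n; exact/measurable_EFinP/measurable_funTS.
  - by move=> n ? _; rewrite lee_fin.
  - by move=> ? _ ? ? mn; rewrite lee_fin; exact/lefP/nd_nnsfun_approx.
transitivity (lim (\int[mu]_x ((f_ n x)%:E * (g x)%:E) @[n --> \oo])%E); last first.
  rewrite -monotone_convergence//=.
  - apply: eq_integral => x /[!inE] xD.
    have [->|gx0] := eqVneq (g x) 0.
      rewrite mule0; apply/cvg_lim => //.
      by under eq_fun do rewrite mule0; exact: cvg_cst.
    apply/cvg_lim => //; apply: cvgeM; last exact: cvg_cst.
    + by rewrite mule_defE eqe (negbTE gx0)/= andbF.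
    + exact: cvg_nnsfun_approx.
  - move=> n; apply/measurable_EFinP/measurable_funM => //.
  - by move=> n ? _; rewrite lee_fin mulr_ge0.
  - move=> ? _ ? ? mn; rewrite lee_fin ler_wpM2r//; exact/lefP/nd_nnsfun_approx.
apply: congr_lim; apply/funext => n /=.
have mr r : measurable (f_ n @^-1` [set r]) by exact: measurable_sfunP.
under eq_integral do rewrite fimfunE -fsumEFin//.
rewrite ge0_integral_fsum//; last 2 first.
  - by move=> r; by apply/measurable_EFinP/measurable_funM => //; exact: measurable_indic.
  - by move=> r x _; rewrite nnfun_muleindic_ge0.
under [RHS]eq_integral.
  move=> x _; rewrite fimfunE -fsumEFin// ge0_mule_fsuml; last first.
    by move=> r; rewrite nnfun_muleindic_ge0.
  over.
rewrite [RHS]ge0_integral_fsum//; last 2 first.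
  - move=> r; apply: emeasurable_funM.
      by apply/measurable_EFinP/measurable_funM => //; exact: measurable_indic.
    exact/measurable_EFinP.
  - move=> r x _; apply: mule_ge0; first exact: nnfun_muleindic_ge0.
    by rewrite lee_fin.
apply: eq_fsbigr => r _.
rewrite integralZl_indic_nnsfun// integral_indic// setIT nuE//.
have [r0|r0] := ltP r 0.
  rewrite preimage_nnfun0// integral_set0 mule0.
  apply/esym; apply: integral0_eq => x _.
  by rewrite indic0 mulr0 mul0e.
have -> : (\int[mu]_(x in f_ n @^-1` [set r]) (g x)%:E
    = \int[mu]_x ((\1_(f_ n @^-1` [set r]) x)%:E * (g x)%:E))%E.
  rewrite integral_mkcond; apply: eq_integral => x _; rewrite patchE indicE.
  by case: ifP => _; rewrite ?mul1e ?mul0e.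
rewrite -ge0_integralZl//.
- by apply: eq_integral => x _; rewrite EFinM muleA.
- apply: emeasurable_funM; last exact/measurable_EFinP.
  exact/measurable_EFinP/measurable_indic.
- by move=> x _; rewrite mule_ge0 ?lee_fin.
Qed.

End density.

Section lebesgue_affine.
Context (R : realType).
Local Notation leb := (@lebesgue_measure R).

Lemma ge0_integral_affine (k v : R) (f : R -> \bar R) : 0 < k ->
  measurable_fun setT f -> (forall x, 0 <= f x)%E ->
  (\int[leb]_x f x = k%:E * \int[leb]_x f (k * x + v)%R)%E.
Proof.
move=> k0 mf f0.
pose phi (x : measurableTypeR R) : measurableTypeR R := k * x + v.
have mphi : measurable_fun setT phi.
  by apply: measurable_funD => //; exact: measurable_funM.
have kn : (0 <= k) by exact: ltW.
have E A : measurable A -> leb A = mscale (NngNum kn) (pushforward leb phi) A.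
  move=> mA.
  apply: (@lebesgue_measure_unique R (mscale (NngNum kn) (pushforward leb (phi : _ -> measurableTypeR R)))) => //.
  move=> _ [[a b]] _ <- /=.
  rewrite /mscale/= /pushforward/=.
  have -> : phi @^-1` `]a, b]%classic = `](a - v) / k, (b - v) / k]%classic.
    apply/seteqP; split => x /=; rewrite !in_itv/= /phi ltr_pdivrMr// ler_pdivlMr//;
      by rewrite ltrBlDr lerBrDr (mulrC x).
  rewrite !lebesgue_measure_itv/= !lte_fin ltr_pM2r ?invr_gt0// ltrD2r.
  case: ifP => _; last by rewrite mule0.
  rewrite -!EFinB -EFinM; congr (_%:E); field; exact: lt0r_neq0.
rewrite (eq_measure_integral (mscale (NngNum kn) (pushforward leb phi))); last first.
  by move=> A mA _; exact: E.
rewrite ge0_integral_mscale//=.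
by rewrite ge0_integral_pushforward//.
Qed.

End lebesgue_affine.

Section normal_change.
Context (R : realType).
Local Notation leb := (@lebesgue_measure R).
Local Notation RT := (measurableTypeR R).
Implicit Types (s k v x t : R).

Definition ndens s x : R := (Num.sqrt (2 * pi * s))^-1 * expR (- x ^+ 2 / (2 * s)).

Lemma normal_pdf_ndens s x : 0 < s -> normal_pdf 0 (Num.sqrt s) x = ndens s x.
Proof.
move=> s0; rewrite normal_pdfE ?gt_eqF ?sqrtr_gt0// /normal_peak /normal_fun.
rewrite sqr_sqrtr ?(ltW s0)// subr0 /ndens.
congr ((Num.sqrt _)^-1 * expR (_ / _)); rewrite -[in LHS]mulr_natl; ring.
Qed.

Lemma ndens_gt0 s x : 0 < s -> 0 < ndens s x.
Proof.
by move=> s0; rewrite mulr_gt0 ?expR_gt0// invr_gt0 sqrtr_gt0 !mulr_gt0 ?pi_gt0.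
Qed.

Lemma measurable_ndens s : measurable_fun setT (ndens s).
Proof.
apply: measurable_funM => //; apply: measurableT_comp => //.
apply: measurable_funM => //; apply: measurableT_comp => //; exact: measurable_funX.
Qed.

Lemma integral_normal s (f : R -> \bar R) : 0 < s -> measurable_fun setT f ->
  (forall x, 0 <= f x)%E ->
  (\int[normal_prob 0 (Num.sqrt s)]_x f x = \int[leb]_x (f x * (ndens s x)%:E))%E.
Proof.
move=> s0 mf f0; apply: (@ge0_integral_density _ RT R leb (normal_prob 0 (Num.sqrt s))) => //.
- by move=> x; exact/ltW/ndens_gt0.
- exact: measurable_ndens.
- by move=> A mA; apply: eq_integral => x _; rewrite normal_pdf_ndens.
Qed.

(** The Radon-Nikodym derivative, in the variable [t], of the pullback of the
    centred normal law of variance [s] by [t |-> k * t + v], with respect to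
    the centred normal law of variance [s']. Keeping two variances allows
    dilations to be treated together with shifts. *)
Definition naff k s s' t v : R :=
  k * Num.sqrt (s' / s) * expR (t ^+ 2 / (2 * s') - (k * t + v) ^+ 2 / (2 * s)).

Lemma naffE k s s' t v : 0 < s -> 0 < s' -> 0 < k ->
  k * ndens s (k * t + v) = naff k s s' t v * ndens s' t.
Proof.
move=> s0 s'0 k0; rewrite /ndens /naff.
have -> : expR (- (k * t + v) ^+ 2 / (2 * s)) =
    expR (t ^+ 2 / (2 * s') - (k * t + v) ^+ 2 / (2 * s)) * expR (- t ^+ 2 / (2 * s')).
  by rewrite -expRD; congr expR; ring.
have -> : (Num.sqrt (2 * pi * s))^-1 = Num.sqrt (s' / s) * (Num.sqrt (2 * pi * s'))^-1.
  rewrite -!sqrtrV ?mulr_ge0 ?pi_ge0 ?(ltW s0) ?(ltW s'0)//.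
  rewrite -sqrtrM ?divr_ge0 ?(ltW s0) ?(ltW s'0)//.
  by move: (pi : R) (pi_gt0 R) => p p0; congr Num.sqrt; field; rewrite !gt_eqF.
ring.
Qed.

Lemma naff_ge0 k s s' t v : 0 < k -> 0 <= naff k s s' t v.
Proof. by move=> k0; rewrite !mulr_ge0 ?expR_ge0 ?sqrtr_ge0 ?ltW. Qed.

Lemma measurable_naff k s s' v : measurable_fun setT (fun t => naff k s s' t v).
Proof.
apply: measurable_funM => //; apply: measurableT_comp => //.
apply: measurable_funB; apply: measurable_funM => //.
apply: measurable_funX; apply: measurable_funD => //; exact: measurable_funM.
Qed.

Lemma integral_normal_affine k s s' v (f : R -> \bar R) :
  0 < k -> 0 < s -> 0 < s' -> measurable_fun setT f -> (forall x, 0 <= f x)%E ->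
  (\int[normal_prob 0 (Num.sqrt s)]_x f x =
   \int[normal_prob 0 (Num.sqrt s')]_t (f (k * t + v)%R * (naff k s s' t v)%:E))%E.
Proof.
move=> k0 s0 s'0 mf f0.
have ma : measurable_fun setT (fun t : RT => k * t + v : RT).
  by apply: measurable_funD => //; exact: measurable_funM.
have mfa : measurable_fun setT (fun t : RT => f (k * t + v)) by exact: measurableT_comp mf ma.
rewrite [LHS](integral_normal s0 mf f0) [RHS](integral_normal s'0); last 2 first.
- by apply: emeasurable_funM => //; apply/measurable_EFinP; exact: measurable_naff.
- by move=> x; rewrite mule_ge0// lee_fin naff_ge0.
rewrite (@ge0_integral_affine _ k v)//; last 2 first.
- by apply: emeasurable_funM => //; apply/measurable_EFinP; exact: measurable_ndens.
- by move=> x; rewrite mule_ge0// lee_fin ltW// ndens_gt0.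
rewrite -ge0_integralZl//; last 3 first.
- apply: emeasurable_funM => //; apply/measurable_EFinP.
  exact: measurableT_comp (measurable_ndens s) ma.
- by move=> x _; rewrite mule_ge0// lee_fin ltW// ndens_gt0.
- by rewrite lee_fin ltW.
apply: eq_integral => x _.
by rewrite muleCA -EFinM (naffE x v s0 s'0 k0) EFinM muleA.
Qed.

End normal_change.

Section gaussian_induction.
Context (R : realType).
Local Notation RT := (measurableTypeR R).
Implicit Types (s k x : R).

Lemma ge0_integral_gaussianS s n (f : n.+1.-tuple RT -> \bar R) :
  measurable_fun setT f -> (forall t, 0 <= f t)%E ->
  (\int[gaussian s n.+1]_t f t =
   \int[normal_prob 0 (Num.sqrt s)]_x \int[gaussian s n]_t f [tuple of x :: t])%E.
Proof.
move=> mf f0 /=.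
rewrite /distribution ge0_integral_pushforward//.
rewrite [LHS](fubini_tonelli1 (f \o _))//.
  by apply: measurableT_comp => //; exact: measurable_tuple_cons.
by move=> x; exact: f0.
Qed.

(** The law of [taff] under a Gaussian has a density which is a product of
    one-dimensional ones; this is where finite dimensional Cameron-Martin
    comes from. *)
Definition taff n k (v : 'I_n -> R) (t : n.-tuple RT) : n.-tuple RT :=
  [tuple k * tnth t i + v i | i < n].

Lemma measurable_taff n k (v : 'I_n -> R) : measurable_fun setT (taff k v).
Proof.
apply/measurable_fun_tnthP => i.
rewrite (_ : _ \o _ = fun t => (k * tnth t i + v i : RT)); last first.
  by apply/funext => t /=; rewrite tnth_mktuple.
apply: measurable_funD => //; apply: measurable_funM => //; exact: measurable_tnth.
Qed.

Lemma measurable_prod_tnth n (r : 'I_n -> R -> R) :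
  (forall i, measurable_fun setT (r i)) ->
  measurable_fun setT (fun t : n.-tuple RT => \prod_(i < n) r i (tnth t i)).
Proof.
move=> mr; apply: measurable_prod => i _.
exact: measurableT_comp (mr i) (measurable_tnth i).
Qed.

Lemma measurable_taff_naff n k s s' (v : 'I_n -> R) (f : n.-tuple RT -> \bar R) :
  measurable_fun setT f -> measurable_fun setT (fun t : n.-tuple RT =>
    (f (taff k v t) * (\prod_(i < n) naff k s s' (tnth t i) (v i))%:E))%E.
Proof.
move=> mf; apply: emeasurable_funM.
  exact: (measurableT_comp mf (measurable_taff k v)).
apply/measurable_EFinP; apply: (@measurable_prod_tnth n (fun i x => naff k s s' x (v i))) => i.
exact: measurable_naff.
Qed.

(** By induction on the dimension, the one-dimensional change of variable
    being applied to the first coordinate. *)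
Lemma ge0_integral_gaussian_affine n k s s' (v : 'I_n -> R) (f : n.-tuple RT -> \bar R) :
  0 < k -> 0 < s -> 0 < s' -> measurable_fun setT f -> (forall t, 0 <= f t)%E ->
  (\int[gaussian s n]_t f t =
   \int[gaussian s' n]_t (f (taff k v t) * (\prod_(i < n) naff k s s' (tnth t i) (v i))%:E))%E.
Proof.
move=> k0 s0 s'0.
elim: n v f => [|n IH] v f mf f0.
  rewrite [LHS]integral_dirac// [RHS]integral_dirac//; last exact: measurable_taff_naff.
  rewrite !diracT !mul1e big_ord0 mule1; congr f; exact: esym (tuple0 _).
have mF : measurable_fun setT (fun t : n.+1.-tuple RT =>
    (f (taff k v t) * (\prod_(i < n.+1) naff k s s' (tnth t i) (v i))%:E))%E.
  exact: measurable_taff_naff.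
have F0 t : (0 <= (f (taff k v t) * (\prod_(i < n.+1) naff k s s' (tnth t i) (v i))%:E))%E.
  by rewrite mule_ge0// lee_fin prodr_ge0// => i _; exact: naff_ge0.
rewrite [LHS](ge0_integral_gaussianS s mf f0) [RHS](ge0_integral_gaussianS s' mF F0).
have mfc x : measurable_fun setT (fun t : n.-tuple RT => f [tuple of x :: t]).
  by apply: measurableT_comp mf _; exact: measurable_cons.
have mi : measurable_fun setT (fun x : RT => (\int[gaussian s n]_t f [tuple of x :: t])%E).
  apply: (@measurable_fun_fubini_tonelli_F _ _ _ _ _ _ (fun p : RT * n.-tuple RT => f [tuple of p.1 :: p.2])) => //.
  by apply: measurableT_comp mf _; exact: measurable_tuple_cons.
rewrite [LHS](integral_normal_affine (v ord0) k0 s0 s'0 mi); last first.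
  by move=> x; exact: integral_ge0.
apply: eq_integral => x _.
rewrite (IH (fun i => v (lift ord0 i)) _ (mfc _))//.
rewrite -ge0_integralZr//; last 3 first.
- exact: (measurable_taff_naff k s s' (fun i => v (lift ord0 i)) (mfc (k * x + v ord0))).
- by move=> t _; rewrite mule_ge0// lee_fin prodr_ge0// => i _; exact: naff_ge0.
- by rewrite lee_fin naff_ge0.
apply: eq_integral => t _.
rewrite -muleA -EFinM; congr (f _ * _%:E)%E; last first.
  rewrite big_ord_recl mulrC; congr (_ * _).
  by apply: eq_bigr => i _; rewrite [in RHS](tnthS).
apply: eq_from_tnth => i; rewrite [in RHS]tnth_mktuple.
have [j ->|->] := unliftP ord0 i; last by rewrite !tnth0.
by rewrite !tnthS tnth_mktuple.
Qed.

End gaussian_induction.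

(** * Real-valued integrals: domination, transfer, Fubini *)

Section real_integrals.
Context d1 d2 (T1 : measurableType d1) (T2 : measurableType d2) (R : realType).

Lemma intble_le (mu : {measure set T1 -> \bar R}) (f g : T1 -> R) :
  measurable_fun setT f -> mu.-integrable setT (EFin \o g) ->
  (forall x, `|f x| <= g x) -> mu.-integrable setT (EFin \o f).
Proof.
move=> mf ig fg; apply: le_integrable ig => //; first exact/measurable_EFinP.
by move=> x _ /=; rewrite lee_fin (le_trans (fg x))// ler_norm.
Qed.

Lemma intble_bounded (mu : probability T1 R) (f : T1 -> R) (C : R) :
  measurable_fun setT f -> (forall x, `|f x| <= C) ->
  mu.-integrable setT (EFin \o f).
Proof.
move=> mf fC; apply: (@intble_le mu f (cst C)) => //.
by apply: finite_measure_integrable_cst.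
Qed.

Section transfer.
Variables (m1 : {measure set T1 -> \bar R}) (m2 : {measure set T2 -> \bar R}).
Variables (phi : T2 -> T1) (rho : T2 -> R).
Hypotheses (mphi : measurable_fun setT phi) (mrho : measurable_fun setT rho).
Hypothesis rho0 : forall t, 0 <= rho t.
Hypothesis E : forall F : T1 -> \bar R, measurable_fun setT F ->
  (forall x, 0 <= F x)%E ->
  (\int[m1]_x F x = \int[m2]_t (F (phi t) * (rho t)%:E))%E.

Lemma integrable_transfer (f : T1 -> R) : measurable_fun setT f ->
  m1.-integrable setT (EFin \o f) <->
  m2.-integrable setT (EFin \o (fun t => f (phi t) * rho t)).
Proof.
move=> mf.
have mg : measurable_fun setT (fun t => f (phi t) * rho t).
  by apply: measurable_funM => //; exact: measurableT_comp mf mphi.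
have -> : m2.-integrable setT (EFin \o (fun t => f (phi t) * rho t)) <->
    (\int[m2]_t `|(f (phi t) * rho t)%:E| < +oo)%E.
  split=> [/integrableP[] //|h]; apply/integrableP; split => //.
  exact/measurable_EFinP.
have -> : (\int[m2]_t `|(f (phi t) * rho t)%:E|)%E = (\int[m1]_x `|(f x)%:E|)%E.
  rewrite (E (F := fun x => `|(f x)%:E|%E)) //; last first.
    by apply: measurableT_comp => //; exact/measurable_EFinP.
  by apply: eq_integral => t _ /=; rewrite -EFinM normrM (ger0_norm (rho0 t)).
split=> [/integrableP[] //|h]; apply/integrableP; split => //.
exact/measurable_EFinP.
Qed.

Lemma Rintegral_transfer (f : T1 -> R) : measurable_fun setT f ->
  \int[m1]_x f x = \int[m2]_t (f (phi t) * rho t).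
Proof.
move=> mf; rewrite /Rintegral; congr fine.
rewrite integralE [RHS]integralE.
rewrite E//; last by apply: measurable_funepos; exact/measurable_EFinP.
rewrite E//; last by apply: measurable_funeneg; exact/measurable_EFinP.
congr (_ - _)%E; apply: eq_integral => t _.
  by rewrite !funeposE -!EFin_max -EFinM maxr_pMl// mul0r.
by rewrite !funenegE -!EFinN -!EFin_max -EFinM maxr_pMl// mul0r mulNr.
Qed.

End transfer.

Section fubini.
Variables (m1 : {sigma_finite_measure set T1 -> \bar R}).
Variables (m2 : {sigma_finite_measure set T2 -> \bar R}).

Lemma Rintegral_fubini (f : T1 * T2 -> R) :
  (m1 \x m2)%E.-integrable setT (EFin \o f) ->
  \int[(m1 \x m2)%E]_z f z = \int[m1]_x \int[m2]_y f (x, y).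
Proof.
move=> fi; rewrite {1}/Rintegral -(integral12_prod_meas1 fi) [RHS]/Rintegral.
congr fine; apply: ae_eq_integral => //.
- exact: (measurable_fubini_F fi).
- apply/measurable_EFinP; apply: measurableT_comp => //.
  exact: (measurable_fubini_F fi).
have [N [mN N0 hN]] := ae_integrable1 fi.
exists N; split => // x /= hx; apply: hN => /= xi; apply: hx => _.
rewrite /fubini_F /Rintegral fineK//.
by apply: integrable_fin_num.
Qed.

Lemma integrable_prodP (f : T1 * T2 -> R) : measurable_fun setT f ->
  (\int[m1]_x \int[m2]_y (`|f (x, y)|)%:E < +oo)%E ->
  (m1 \x m2)%E.-integrable setT (EFin \o f).
Proof.
move=> mf h; have mf' : measurable_fun setT (EFin \o f) by exact/measurable_EFinP.
exact/(integrable12ltyP m1 m2 mf').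
Qed.

End fubini.
End real_integrals.

(** * Gaussian integrals on the line *)

Section gaussian1.
Context (R : realType).
Local Notation RT := (measurableTypeR R).
Variable s : R.
Hypothesis s0 : 0 < s.
Local Notation N := (normal_prob 0 (Num.sqrt s)).

Lemma naff_shiftE v t : naff 1 s s t v = expR (- t * v / s - v ^+ 2 / (2 * s)).
Proof.
rewrite /naff divff ?gt_eqF// sqrtr1 !mul1r; congr expR; field; exact: lt0r_neq0.
Qed.

Lemma integrable_normal_expR c : N.-integrable setT (EFin \o (fun x => expR (c * x))).
Proof.
have mf : measurable_fun setT (fun x : RT => expR (c * x)).
  by apply: measurableT_comp => //; exact: measurable_funM.
apply/integrableP; split; first exact/measurable_EFinP.
have one0 : forall x : R, (0 <= (cst 1 : R -> \bar R) x)%E.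
  by move=> x; rewrite lee_fin ler01.
have := @integral_normal_affine R 1 s s (- c * s) (cst 1)%E ltr01 s0 s0
  (measurable_cst _) one0.
rewrite integral_cst// [X in (_ * X)%E]probability_setT mule1 => /esym.
under eq_integral do rewrite naff_shiftE mul1e.
move=> e1.
have -> : (\int[N]_x `|(EFin \o (fun x => expR (c * x))) x| =
    \int[N]_x ((expR ((- c * s) ^+ 2 / (2 * s)))%:E *
      (expR (- x * (- c * s) / s - (- c * s) ^+ 2 / (2 * s)))%:E))%E.
  apply: eq_integral => x _ /=.
  rewrite -EFinM -expRD ger0_norm ?expR_ge0//; congr ((expR _)%:E); field.
  exact: lt0r_neq0.
rewrite ge0_integralZl//.
- by rewrite e1 mule1 ltry.
- apply/measurable_EFinP; apply: measurableT_comp => //.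
  by apply: measurable_funB => //; do 2 apply: measurable_funM => //.
Qed.

Lemma integrable_normal_expR_abs c :
  N.-integrable setT (EFin \o (fun x => expR (c * `|x|))).
Proof.
have i1 := integrable_normal_expR c.
have i2 := integrable_normal_expR (- c).
have : N.-integrable setT (EFin \o (fun x => expR (c * x) + expR (- c * x))).
  by rewrite (_ : EFin \o _ = (EFin \o (fun x => expR (c * x))) \+
    (EFin \o (fun x => expR (- c * x))))%E//; exact: integrableD.
move=> i12; apply: (intble_le _ i12).
  by apply: measurableT_comp => //; apply: measurable_funM.
move=> x; rewrite ger0_norm ?expR_ge0//.
have [x0|x0] := ger0P x; first by rewrite lerDl expR_ge0.
by rewrite mulrN -mulNr lerDr expR_ge0.
Qed.

End gaussian1.

Section stein.
Context (R : realType).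
Local Notation RT := (measurableTypeR R).
Variable s : R.
Hypothesis s0 : 0 < s.
Local Notation N := (normal_prob 0 (Num.sqrt s)).
Variables (h h' : R -> R) (C c : R).
Hypotheses (C0 : 0 <= C) (c0 : 0 <= c).
Hypothesis dh : forall x, is_derive x (1 : R) h (h' x).
Hypothesis mh' : measurable_fun [set: RT] h'.
Hypothesis hC : forall x, `|h x| <= C * expR (c * `|x|).
Hypothesis h'C : forall x, `|h' x| <= C * expR (c * `|x|).

Let mh : measurable_fun [set: RT] h.
Proof.
apply: continuous_measurable_fun => x.
by apply: differentiable_continuous; apply/derivable1_diffP.
Qed.

Let w (v x : R) := expR (- x * v / s - v ^+ 2 / (2 * s)).

Let dw (x v : R) : is_derive v (1 : R) (w ^~ x) ((- (x + v) / s) * w v x).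
Proof.
rewrite /w; apply: is_derive_eq.
rewrite /GRing.scale/= mulrC; congr (_ * _); field; exact: lt0r_neq0.
Qed.

Let mw v : measurable_fun setT (w v).
Proof.
apply: measurableT_comp => //; apply: measurable_funB => //.
by do 2 apply: measurable_funM => //.
Qed.

Let K := C * expR c * (1 + s^-1).
Let c' := c + s^-1 + 1.

Let boundh v x : -1 < v < 1 -> forall y, `|y| <= C * expR (c * `|x + v|) ->
  `|y * w v x| * (1 + (`|x| + 1) / s) <= K * expR (c' * `|x|).
Proof.
move=> /andP[v1 v2] y hy.
have v1' : `|v| <= 1 by rewrite ler_norml !ltW.
have wle : w v x <= expR (s^-1 * `|x|).
  rewrite ler_expR.
  have : - x * v / s <= s^-1 * `|x|.
    rewrite mulrC ler_pM2l ?invr_gt0//.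
    rewrite (le_trans (ler_norm _))// normrM normrN ler_piMr//.
  have : 0 <= v ^+ 2 / (2 * s) by rewrite divr_ge0 ?sqr_ge0// mulr_ge0// ltW.
  lra.
have yle : `|y| <= C * (expR c * expR (c * `|x|)).
  rewrite (le_trans hy)// ler_wpM2l// -expRD ler_expR.
  rewrite (_ : c + c * `|x| = c * (`|x| + 1)); last by rewrite mulrDr mulr1 addrC.
  rewrite ler_wpM2l//.
  by rewrite (le_trans (ler_normD _ _))// lerD2l.
have xle : 1 + (`|x| + 1) / s <= (1 + s^-1) * expR `|x|.
  have := expR_ge1Dx `|x|; move: (normr_ge0 x); move: `|x| => z z0 hz.
  rewrite (@le_trans _ _ ((1 + s^-1) * (1 + z)))//.
    by move: (s^-1) => i; nra.
  by rewrite ler_wpM2l// addr_ge0// invr_ge0 ltW.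
rewrite normrM (ger0_norm (expR_ge0 _)).
have -> : K * expR (c' * `|x|) =
    (C * (expR c * expR (c * `|x|))) * expR (s^-1 * `|x|) * ((1 + s^-1) * expR `|x|).
  by rewrite /K /c' !mulrDl mul1r !expRD; ring.
apply: ler_pM => //.
- by rewrite addr_ge0// divr_ge0 ?addr_ge0// ltW.
- by apply: ler_pM => //; rewrite ?mulr_ge0 ?expR_ge0.
Qed.

Let Gint : N.-integrable setT (EFin \o (fun x => K * expR (c' * `|x|))).
Proof.
rewrite (_ : EFin \o _ = fun x => (K%:E * (EFin \o (fun x => expR (c' * `|x|))%R) x)%E)//.
by apply: integrableZl => //; exact: integrable_normal_expR_abs.
Qed.

(** The integral of [h (x + v)] against the shifted density does not depend on
    [v]; the formula is its derivative at v = 0, computed under the integral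
    sign. No antiderivative and no boundary term is involved. *)
Lemma gaussian_integration_by_parts :
  N.-integrable setT (EFin \o h') /\
  N.-integrable setT (EFin \o (fun x => x * h x)) /\
  s * \int[N]_x h' x = \int[N]_x (x * h x).
Proof.
pose f v (x : RT) := h (x + v) * w v x.
have bnd v x : -1 < v < 1 -> `|f v x| <= K * expR (c' * `|x|).
  move=> v1; apply: le_trans (boundh v1 (hC (x + v))).
  by rewrite ler_peMr// lerDl divr_ge0 ?addr_ge0// ltW.
have mf v : measurable_fun setT (f v).
  have mt : measurable_fun setT (fun x : RT => x + v : RT) by exact: measurable_funD.
  by apply: measurable_funM (mw v); exact: (measurableT_comp mh mt).
have intf v : -1 < v < 1 -> N.-integrable setT (EFin \o f v).
  by move=> v1; apply: (intble_le (mf v) Gint) => x; exact: bnd.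
have df v x : is_derive v (1 : R) (f ^~ x)
    (h' (x + v) * w v x - (x + v) / s * (h (x + v) * w v x)).
  have dhx : is_derive v (1 : R) (fun v => h (x + v)) (h' (x + v)).
    have g1 : is_derive v (1 : R) (fun v => x + v) 1.
      by apply: is_derive_eq; rewrite add0r mulr1.
    by have := is_derive1_comp (dh (x + v)) g1; rewrite mulr1.
  apply: is_derive_eq; rewrite /GRing.scale/= -/(w v x); field; exact: lt0r_neq0.
have i0 : -1 < (0 : R) < 1 by rewrite ltrN10 ltr01.
have dbnd v x : -1 < v < 1 ->
    `|h' (x + v) * w v x - (x + v) / s * (h (x + v) * w v x)| <= 2 * K * expR (c' * `|x|).
  move=> v1.
  have b1 : `|h' (x + v) * w v x| <= K * expR (c' * `|x|).
    apply: le_trans (boundh v1 (h'C (x + v))).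
    by rewrite ler_peMr// lerDl divr_ge0 ?addr_ge0// ltW.
  have b2 : `|(x + v) / s * (h (x + v) * w v x)| <= K * expR (c' * `|x|).
    apply: le_trans (boundh v1 (hC (x + v))).
    rewrite normrM mulrC ler_wpM2l// normrM normfV (gtr0_norm s0).
    apply: (@le_trans _ _ ((`|x| + 1) / s)); last by rewrite lerDr.
    rewrite ler_wpM2r ?invr_ge0 ?(ltW s0)// (le_trans (ler_normD _ _))// lerD2l.
    by move: v1 => /andP[v1 v2]; rewrite ler_norml !ltW.
  apply: le_trans (ler_normB _ _) _; apply: le_trans (lerD b1 b2) _.
  by rewrite -mulrDl mulr_natl mulr2n.
have G2 : N.-integrable setT (EFin \o (fun x : R => 2 * K * expR (c' * `|x|))).
  rewrite (_ : EFin \o _ = fun x => (2%:E * (EFin \o (fun x : R => K * expR (c' * `|x|))%R) x)%E).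
    exact: integrableZl.
  by apply/funext => x /=; rewrite -mulrA EFinM.
have K0 : 0 <= K.
  by rewrite !mulr_ge0 ?expR_ge0// addr_ge0// invr_ge0 ltW.
have cstF v : \int[N]_x f v x = \int[N]_x h x.
  have mt : measurable_fun setT (fun t : RT => 1 * t + v : RT).
    by apply: measurable_funD => //; exact: measurable_funM.
  have r0 t : 0 <= naff 1 s s t v by exact: naff_ge0.
  rewrite [RHS](@Rintegral_transfer _ _ RT RT R N N (fun t => 1 * t + v)
    (fun t => naff 1 s s t v) r0)//.
    by apply: eq_Rintegral => t _; rewrite /f naff_shiftE// mul1r.
  by move=> F mF F0; exact: integral_normal_affine.
have D v x : partial1of2 f v x = h' (x + v) * w v x - (x + v) / s * (h (x + v) * w v x).
  by rewrite partial1of2E; have [_ ->] := df v x.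
have I0 : `]-1, 1[%classic (0 : R) by rewrite /= in_itv.
have Hi x : `]-1, 1[%classic x -> N.-integrable setT (EFin \o f x).
  by rewrite /= in_itv/= => v1; exact: intf.
have Hd x y : `]-1, 1[%classic x -> setT y -> derivable (f ^~ y) x 1.
  by move=> _ _; have [] := df x y.
have HG (y : R) : 0 <= 2 * K * expR (c' * `|y|).
  exact: mulr_ge0 (mulr_ge0 (ler0n _ 2) K0) (expR_ge0 _).
have Hb x y : `]-1, 1[%classic x -> setT y ->
    `|partial1of2 f x y| <= 2 * K * expR (c' * `|y|).
  by rewrite /= in_itv/= => v1 _; rewrite D; exact: dbnd.
have := @differentiation_under_integral R _ RT N f setT measurableT 0 (-1) 1
  I0 Hi Hd (fun x => 2 * K * expR (c' * `|x|)) HG G2 Hb.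
rewrite (_ : (fun _ => _) = cst (\int[N]_x h x)); last first.
  by apply/funext => v; exact: cstF.
rewrite derive1_cst => /esym.
under eq_Rintegral do rewrite D /w addr0 mulr0 mul0r expr0n/= mul0r subr0 expR0 !mulr1.
have ih' : N.-integrable setT (EFin \o h').
  apply: (intble_le mh' Gint) => x.
  have := @boundh 0 x i0 (h' x); rewrite addr0 => /(_ (h'C x)).
  apply: le_trans; rewrite /w mulr0 mul0r expr0n/= mul0r subr0 expR0 mulr1.
  by rewrite ler_peMr// lerDl divr_ge0 ?addr_ge0// ltW.
have ixh : N.-integrable setT (EFin \o (fun x => x / s * h x)).
  have mxh : measurable_fun setT (fun x : RT => x / s * h x).
    by apply: measurable_funM => //; exact: measurable_funM.
  apply: (intble_le mxh Gint) => x.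
  have := @boundh 0 x i0 (h x); rewrite addr0 => /(_ (hC x)).
  apply: le_trans; rewrite /w mulr0 mul0r expr0n/= mul0r subr0 expR0 mulr1.
  rewrite normrM mulrC ler_wpM2l// normrM normfV (gtr0_norm s0).
  apply: (@le_trans _ _ ((`|x| + 1) / s)); last by rewrite lerDr.
  by rewrite ler_wpM2r ?invr_ge0 ?(ltW s0)// lerDl.
rewrite RintegralB// => /eqP; rewrite subr_eq0 => /eqP ->.
split=> //.
have E : (fun x => x * h x) = (fun x => s * (x / s * h x)).
  by apply/funext => x; field; exact: lt0r_neq0.
rewrite E; split.
  rewrite (_ : EFin \o _ = fun x => (s%:E * (EFin \o (fun x => x / s * h x)%R) x)%E)//.
  exact: integrableZl.
by rewrite RintegralZl.
Qed.

End stein.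

Section charfun1.
Context (R : realType).
Local Notation RT := (measurableTypeR R).
Variable s : R.
Hypothesis s0 : 0 < s.
Local Notation N := (normal_prob 0 (Num.sqrt s)).

Lemma measurable_cos_affine (th q : R) :
  measurable_fun [set: RT] (fun x : RT => cos (th + q * x)).
Proof.
apply: continuous_measurable_fun => x.
by apply: differentiable_continuous; apply/derivable1_diffP.
Qed.

Lemma measurable_sin_affine (th q : R) :
  measurable_fun [set: RT] (fun x : RT => sin (th + q * x)).
Proof.
apply: continuous_measurable_fun => x.
by apply: differentiable_continuous; apply/derivable1_diffP.
Qed.

Lemma integrable_cos_normal (th q : R) :
  N.-integrable setT (EFin \o (fun x => cos (th + q * x))).
Proof.
apply: (intble_bounded (C := 1) _ (measurable_cos_affine th q)) => x.
by rewrite ler_norml cos_geN1 cos_le1.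
Qed.

Lemma normal_x_sin (th q : R) :
  N.-integrable setT (EFin \o (fun x => x * sin (th + q * x))) /\
  \int[N]_x (x * sin (th + q * x)) = s * q * \int[N]_x cos (th + q * x).
Proof.
have dh x : is_derive x (1 : R) (fun x => sin (th + q * x)) (q * cos (th + q * x)).
  by apply: is_derive_eq; rewrite /GRing.scale/=; ring.
have C0 : 0 <= 1 + `|q| by rewrite addr_ge0.
have sb (y : R) : `|sin y| <= 1 by rewrite ler_norml sin_geN1 sin_le1.
have cb (y : R) : `|cos y| <= 1 by rewrite ler_norml cos_geN1 cos_le1.
have mh' : measurable_fun [set: RT] (fun x : RT => q * cos (th + q * x)).
  by apply: measurable_funM => //; exact: measurable_cos_affine.
have [||_ [ixs E]] := gaussian_integration_by_parts s0 C0 (lexx 0) dh mh'.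
- by move=> x; rewrite mul0r expR0 mulr1 (le_trans (sb _))// lerDl.
- move=> x; rewrite mul0r expR0 mulr1 normrM.
  by apply: (@le_trans _ _ (`|q| * 1)); rewrite ?ler_wpM2l// mulr1 lerDr.
split=> //; rewrite -E -mulrA; congr (s * _); rewrite RintegralZl//.
exact: integrable_cos_normal.
Qed.

(** Both sides, as functions of the frequency, solve the same linear
    differential equation, by Gaussian integration by parts. The phase [th]
    makes the sine transform a special case. *)
Lemma normal_charfun (th q : R) :
  \int[N]_x cos (th + q * x) = cos th * expR (- (s * q ^+ 2 / 2)).
Proof.
pose F q := \int[N]_x cos (th + q * x).
have absint : N.-integrable setT (EFin \o (fun x : RT => expR (1 * `|x|))).
  exact: integrable_normal_expR_abs.
have dF p : is_derive p (1 : R) F (- (s * p) * F p).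
  have dc (r x : R) : is_derive r (1 : R) (fun r => cos (th + r * x)) (- (x * sin (th + r * x))).
    by apply: is_derive_eq; rewrite /GRing.scale/=; ring.
  pose f (r x : R) := cos (th + r * x).
  have D v x : partial1of2 f v x = - (x * sin (th + v * x)).
    by rewrite partial1of2E; have [_ ->] := dc v x.
  have I0 : `]p - 1, p + 1[%classic p.
    by rewrite /= in_itv/= ltrBlDr ltrDl ltr01.
  have Hi x : `]p - 1, p + 1[%classic x -> N.-integrable setT (EFin \o f x).
    by move=> _; exact: integrable_cos_normal.
  have Hd r x : `]p - 1, p + 1[%classic r -> [set: RT] x -> derivable (f ^~ x) r 1.
    by move=> _ _; have [] := dc r x.
  have HG (y : R) : 0 <= expR (1 * `|y|) by exact: expR_ge0.
  have Hb r x : `]p - 1, p + 1[%classic r -> [set: RT] x ->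
      `|partial1of2 f r x| <= expR (1 * `|x|).
    move=> _ _; rewrite D normrN normrM mul1r.
    apply: (@le_trans _ _ (`|x| * 1)).
      by rewrite ler_wpM2l// ler_norml sin_geN1 sin_le1.
    by rewrite mulr1 (le_trans _ (expR_ge1Dx _))// lerDr.
  have H1 := @differentiation_under_integral R _ RT N f setT measurableT p _ _
    I0 Hi Hd _ HG absint Hb.
  have H2 := @derivable_under_integral R _ RT N f setT measurableT p _ _
    I0 Hi Hd _ HG absint Hb.
  split=> //; rewrite -derive1E H1.
  have [ixs E] := normal_x_sin th p.
  rewrite [RHS]mulNr -E; under eq_Rintegral do rewrite D -mulN1r.
  by rewrite RintegralZl// mulN1r.
(* constant, because F' q = - s q F q *)
pose G q := F q * expR (s * q ^+ 2 / 2).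
have dG p : is_derive p (1 : R) G 0.
  by rewrite /G; apply: is_derive_eq; rewrite /GRing.scale/=; field.
have := is_derive_0_is_cst q 0 dG.
rewrite /G /F expr0n/= mulr0 mul0r expR0 mulr1.
under [X in _ = X -> _]eq_Rintegral do rewrite mul0r addr0.
rewrite Rintegral_cst// [X in fine X]probability_setT mulr1 => <-.
by rewrite -[RHS]mulrA -expRD subrr expR0 mulr1.
Qed.

Lemma normal_x2_cos (q : R) :
  N.-integrable setT (EFin \o (fun x => x ^+ 2 * cos (q * x))) /\
  \int[N]_x (x ^+ 2 * cos (q * x)) = s * (1 - s * q ^+ 2) * expR (- (s * q ^+ 2 / 2)).
Proof.
have dh x : is_derive x (1 : R) (fun x => x * cos (0 + q * x))
    (cos (0 + q * x) - q * (x * sin (0 + q * x))).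
  by apply: is_derive_eq; rewrite /GRing.scale/=; ring.
have C0 : 0 <= 1 + `|q| by rewrite addr_ge0.
have sb (y : R) : `|sin y| <= 1 by rewrite ler_norml sin_geN1 sin_le1.
have cb (y : R) : `|cos y| <= 1 by rewrite ler_norml cos_geN1 cos_le1.
have mh' : measurable_fun [set: RT] (fun x : RT => cos (0 + q * x) - q * (x * sin (0 + q * x))).
  apply: measurable_funB; first exact: measurable_cos_affine.
  by do 2 apply: measurable_funM => //; exact: measurable_sin_affine.
have xe (x : R) : 1 + `|x| <= expR (1 * `|x|) by rewrite mul1r expR_ge1Dx.
have [||_ [ixs E]] := gaussian_integration_by_parts s0 C0 ler01 dh mh'.
- move=> x; apply: (@le_trans _ _ (1 * expR (1 * `|x|))); last first.
    by rewrite ler_wpM2r ?expR_ge0// lerDl.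
  rewrite mul1r (le_trans _ (xe x))// normrM (@le_trans _ _ (`|x| * 1))//.
    by rewrite ler_wpM2l.
  by rewrite mulr1 lerDr.
- move=> x; apply: (@le_trans _ _ ((1 + `|q|) * (1 + `|x|))); last first.
    by rewrite ler_wpM2l.
  rewrite (le_trans (ler_normB _ _))//.
  apply: (@le_trans _ _ (1 + `|q| * (`|x| * 1))).
    by rewrite lerD// !normrM !ler_wpM2l.
  by rewrite mulr1 mulrDl !mul1r mulrDr mulr1; have := normr_ge0 q; have := normr_ge0 x; lra.
have EE : (fun x => x * (x * cos (0 + q * x))) = (fun x => x ^+ 2 * cos (q * x)).
  by apply/funext => x; rewrite mulrA -expr2 add0r.
rewrite EE in ixs E; split => //.
have [ixsin E2] := normal_x_sin 0 q.
rewrite -E RintegralB//; last 2 first.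
- exact: integrable_cos_normal.
- rewrite (_ : EFin \o _ = fun x => (q%:E * (EFin \o (fun x => x * sin (0 + q * x))%R) x)%E)//.
  exact: integrableZl.
by rewrite RintegralZl// E2 normal_charfun cos0; ring.
Qed.

End charfun1.

(** * Gaussian integrals on tuples *)

Section gaussian_n.
Context (R : realType).
Local Notation RT := (measurableTypeR R).

Lemma Rintegral_gaussianS (s : R) n (f : n.+1.-tuple RT -> R) :
  (gaussian s n.+1).-integrable setT (EFin \o f) ->
  \int[gaussian s n.+1]_t f t =
  \int[normal_prob 0 (Num.sqrt s)]_x \int[gaussian s n]_t f [tuple of x :: t].
Proof.
move=> fi.
have mf : measurable_fun setT f by apply/measurable_EFinP; exact: measurable_int fi.
have mtc : measurable_fun [set: RT * n.-tuple RT] (@tuple_cons R n).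
  exact: measurable_tuple_cons.
have fi' : (normal_prob 0 (Num.sqrt s) \x gaussian s n)%E.-integrable setT
    (EFin \o (fun p => f (tuple_cons p))).
  apply: integrable_prodP; first exact: (measurableT_comp mf mtc).
  move/integrableP : fi => [_].
  rewrite [X in (X < _)%E -> _]ge0_integral_gaussianS//; last first.
    by apply: measurableT_comp => //; exact/measurable_EFinP.
rewrite -(Rintegral_fubini fi') /Rintegral; congr fine.
rewrite [LHS](integral_pushforward mtc)//; exact/measurable_EFinP.
Qed.

Definition tdot n (a : 'I_n -> R) (t : n.-tuple RT) : R := \sum_(i < n) a i * tnth t i.

Lemma measurable_tdot n (a : 'I_n -> R) : measurable_fun setT (tdot a).
Proof.
apply: measurable_sum => i; apply: measurable_funM => //; exact: measurable_tnth.
Qed.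

Definition tnorm2 n (t : n.-tuple RT) : R := \sum_(i < n) tnth t i ^+ 2.

Lemma measurable_tnorm2 n : measurable_fun setT (@tnorm2 n).
Proof.
apply: measurable_sum => i; apply: measurable_funX; exact: measurable_tnth.
Qed.

Lemma measurable_cos_tdot n (th : R) (a : 'I_n -> R) :
  measurable_fun setT (fun t => cos (th + tdot a t)).
Proof.
apply: (@measurableT_comp _ _ _ _ RT _ (fun x : RT => cos x)).
  apply: continuous_measurable_fun; exact: continuous_cos.
by apply: measurable_funD => //; exact: measurable_tdot.
Qed.

Lemma gaussian_charfun (s : R) n (th : R) (a : 'I_n -> R) : 0 < s ->
  \int[gaussian s n]_t cos (th + tdot a t) =
  cos th * expR (- (s * (\sum_(i < n) a i ^+ 2) / 2)).
Proof.
move=> s0; elim: n th a => [|n IH] th a.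
  rewrite /Rintegral integral_dirac//; last first.
    by apply/measurable_EFinP; exact: measurable_cos_tdot.
  by rewrite diracT mul1e /= /tdot !big_ord0 addr0 mulr0 mul0r oppr0 expR0 mulr1.
rewrite Rintegral_gaussianS; last first.
  apply: (intble_bounded (C := 1) _ (measurable_cos_tdot th a)) => t.
  by rewrite ler_norml cos_geN1 cos_le1.
under eq_Rintegral => x _.
  under eq_Rintegral => t _.
    rewrite /tdot big_ord_recl tnth0 addrA.
    under eq_bigr do rewrite tnthS.
    over.
  rewrite (IH (th + a ord0 * x) (fun i => a (lift ord0 i))).
  over.
rewrite RintegralZr//; last exact: integrable_cos_normal.
rewrite normal_charfun// -[LHS]mulrA -expRD big_ord_recl; congr (_ * expR _); ring.
Qed.

Lemma ge0_integral_gaussian_prod (s : R) n (k : 'I_n -> RT -> R) :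
  (forall i, measurable_fun setT (k i)) -> (forall i x, 0 <= k i x) ->
  (\int[gaussian s n]_t (\prod_(i < n) k i (tnth t i))%:E =
   \prod_(i < n) \int[normal_prob 0 (Num.sqrt s)]_x (k i x)%:E)%E.
Proof.
elim: n k => [|n IH] k mk k0.
  rewrite [LHS]integral_dirac//; last first.
    by apply/measurable_EFinP; exact: measurable_prod_tnth.
  by rewrite diracT mul1e !big_ord0.
rewrite [LHS]ge0_integral_gaussianS//; last 2 first.
- by apply/measurable_EFinP; exact: measurable_prod_tnth.
- by move=> t; rewrite lee_fin prodr_ge0.
rewrite [RHS]big_ord_recl -(IH (fun i => k (lift ord0 i)))//.
rewrite -[RHS]ge0_integralZr//; last 3 first.
- exact/measurable_EFinP.
- by move=> x _; rewrite lee_fin.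
- by apply: integral_ge0 => t _; rewrite lee_fin prodr_ge0.
apply: eq_integral => x _.
rewrite -[RHS]ge0_integralZl//; last 3 first.
- apply/measurable_EFinP; apply: (measurable_prod_tnth (r := fun i => k (lift ord0 i))) => i; exact: mk.
- by move=> t _; rewrite lee_fin prodr_ge0.
- by rewrite lee_fin.
apply: eq_integral => t _.
rewrite big_ord_recl tnth0 EFinM; congr (_ * (_)%:E)%E.
by apply: eq_bigr => i _; rewrite tnthS.
Qed.

(** The weight exp (|t|^2 / h) turns the Gaussian of variance [h / 2] into a
    multiple of Lebesgue measure, for which this function is integrable:
    bounds by [decay] play the role of Lebesgue integrability. *)
Definition decay n (t : n.-tuple RT) : R := \prod_(i < n) (1 + tnth t i ^+ 2)^-1.

Lemma decay_gt0 n (t : n.-tuple RT) : 0 < decay t.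
Proof. by apply: prodr_gt0 => i _; rewrite invr_gt0 ltr_pwDl// sqr_ge0. Qed.

Lemma measurable_decay n : measurable_fun setT (@decay n).
Proof.
apply: (measurable_prod_tnth (r := fun _ x => (1 + x ^+ 2)^-1)) => i.
apply: measurable_funTS; apply: continuous_measurable_fun => x.
by apply: (@continuous_oneDsqrV R).
Qed.

Lemma normal_decay_fin (h : R) : 0 < h ->
  (\int[normal_prob 0 (Num.sqrt (h / 2))]_x (expR (x ^+ 2 / h) * (1 + x ^+ 2)^-1)%:E)%E
    \is a fin_num.
Proof.
move=> h0; have k0 (x : R) : 0 <= (1 + x ^+ 2)^-1 by rewrite invr_ge0 addr_ge0 ?sqr_ge0.
have mk : measurable_fun [set: RT] (fun x : RT => (1 + x ^+ 2)^-1).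
  apply: continuous_measurable_fun; exact: continuous_oneDsqrV.
have me : measurable_fun [set: RT] (fun x : RT => expR (x ^+ 2 / h)).
  by apply: measurableT_comp => //; apply: measurable_funM.
rewrite ge0_fin_numE; last first.
  by apply: integral_ge0 => x _; rewrite lee_fin mulr_ge0 ?expR_ge0.
rewrite integral_normal ?divr_gt0//; last 2 first.
- by apply/measurable_EFinP; exact: measurable_funM.
- by move=> x; rewrite lee_fin mulr_ge0 ?expR_ge0.
set c := (Num.sqrt (2 * pi * (h / 2)))^-1.
have c0 : 0 <= c by rewrite invr_ge0 sqrtr_ge0.
have E (x : R) : expR (x ^+ 2 / h) * (1 + x ^+ 2)^-1 * ndens (h / 2) x = c * (1 + x ^+ 2)^-1.
  rewrite /ndens -/c [LHS](_ : _ =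
    c * (1 + x ^+ 2)^-1 * (expR (x ^+ 2 / h) * expR (- x ^+ 2 / (2 * (h / 2))))); last by ring.
  rewrite -expRD (_ : x ^+ 2 / h + - x ^+ 2 / (2 * (h / 2)) = 0) ?expR0 ?mulr1//.
  by field; exact: lt0r_neq0.
under eq_integral do rewrite -EFinM E EFinM.
rewrite ge0_integralZl//; last 2 first.
- exact/measurable_EFinP.
- by move=> x _; rewrite lee_fin.
rewrite ge0_symfun_integralT//=; last 2 first.
- exact: continuous_oneDsqrV.
- by move=> x /=; rewrite sqrrN.
have I := @integral0y_oneDsqr R; rewrite /oneDsqr in I.
by rewrite -set_itvcy I -!EFinM ltry.
Qed.

Lemma integrable_decay (h : R) n : 0 < h ->
  (gaussian (h / 2) n).-integrable setT
    (EFin \o (fun t => expR (tnorm2 t / h) * decay t)).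
Proof.
move=> h0; apply/integrableP; split.
  apply/measurable_EFinP; apply: measurable_funM; last exact: measurable_decay.
  apply: measurableT_comp => //; apply: measurable_funM => //.
  exact: measurable_tnorm2.
pose k (i : 'I_n) (x : RT) := expR (x ^+ 2 / h) * (1 + x ^+ 2)^-1.
have mk i : measurable_fun setT (k i).
  apply: measurable_funM.
    by apply: measurableT_comp => //; apply: measurable_funM.
  apply: continuous_measurable_fun; exact: continuous_oneDsqrV.
have k0 i x : 0 <= k i x by rewrite mulr_ge0 ?expR_ge0// invr_ge0 addr_ge0 ?sqr_ge0.
under eq_integral => t _.
  rewrite /= ger0_norm; last by rewrite mulr_ge0 ?expR_ge0 ?ltW ?decay_gt0.
  rewrite /tnorm2 mulr_suml expR_sum -big_split/=.
  over.
rewrite (ge0_integral_gaussian_prod _ mk k0).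
rewrite -ge0_fin_numE; last by apply: prode_ge0 => i _; apply: integral_ge0 => x _; rewrite lee_fin.
by apply: prode_fin_num => i _; exact: normal_decay_fin.
Qed.

End gaussian_n.

Lemma Rintegral_dominated_cvg d (T : measurableType d) (R : realType)
  (mu : {measure set T -> \bar R}) (f_ : nat -> T -> R) (f g : T -> R) :
  (forall m, measurable_fun setT (f_ m)) -> mu.-integrable setT (EFin \o g) ->
  (forall m x, `|f_ m x| <= g x) -> (forall x, f_ m x @[m --> \oo] --> f x) ->
  \int[mu]_x f_ m x @[m --> \oo] --> \int[mu]_x f x.
Proof.
move=> mf ig fg fl.
have mfl : measurable_fun setT f.
  apply: (measurable_fun_cvg mf) => x _; exact: fl.
have fi : mu.-integrable setT (EFin \o f).
  apply: (intble_le mfl ig) => x.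
  have := @ler_cvg_to nat \oo _ R (fun m => `|f_ m x|) (cst (g x)) `|f x| (g x).
  apply; [exact: cvg_norm (fl x)|exact: cvg_cst|exact: nearW].
apply: fine_cvg; rewrite /Rintegral fineK; last exact: integrable_fin_num.
apply: (@dominated_cvg _ _ _ mu setT measurableT _ _ (EFin \o g)) => //.
- by move=> m; exact/measurable_EFinP.
- by move=> x _; apply: cvg_EFin; [exact: nearW|exact: fl].
- by move=> m x _; rewrite lee_fin.
Qed.

Section gaussian_real.
Context (R : realType).
Local Notation RT := (measurableTypeR R).

Lemma measurable_prod_naff (k s s' : R) n (v : 'I_n -> R) :
  measurable_fun setT (fun t : n.-tuple RT => \prod_(i < n) naff k s s' (tnth t i) (v i)).
Proof.
apply: (measurable_prod_tnth (r := fun i x => naff k s s' x (v i))) => i.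
exact: measurable_naff.
Qed.

Lemma Rintegral_gaussian_affine n (k s s' : R) (v : 'I_n -> R) (f : n.-tuple RT -> R) :
  0 < k -> 0 < s -> 0 < s' -> measurable_fun setT f ->
  \int[gaussian s n]_t f t =
  \int[gaussian s' n]_t (f (taff k v t) * (\prod_(i < n) naff k s s' (tnth t i) (v i))).
Proof.
move=> k0 s0 s'0 mf; apply: Rintegral_transfer => //.
- by move=> t; apply: prodr_ge0 => i _; exact: naff_ge0.
- by move=> F mF F0; exact: ge0_integral_gaussian_affine.
Qed.

Lemma integrable_gaussian_affine n (k s s' : R) (v : 'I_n -> R) (f : n.-tuple RT -> R) :
  0 < k -> 0 < s -> 0 < s' -> measurable_fun setT f ->
  (gaussian s n).-integrable setT (EFin \o f) <->
  (gaussian s' n).-integrable setT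
    (EFin \o (fun t => f (taff k v t) * (\prod_(i < n) naff k s s' (tnth t i) (v i)))).
Proof.
move=> k0 s0 s'0 mf; apply: integrable_transfer => //.
- exact: measurable_taff.
- exact: measurable_prod_naff.
- by move=> t; apply: prodr_ge0 => i _; exact: naff_ge0.
- by move=> F mF F0; exact: ge0_integral_gaussian_affine.
Qed.

Lemma prod_naff_scale n (s s' : R) (t : n.-tuple RT) : 0 < s -> 0 < s' ->
  \prod_(i < n) naff 1 s s' (tnth t i) 0 =
  Num.sqrt (s' / s) ^+ n * expR (tnorm2 t / (2 * s') - tnorm2 t / (2 * s)).
Proof.
move=> s0 s'0; rewrite /naff big_split/= prodr_const card_ord; congr (_ * _).
  by rewrite mul1r.
rewrite -expR_sum; congr expR; rewrite /tnorm2 !mulr_suml -sumrB.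
by apply: eq_bigr => i _; rewrite mul1r addr0.
Qed.

Lemma prod_naff_shift n (h : R) (v : 'I_n -> R) (t : n.-tuple RT) : 0 < h ->
  \prod_(i < n) naff 1 (h / 2) (h / 2) (tnth t i) (v i) =
  expR (tnorm2 t / h - tnorm2 (taff 1 v t) / h).
Proof.
move=> h0; rewrite /tnorm2 !mulr_suml -sumrB expR_sum; apply: eq_bigr => i _.
rewrite naff_shiftE ?divr_gt0// tnth_mktuple mul1r; congr expR; field.
exact: lt0r_neq0.
Qed.

(** The weight makes the measure a multiple of Lebesgue measure: this is
    translation invariance. *)
Lemma Rintegral_lebesgue_shift n (h : R) (v : 'I_n -> R) (f : n.-tuple RT -> R) :
  0 < h -> measurable_fun setT f ->
  \int[gaussian (h / 2) n]_t (f (taff 1 v t) * expR (tnorm2 t / h)) =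
  \int[gaussian (h / 2) n]_t (f t * expR (tnorm2 t / h)).
Proof.
move=> h0 mf; rewrite [RHS](Rintegral_gaussian_affine v ltr01 (s' := h / 2)) ?divr_gt0//.
  apply: eq_Rintegral => t _; rewrite prod_naff_shift// -mulrA -expRD; congr (_ * expR _).
  ring.
apply: measurable_funM => //; apply: measurableT_comp => //.
by apply: measurable_funM => //; exact: measurable_tnorm2.
Qed.

(** The Gaussians of vanishing variance form an approximate identity, by
    rescaling to variance one and dominated convergence. *)
Lemma gaussian_concentration n (sg : nat -> R) (f : n.-tuple RT -> R) (C l : R) :
  (forall m, 0 < sg m) -> measurable_fun setT f -> (forall t, `|f t| <= C) ->
  (forall t, f (taff (Num.sqrt (sg m)) (fun=> 0) t) @[m --> \oo] --> l) ->
  \int[gaussian (sg m) n]_t f t @[m --> \oo] --> l.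
Proof.
move=> sg0 mf fC fl.
have E m : \int[gaussian (sg m) n]_t f t =
    \int[gaussian 1 n]_t f (taff (Num.sqrt (sg m)) (fun=> 0) t).
  rewrite (@Rintegral_gaussian_affine n (Num.sqrt (sg m)) (sg m) 1 (fun=> 0))// ?sqrtr_gt0//.
  apply: eq_Rintegral => t _; rewrite big1 ?mulr1// => i _.
  rewrite /naff div1r sqrtrV ?(ltW (sg0 m))// divff ?gt_eqF ?sqrtr_gt0//.
  rewrite addr0 exprMn sqr_sqrtr ?(ltW (sg0 m))// mul1r -[RHS]expR0; congr expR.
  by field; exact: lt0r_neq0.
under eq_cvg do rewrite E.
have mfm m : measurable_fun setT (fun t : n.-tuple RT => f (taff (Num.sqrt (sg m)) (fun=> 0) t)).
  by apply: (measurableT_comp mf); exact: measurable_taff.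
have -> : l = \int[gaussian 1 n]_t (cst l t).
  by rewrite Rintegral_cst// [X in fine X]probability_setT mulr1.
apply: (@Rintegral_dominated_cvg _ _ _ _ _ _ (cst C)) => //.
exact: finite_measure_integrable_cst.
Qed.

End gaussian_real.

(** * The Gaussian Fourier transform and its inversion *)

Section inversion.
Context (R : realType) (h : R) (n : nat).
Hypothesis h0 : 0 < h.
Local Notation RT := (measurableTypeR R).
Local Notation TT := (n.-tuple RT).

(** This is th + b . xi - (2 / h) xi . t, the phase of the exponential wave
    [b] times the kernel of the Fourier transform of the Wigner function. *)
Definition phase (th : R) (b : 'I_n -> R) (xi t : TT) : R :=
  th + tdot (fun i => b i - 2 / h * tnth t i) xi.

Lemma measurable_phase th b : measurable_fun setT (fun p : TT * TT => phase th b p.1 p.2).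
Proof.
apply: measurable_funD => //; apply: measurable_sum => i; apply: measurable_funM.
  apply: measurable_funB => //; apply: measurable_funM => //.
  exact: (measurableT_comp (measurable_tnth i) measurable_snd).
exact: (measurableT_comp (measurable_tnth i) measurable_fst).
Qed.

Lemma measurable_cos_comp d (T : measurableType d) (f : T -> R) :
  measurable_fun setT f -> measurable_fun setT (fun x => cos (f x)).
Proof.
move=> mf; apply: (@measurableT_comp _ _ _ _ RT _ (fun x : RT => cos x)) => //.
by apply: continuous_measurable_fun; exact: continuous_cos.
Qed.

(** The Fourier transform, in the variable [t], of the function [p] against a
    multiple of Lebesgue measure; for p t = f (x + t) g (x - t) it is the
    Wigner function up to normalisation. *)
Definition wigner_integral th b (p : TT -> R) (xi : TT) : R :=
  \int[gaussian (h / 2) n]_t (cos (phase th b xi t) * p t * expR (tnorm2 t / h)).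

Definition ft_kernel th b (p : TT -> R) (z : TT * TT) : R :=
  cos (phase th b z.1 z.2) * p z.2 * expR (tnorm2 z.2 / h).

Lemma measurable_expn2 : measurable_fun setT (fun t : TT => expR (tnorm2 t / h)).
Proof.
by apply: measurableT_comp => //; apply: measurable_funM => //; exact: measurable_tnorm2.
Qed.

Variables (p : TT -> R) (C : R).
Hypotheses (mp : measurable_fun setT p) (pC : forall t, `|p t| <= C * decay t).

Lemma measurable_ft_kernel th b : measurable_fun setT (ft_kernel th b p).
Proof.
apply: measurable_funM; [apply: measurable_funM|].
- by apply: measurable_cos_comp; exact: measurable_phase.
- exact: (measurableT_comp mp measurable_snd).
- exact: (measurableT_comp measurable_expn2 measurable_snd).
Qed.

Lemma ft_kernel_le th b z : `|ft_kernel th b p z| <= C * (expR (tnorm2 z.2 / h) * decay z.2).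
Proof.
rewrite !normrM (ger0_norm (expR_ge0 _)) -mulrA.
apply: (@le_trans _ _ (1 * (C * decay z.2 * expR (tnorm2 z.2 / h)))); last first.
  by rewrite mul1r -mulrA (mulrC (decay _)).
apply: ler_pM => //; rewrite ?mulr_ge0 ?expR_ge0//.
  by rewrite ler_norml cos_geN1 cos_le1.
by rewrite ler_wpM2r ?expR_ge0.
Qed.

Lemma integrable_Cdecay : (gaussian (h / 2) n).-integrable setT
  (EFin \o (fun t => C * (expR (tnorm2 t / h) * decay t))).
Proof.
rewrite (_ : EFin \o _ = fun t => (C%:E * (EFin \o (fun t => expR (tnorm2 t / h) * decay t)%R) t)%E)//.
by apply: integrableZl => //; exact: integrable_decay.
Qed.

Lemma integrable_ft_kernel th b xi : (gaussian (h / 2) n).-integrable setT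
  (EFin \o (fun t => ft_kernel th b p (xi, t))).
Proof.
apply: (intble_le _ integrable_Cdecay) => [|t]; last exact: (ft_kernel_le th b (xi, t)).
exact: (measurableT_comp (measurable_ft_kernel th b) (measurable_pair1 xi)).
Qed.

Lemma integrable_ft_kernel_prod th b (sg : R) :
  (gaussian sg n \x gaussian (h / 2) n)%E.-integrable setT (EFin \o ft_kernel th b p).
Proof.
apply: integrable_prodP; first exact: measurable_ft_kernel.
apply: (@le_lt_trans _ _ (\int[gaussian sg n]_x (cst
  (\int[gaussian (h / 2) n]_t (C * (expR (tnorm2 t / h) * decay t))%:E)) x)%E).
  apply: ge0_le_integral => //.
  - by move=> x _; apply: integral_ge0.
  - apply: (@measurable_fun_fubini_tonelli_F _ _ _ _ _ _ (fun z => (`|ft_kernel th b p z|)%:E)) => //.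
    by apply/measurable_EFinP; apply: measurableT_comp => //; exact: measurable_ft_kernel.
  - move=> x _; apply: ge0_le_integral => //.
    + apply/measurable_EFinP; apply: measurableT_comp => //.
      exact: (measurableT_comp (measurable_ft_kernel th b) (measurable_pair1 x)).
    + exact: (measurable_int _ integrable_Cdecay).
    + by move=> t _; rewrite lee_fin; exact: (ft_kernel_le th b (x, t)).
rewrite integral_cst// [X in (_ * X)%E]probability_setT mule1.
have := integrable_fin_num measurableT integrable_Cdecay.
by rewrite fin_numElt => /andP[].
Qed.

Lemma measurable_wigner_integral th b : measurable_fun setT (wigner_integral th b p).
Proof.
apply: measurableT_comp => //.
exact: (measurable_fubini_F (integrable_ft_kernel_prod th b 1)).
Qed.

Lemma RintegralC_fubini (m1 m2 : probability TT R) (f : TT * TT -> R) :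
  (m1 \x m2)%E.-integrable setT (EFin \o f) ->
  \int[m1]_x \int[m2]_y f (x, y) = \int[m2]_y \int[m1]_x f (x, y).
Proof.
move=> fi; rewrite -(Rintegral_fubini fi).
pose g (z : TT * TT) := f (z.2, z.1).
have mf : measurable_fun setT f by apply/measurable_EFinP; exact: measurable_int fi.
have mg : measurable_fun setT g.
  apply: (measurableT_comp mf); exact: measurable_fun_pair.
have gi : (m2 \x m1)%E.-integrable setT (EFin \o g).
  apply: integrable_prodP => //.
  rewrite -(@fubini_tonelli _ _ TT TT R m1 m2 (fun z => (`|f z|)%:E))//.
  - have mfe : measurable_fun setT (EFin \o f) by exact/measurable_EFinP.
    exact/(integrable12ltyP m1 m2 mfe).
  - by apply/measurable_EFinP; exact: measurableT_comp.
rewrite -(Rintegral_fubini gi) /Rintegral; congr fine.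
rewrite -(integral12_prod_meas1 fi) -(integral12_prod_meas1 gi).
by rewrite (Fubini fi).
Qed.

(** A Gaussian factor in [xi] makes Fubini legitimate; the inner integral is
    then a Gaussian characteristic function, which concentrates [t] around h /
    2 * b. *)
Lemma gaussian_regularized_inversion th b (sg : R) : 0 < sg ->
  \int[gaussian (h / 2) n]_xi (wigner_integral th b p xi *
     expR (tnorm2 xi / h - tnorm2 xi / (2 * sg))) =
  cos th * \int[gaussian (h ^+ 2 / (4 * sg)) n]_t p (taff 1 (fun i => h / 2 * b i) t).
Proof.
move=> sg0.
have h20 : 0 < h / 2 by rewrite divr_gt0.
pose c := Num.sqrt (h / 2 / sg) ^+ n.
have c0 : 0 < c by rewrite exprn_gt0// sqrtr_gt0 divr_gt0.
have mW := measurable_wigner_integral th b.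
pose E (xi : TT) := expR (tnorm2 xi / h - tnorm2 xi / (2 * sg)).
transitivity (c^-1 * \int[gaussian sg n]_xi wigner_integral th b p xi).
  rewrite (Rintegral_gaussian_affine (fun=> 0) ltr01 sg0 h20 mW).
  under [in RHS]eq_Rintegral => xi _.
    rewrite prod_naff_scale// -/c (_ : taff 1 _ xi = xi); last first.
      by apply: eq_from_tnth => i; rewrite tnth_mktuple mul1r addr0.
    rewrite (_ : 2 * (h / 2) = h); last by field.
    rewrite mulrCA -/(E xi).
    over.
  have iW : (gaussian (h / 2) n).-integrable setT
      (EFin \o (fun xi => wigner_integral th b p xi * E xi)).
    have : (gaussian sg n).-integrable setT (EFin \o wigner_integral th b p).
      have := integrable_fubini_F (integrable_ft_kernel_prod th b sg).
      apply: eq_integrable => // xi _.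
      rewrite /fubini_F /= /wigner_integral /Rintegral fineK//.
      exact: integrable_fin_num (integrable_ft_kernel th b xi).
    move/(integrable_gaussian_affine (fun=> 0) ltr01 sg0 h20 mW).
    move/(integrableZl measurableT c^-1).
    apply: eq_integrable => // xi _ /=.
    rewrite -EFinM prod_naff_scale// -/c (_ : taff 1 _ xi = xi); last first.
      by apply: eq_from_tnth => i; rewrite tnth_mktuple mul1r addr0.
    rewrite (_ : 2 * (h / 2) = h); last by field.
    by rewrite -/(E xi) [_ * (c * _)]mulrCA mulKf ?gt_eqF.
  by rewrite RintegralZl// mulKf ?gt_eqF.
rewrite /wigner_integral (RintegralC_fubini (integrable_ft_kernel_prod th b sg)) /=.
pose v i := h / 2 * b i.
pose ex (t : TT) := expR (- (sg * (\sum_(i < n) (b i - 2 / h * tnth t i) ^+ 2) / 2)).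
pose q (t : TT) := p t * ex t.
have I t : \int[gaussian sg n]_x ft_kernel th b p (x, t) = cos th * (q t * expR (tnorm2 t / h)).
  under eq_Rintegral do rewrite /ft_kernel/= -mulrA.
  rewrite RintegralZr//; last first.
    apply: (intble_bounded (C := 1) _ (measurable_cos_tdot _ _)) => xi.
    by rewrite ler_norml cos_geN1 cos_le1.
  by rewrite /phase gaussian_charfun// -/(ex t) /q; ring.
under eq_Rintegral do rewrite I.
have mexp : measurable_fun setT ex.
  apply: measurableT_comp => //; apply: measurableT_comp => //.
  apply: measurable_funM => //; apply: measurable_funM => //.
  apply: measurable_sum => i; apply: measurable_funX.
  apply: measurable_funB => //; apply: measurable_funM => //.
  exact: measurable_tnth.
have mq : measurable_fun setT q by exact: measurable_funM.
have ex1 (t : TT) : ex t <= 1.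
  rewrite -[leRHS]expR0 ler_expR oppr_le0 divr_ge0// mulr_ge0 ?(ltW sg0)//.
  by apply: sumr_ge0 => i _; exact: sqr_ge0.
have iq : (gaussian (h / 2) n).-integrable setT (EFin \o (fun t => q t * expR (tnorm2 t / h))).
  apply: (intble_le _ integrable_Cdecay) => [|t].
    by apply: measurable_funM => //; exact: measurable_expn2.
  rewrite /q normrM (ger0_norm (expR_ge0 _)) (mulrC (expR _)) mulrA.
  rewrite ler_wpM2r ?expR_ge0// (le_trans _ (pC t))// normrM.
  by rewrite ler_piMr// ger0_norm ?expR_ge0.
rewrite RintegralZl// -(Rintegral_lebesgue_shift v h0 mq).
have h2s0 : 0 < h ^+ 2 / (4 * sg) by rewrite divr_gt0 ?exprn_gt0 ?mulr_gt0.
have mpv : measurable_fun setT (fun t : TT => p (taff 1 v t)).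
  by apply: (measurableT_comp mp); exact: measurable_taff.
rewrite [in RHS](Rintegral_gaussian_affine (fun=> 0) ltr01 h2s0 h20 mpv).
rewrite mulrCA; congr (_ * _).
have cE : Num.sqrt (h / 2 / (h ^+ 2 / (4 * sg))) ^+ n = c^-1.
  rewrite /c -exprVn; congr (_ ^+ _); rewrite -sqrtrV ?divr_ge0 ?(ltW h0) ?(ltW sg0)//.
  by congr Num.sqrt; field; rewrite !gt_eqF.
have taff10 (t : TT) : taff 1 (fun=> 0) t = t.
  by apply: eq_from_tnth => i; rewrite tnth_mktuple mul1r addr0.
under [in RHS]eq_Rintegral => t _.
  rewrite prod_naff_scale// cE taff10 mulrCA.
  over.
have F t : q (taff 1 v t) * expR (tnorm2 t / h) = p (taff 1 v t) *
    expR (tnorm2 t / (2 * (h / 2)) - tnorm2 t / (2 * (h ^+ 2 / (4 * sg)))).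
  rewrite /q /ex -mulrA -expRD; congr (_ * expR _).
  have -> : \sum_(i < n) (b i - 2 / h * tnth (taff 1 v t) i) ^+ 2 = (2 / h) ^+ 2 * tnorm2 t.
    rewrite /tnorm2 mulr_sumr; apply: eq_bigr => i _; rewrite tnth_mktuple /v; field.
    exact: lt0r_neq0.
  by field; rewrite !gt_eqF.
under eq_Rintegral do rewrite F.
rewrite RintegralZl//.
have mqe : measurable_fun setT (fun t => q t * expR (tnorm2 t / h)).
  by apply: measurable_funM => //; exact: measurable_expn2.
have := (integrable_gaussian_affine v ltr01 h20 h20 mqe).1 iq.
apply: eq_integrable => // t _ /=.
rewrite prod_naff_shift// -[in LHS]mulrA -expRD -F; congr ((_ * expR _)%:E); ring.
Qed.

(** The regularizing variance tends to zero: the left side converges by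
    dominated convergence, the right side by concentration at the point h / 2
    * b. *)
Theorem wigner_inversion th b :
  (gaussian (h / 2) n).-integrable setT
    (EFin \o (fun xi => wigner_integral th b p xi * expR (tnorm2 xi / h))) ->
  (forall (c : nat -> R) (t : TT), c m @[m --> \oo] --> 0 ->
    p [tuple c m * tnth t i + h / 2 * b i | i < n] @[m --> \oo] -->
    p [tuple h / 2 * b i | i < n]) ->
  \int[gaussian (h / 2) n]_xi (wigner_integral th b p xi * expR (tnorm2 xi / h)) =
  cos th * p [tuple h / 2 * b i | i < n].
Proof.
move=> iW cp; have mW := measurable_wigner_integral th b.
pose sg (m : nat) : R := m.+1%:R.
have sg0 m : 0 < sg m by rewrite ltr0n.
have inv0 : (sg m)^-1 @[m --> \oo] --> 0 by exact: cvg_harmonic.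
have L : \int[gaussian (h / 2) n]_xi (wigner_integral th b p xi *
     expR (tnorm2 xi / h - tnorm2 xi / (2 * sg m))) @[m --> \oo] -->
  \int[gaussian (h / 2) n]_xi (wigner_integral th b p xi * expR (tnorm2 xi / h)).
  apply: (@Rintegral_dominated_cvg _ _ _ _ _ _
    (fun xi => `|wigner_integral th b p xi * expR (tnorm2 xi / h)|)).
  - move=> m; apply: measurable_funM => //; apply: measurableT_comp => //.
    by apply: measurable_funB; apply: measurable_funM => //; exact: measurable_tnorm2.
  - exact: integrable_norm.
  - move=> m x; rewrite !normrM ler_wpM2l// !ger0_norm ?expR_ge0// ler_expR gerBl.
    by rewrite divr_ge0 ?mulr_ge0// sumr_ge0// => i _; exact: sqr_ge0.
  - move=> x; apply: cvgM; first exact: cvg_cst.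
    apply: (@cvg_comp _ _ _ (fun m => tnorm2 x / h - tnorm2 x / (2 * sg m)) expR _ (nbhs (tnorm2 x / h))).
      have Z : tnorm2 x / (2 * sg m) @[m --> \oo] --> 0.
        rewrite -(mulr0 (tnorm2 x / 2)); under eq_fun do rewrite invfM mulrA.
        by apply: cvgM => //; exact: cvg_cst.
      by have := cvgB (cvg_cst (tnorm2 x / h)) Z; rewrite subr0; apply.
    exact: continuous_expR.
have Q : \int[gaussian (h / 2) n]_xi (wigner_integral th b p xi *
     expR (tnorm2 xi / h - tnorm2 xi / (2 * sg m))) @[m --> \oo] -->
  cos th * p [tuple h / 2 * b i | i < n].
  under eq_fun do rewrite gaussian_regularized_inversion//.
  apply: cvgM; first exact: cvg_cst.
  have C0 : 0 <= C.
    have := le_trans (normr_ge0 _) (pC [tuple 0 | i < n]).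
    by rewrite pmulr_lge0// decay_gt0.
  apply: (@gaussian_concentration _ _ _ (fun t => p (taff 1 (fun i => h / 2 * b i) t)) C).
  - by move=> m; rewrite divr_gt0 ?exprn_gt0 ?mulr_gt0.
  - by apply: (measurableT_comp mp); exact: measurable_taff.
  - move=> t; apply: le_trans (pC _) _; rewrite ler_piMr//.
    apply: prodr_ile1 => i _; rewrite invr_ge0 addr_ge0 ?sqr_ge0//=.
    by rewrite invf_le1 ?lerDl ?sqr_ge0// ltr_pwDl ?sqr_ge0.
  - move=> t; have := cp (fun m => Num.sqrt (h ^+ 2 / (4 * sg m))) t.
    under [X in _ -> X @ _ --> _]eq_fun => m.
      rewrite (_ : taff 1 _ _ = [tuple Num.sqrt (h ^+ 2 / (4 * sg m)) * tnth t i + h / 2 * b i | i < n]); last first.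
        by apply: eq_from_tnth => i; rewrite !tnth_mktuple mul1r addr0.
      over.
    apply; rewrite -sqrtr0.
    have Z : h ^+ 2 / (4 * sg m) @[m --> \oo] --> 0.
      rewrite -(mulr0 (h ^+ 2 / 4)); under eq_fun do rewrite invfM mulrA.
      by apply: cvgM => //; exact: cvg_cst.
    apply: (@cvg_comp _ _ _ (fun m => h ^+ 2 / (4 * sg m)) Num.sqrt _ (nbhs 0)) => //.
    exact: sqrt_continuous.
by have /cvg_unique := L; apply.
Qed.

End inversion.

(** * Scalar products and finite orthonormal families *)

Section hilbert.
Context {R : realType} {H : completeNormedModType R} (dot : H -> H -> R).
Hypothesis hH : hilbert_axioms dot.
Implicit Types (x y z : H) (a : R) (u w : seq H).

Let dC : forall x y, dot x y = dot y x := dotC hH.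

Lemma dotPl a x y z : dot (a *: x + y) z = a * dot x z + dot y z.
Proof. exact: (dot_linear hH z a x y). Qed.

Lemma dotDl x y z : dot (x + y) z = dot x z + dot y z.
Proof. by rewrite -[x in LHS]scale1r dotPl mul1r. Qed.

Lemma dot0l z : dot 0 z = 0.
Proof. by have := dotDl 0 0 z; rewrite addr0 => /eqP; rewrite -subr_eq subrr eq_sym => /eqP. Qed.

Lemma dotZl a x z : dot (a *: x) z = a * dot x z.
Proof. by rewrite -[a *: x]addr0 dotPl dot0l addr0. Qed.

Lemma dotNl x z : dot (- x) z = - dot x z.
Proof. by rewrite -scaleN1r dotZl mulN1r. Qed.

Lemma dotBl x y z : dot (x - y) z = dot x z - dot y z.
Proof. by rewrite dotDl dotNl. Qed.

Lemma dotDr x y z : dot z (x + y) = dot z x + dot z y.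
Proof. by rewrite dC dotDl !(dC z). Qed.

Lemma dotZr a x z : dot z (a *: x) = a * dot z x.
Proof. by rewrite dC dotZl (dC z). Qed.

Lemma dotNr x z : dot z (- x) = - dot z x.
Proof. by rewrite dC dotNl (dC z). Qed.

Lemma dotBr x y z : dot z (x - y) = dot z x - dot z y.
Proof. by rewrite dotDr dotNr. Qed.

Lemma dot0r z : dot z 0 = 0.
Proof. by rewrite dC dot0l. Qed.

Lemma dot_suml I (r : seq I) (P : pred I) (F : I -> H) z :
  dot (\sum_(i <- r | P i) F i) z = \sum_(i <- r | P i) dot (F i) z.
Proof. by elim/big_rec2: _ => [|i y1 y2 _ <-]; rewrite ?dot0l// dotDl. Qed.

Lemma dot_sumr I (r : seq I) (P : pred I) (F : I -> H) z :
  dot z (\sum_(i <- r | P i) F i) = \sum_(i <- r | P i) dot z (F i).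
Proof. by rewrite dC dot_suml; apply: eq_bigr => i _; exact: dC. Qed.

Lemma dot_ge0 x : 0 <= dot x x.
Proof. by rewrite (dot_norm hH) sqr_ge0. Qed.

Lemma dot_eq0 x : dot x x = 0 -> x = 0.
Proof. by rewrite (dot_norm hH) => /eqP; rewrite sqrf_eq0 normr_eq0 => /eqP. Qed.

Lemma cauchy_schwarz x y : `|dot x y| <= `|x| * `|y|.
Proof.
have [->|y0] := eqVneq y 0; first by rewrite dot0r !normr0 mulr0.
have ny : 0 < `|y| by rewrite normr_gt0.
rewrite -(@ler_pXn2r _ 2)// ?nnegrE ?mulr_ge0// exprMn real_normK ?num_real//.
have := dot_ge0 (x - (dot x y / dot y y) *: y).
rewrite dotBl !dotBr !dotZl !dotZr (dC y x) !(dot_norm hH).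
move: (dot x y) => c; set X := `|x| ^+ 2; set Y := `|y| ^+ 2.
have Y0 : 0 < Y by rewrite exprn_gt0.
have -> : X - c / Y * c - (c / Y * c - c / Y * (c / Y * Y)) = (X * Y - c ^+ 2) / Y.
  field; exact: lt0r_neq0.
by rewrite pmulr_lge0 ?invr_gt0// subr_ge0.
Qed.

Lemma dot_continuous z : continuous (dot z).
Proof.
move=> x; apply/cvgrPdist_lt => e e0.
have k0 : 0 < `|z| + 1 by rewrite ltr_pwDr.
near=> y.
rewrite -dotBr (le_lt_trans (cauchy_schwarz _ _))//.
apply: (@le_lt_trans _ _ ((`|z| + 1) * `|x - y|)); first by rewrite ler_wpM2r// lerDl.
rewrite -ltr_pdivlMl// mulrC.
near: y; apply: cvgr_dist_lt => //; by rewrite divr_gt0.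
Unshelve. all: by end_near. Qed.

Lemma dot_lincomb u (ou : orthonormal_seq dot u) t (i : 'I_(size u)) :
  dot u`_i (lincomb (u := u) t) = tnth t i.
Proof.
rewrite /lincomb dot_sumr (bigD1 i)//= dotZr ou// eqxx mulr1 big1 ?addr0// => j ji.
by rewrite dotZr ou// (negbTE (_ : (i : nat) != j)) ?mulr0// eq_sym.
Qed.

Lemma dot_lincomb2 u (ou : orthonormal_seq dot u) t s :
  dot (lincomb (u := u) t) (lincomb (u := u) s) = \sum_(i < size u) tnth t i * tnth s i.
Proof.
rewrite {1}/lincomb dot_suml; apply: eq_bigr => i _.
by rewrite dotZl dot_lincomb.
Qed.

Definition proj u x : H := \sum_(i < size u) dot u`_i x *: u`_i.

Lemma proj_lincomb u x :
  proj u x = lincomb (u := u) [tuple dot u`_i x | i < size u].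
Proof. by rewrite /lincomb; apply: eq_bigr => i _; rewrite tnth_mktuple. Qed.

Lemma proj_span u x : fspan u (proj u x).
Proof. by rewrite proj_lincomb; exists [tuple dot u`_i x | i < size u]. Qed.

Lemma projK u x : orthonormal_seq dot u -> fspan u x -> proj u x = x.
Proof.
move=> ou [t _ <-]; rewrite /proj [RHS]/lincomb.
by apply: eq_bigr => i _; rewrite dot_lincomb.
Qed.

Lemma fspanP u x : orthonormal_seq dot u -> fspan u x <-> proj u x = x.
Proof. by move=> ou; split=> [|<-]; [exact: projK|exact: proj_span]. Qed.

Lemma dot_proj u x (i : 'I_(size u)) : orthonormal_seq dot u ->
  dot u`_i (proj u x) = dot u`_i x.
Proof. by move=> ou; rewrite proj_lincomb dot_lincomb// tnth_mktuple. Qed.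

Lemma dot_proj_perp u x y : orthonormal_seq dot u -> fspan u y ->
  dot y (x - proj u x) = 0.
Proof.
move=> ou [t _ <-]; rewrite dot_suml big1// => i _.
by rewrite dotZl dotBr dot_proj// subrr mulr0.
Qed.

Lemma fspan_linear u a x y : fspan u x -> fspan u y -> fspan u (a *: x + y).
Proof.
move=> [t _ <-] [s _ <-].
exists [tuple a * tnth t i + tnth s i | i < size u] => //.
rewrite /lincomb scaler_sumr -big_split; apply: eq_bigr => i _ /=.
by rewrite tnth_mktuple scalerDl scalerA.
Qed.

Lemma fspan_nth u i : (i < size u)%N -> fspan u u`_i.
Proof.
move=> iu; exists [tuple ((j : nat) == i)%:R | j < size u] => //.
rewrite /lincomb (bigD1 (Ordinal iu))//= tnth_mktuple eqxx scale1r big1 ?addr0// => j ji.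
by rewrite tnth_mktuple (_ : (j : nat) == i = false) ?scale0r//; exact: negbTE.
Qed.

Lemma fspan_mem u v : v \in u -> fspan u v.
Proof. by move=> vu; rewrite -(nth_index 0 vu); apply: fspan_nth; rewrite index_mem. Qed.

Lemma fspan0 u : fspan u 0.
Proof.
exists [tuple 0 | i < size u] => //.
by rewrite /lincomb big1// => i _; rewrite tnth_mktuple scale0r.
Qed.

Lemma fspanZ u a x : fspan u x -> fspan u (a *: x).
Proof. by move=> ux; rewrite -[_ *: _]addr0; apply: fspan_linear => //; exact: fspan0. Qed.

Lemma fspanD u x y : fspan u x -> fspan u y -> fspan u (x + y).
Proof. by move=> ux uy; rewrite -[x]scale1r; exact: fspan_linear. Qed.

Lemma fspanB u x y : fspan u x -> fspan u y -> fspan u (x - y).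
Proof. by move=> ux uy; rewrite addrC -scaleN1r; exact: fspan_linear. Qed.

Lemma fspan_sub u w : (forall v, v \in u -> fspan w v) -> fspan u `<=` fspan w.
Proof.
move=> uw _ [t _ <-]; rewrite /lincomb.
elim/big_ind: _ => [|x y|i _]; [exact: fspan0|exact: fspanD|].
by apply: fspanZ; apply: uw; exact: mem_nth.
Qed.

Lemma fspan_catl u w : fspan u `<=` fspan (u ++ w).
Proof. by apply: fspan_sub => v vu; apply: fspan_mem; rewrite mem_cat vu. Qed.

(** The residual of a projection is orthogonal to [S], hence to everything by
    density, hence to itself. *)
Lemma fspan_closed_dense u (S : set H) : orthonormal_seq dot u -> dense S ->
  S `<=` fspan u -> fspan u = setT.
Proof.
move=> ou dS Su; apply/seteqP; split=> // x _.
apply/(fspanP _ ou); apply/eqP; rewrite eq_sym -subr_eq0; apply/eqP; apply: dot_eq0.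
set r := x - proj u x.
have : closed [set y | dot r y = 0].
  apply: (@closed_comp _ _ (dot r) [set 0]); last exact: closed_eq.
  by move=> y _; exact: dot_continuous.
move/closure_id => cl.
have : [set y | dot r y = 0] = setT.
  apply/seteqP; split => // y _; rewrite cl => A Ay.
  have [z [Az Sz]] := dS A° (ex_intro _ y Ay) (open_interior A).
  exists z; split; last exact: interior_subset.
  by rewrite /= dC; apply: dot_proj_perp => //; exact: Su.
by move=> /seteqP[_ /(_ r I)].
Qed.

Lemma orthonormal_rcons u y : orthonormal_seq dot u -> ~ fspan u y ->
  orthonormal_seq dot (rcons u (`|y - proj u y|^-1 *: (y - proj u y))).
Proof.
move=> ou uy; set r := y - proj u y.
have r0 : r != 0.
  apply: contra_notN uy => /eqP ry; apply/(fspanP _ ou).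
  by apply/eqP; rewrite eq_sym -subr_eq0; exact/eqP.
have nr : `|r| != 0 by rewrite normr_eq0.
have perp i : (i < size u)%N -> dot u`_i (`|r|^-1 *: r) = 0.
  by move=> iu; rewrite dotZr dot_proj_perp ?mulr0//; exact: fspan_nth.
move=> i j; rewrite size_rcons !ltnS !nth_rcons => iu ju.
case: ltnP => iu'; case: ltnP => ju'.
- exact: ou.
- have -> : j = size u by apply/eqP; rewrite eqn_leq ju ju'.
  by rewrite eqxx perp// (ltn_eqF iu').
- have -> : i = size u by apply/eqP; rewrite eqn_leq iu iu'.
  by rewrite eqxx dC perp// (gtn_eqF ju').
- have -> : i = size u by apply/eqP; rewrite eqn_leq iu iu'.
  have -> : j = size u by apply/eqP; rewrite eqn_leq ju ju'.
  rewrite !eqxx dotZl dotZr (dot_norm hH) mulrA -expr2 -exprMn mulVf// expr1n//.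
Qed.

Lemma fspan_rcons_residual u y :
  fspan (rcons u (`|y - proj u y|^-1 *: (y - proj u y))) y.
Proof.
set r := y - proj u y; set w := rcons _ _.
have uw : fspan u `<=` fspan w by rewrite /w -cats1; exact: fspan_catl.
rewrite -(subrK (proj u y) y) -/r; apply: fspanD; last exact/uw/proj_span.
have [->|r0] := eqVneq r 0; first exact: fspan0.
rewrite -[r]scale1r -(mulfV (_ : `|r| != 0)) ?normr_eq0// -scalerA.
by apply: fspanZ; apply: fspan_mem; rewrite /w mem_rcons mem_head.
Qed.

Section gram_schmidt.
Variable S : set H.
Hypothesis S0 : S 0.
Hypothesis Slin : forall a x y, S x -> S y -> S (a *: x + y).

Lemma proj_sub u x : {in u, forall v, S v} -> S (proj u x).
Proof.
move=> uS; rewrite /proj; elim/big_ind: _ => // [y z Sy Sz|i _].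
  by rewrite -[y]scale1r; exact: Slin.
by rewrite -[_ *: _]addr0; apply: Slin => //; apply: uS; exact: mem_nth.
Qed.

(** The vectors [w] are built one at a time, by normalising the residual of
    the projection of the next vector that is not yet spanned. *)
Lemma gram_schmidt u (ys : seq H) : orthonormal_seq dot u ->
  {in u, forall v, S v} -> {in ys, forall v, S v} ->
  exists w, [/\ orthonormal_seq dot (u ++ w), {in u ++ w, forall v, S v} &
    {in ys, forall y, fspan (u ++ w) y}].
Proof.
elim: ys u => [|y ys IH] u ou uS ysS; first by exists [::]; rewrite cats0.
have ySS : {in ys, forall v, S v} by move=> v vy; apply: ysS; rewrite inE vy orbT.
have Sy : S y by apply: ysS; rewrite mem_head.
have [uy|uy] := pselect (fspan u y).
  have [w [ow wS wy]] := IH u ou uS ySS.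
  exists w; split=> // z; rewrite inE => /orP[/eqP ->|]; last exact: wy.
  exact: fspan_catl.
set r := `|y - proj u y|^-1 *: (y - proj u y).
have ou' : orthonormal_seq dot (rcons u r) by exact: orthonormal_rcons.
have Sr : S r.
  rewrite /r -[_ *: _]addr0; apply: Slin => //.
  by rewrite addrC -scaleN1r; apply: Slin => //; exact: proj_sub.
have uS' : {in rcons u r, forall v, S v}.
  by move=> v; rewrite mem_rcons inE => /orP[/eqP ->//|]; exact: uS.
have [w [ow wS wy]] := IH _ ou' uS' ySS.
exists (r :: w); rewrite -cat_rcons; split=> // z.
rewrite inE => /orP[/eqP ->|]; last exact: wy.
by apply: fspan_catl; exact: fspan_rcons_residual.
Qed.

End gram_schmidt.
End hilbert.

(** * A Hilbert basis inside a dense subspace *)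

Section hilbert_basis.
Context {R : realType} {H : completeNormedModType R} (dot : H -> H -> R).
Hypothesis hH : hilbert_axioms dot.
Variable S : set H.
Hypothesis S0 : S 0.
Hypothesis Slin : forall a x y, S x -> S y -> S (a *: x + y).
Hypothesis dS : dense S.

(** [S] itself has a countable dense subset: for each point of a countable
    dense set of [H] and each radius 1 / n, one approximating point of [S] is
    chosen. *)
Lemma dense_sequence : exists d : nat -> H, (forall k, S (d k)) /\ dense (range d).
Proof.
have [D /pcard_injP[f finj] dD] := hilbert_separable hH.
have ex (k m : nat) : exists y, S y /\
    forall x, D x -> f x = k -> ball x (m.+1%:R^-1) y.
  have [[x Dx fx]|no] := pselect (exists2 x, D x & f x = k); last first.
    by exists 0; split=> // x Dx fx; case: no; exists x.
  have m0 : 0 < m.+1%:R^-1 :> R by rewrite invr_gt0 ltr0n.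
  have [|y [xy Sy]] := dS _ (ball_open x m.+1%:R^-1).
    by exists x; exact: ballxx.
  exists y; split=> // x' Dx' fx'.
  by rewrite (_ : x' = x)//; apply: finj; rewrite ?inE// fx fx'.
have ex' (k : nat) : exists y, S y /\ forall p : nat * nat, unpickle k = Some p ->
    forall x, D x -> f x = p.1 -> ball x (p.2.+1%:R^-1) y.
  case E : (unpickle k : option (nat * nat)) => [p|]; last by exists 0; split.
  have [y [Sy hy]] := ex p.1 p.2.
  by exists y; split=> // q [<-].
have [d dP] := choice ex'.
exists d; split=> [k|O [z Oz] oO]; first by have [] := dP k.
have [x [Ox Dx]] := dD O (ex_intro _ z Oz) oO.
have /nbhs_ballP[e /= e0 xe] : nbhs x O by exact: open_nbhs_nbhs.
have [m hm] : exists m : nat, m.+1%:R^-1 < e.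
  by have [m] := near_infty_natSinv_lt (PosNum e0) => _ /(_ m (leqnn m)); exists m.
have [_ /(_ (f x, m))] := dP (pickle (f x, m)).
rewrite pickleK => /(_ erefl x Dx erefl) /= b.
exists (d (pickle (f x, m))); split; last by exists (pickle (f x, m)).
by apply: xe; exact: (le_ball (ltW hm)).
Qed.

Lemma not_span u : orthonormal_seq dot u -> exists2 y, S y & ~ fspan u y.
Proof.
move=> ou; apply: contrapT => h; apply: (hilbert_infinite_dim (u := u) hH).
apply: (fspan_closed_dense hH ou dS) => y Sy.
by apply: contrapT => uy; apply: h; exists y.
Qed.

Let Good (l : seq H) := orthonormal_seq dot l /\ {in l, forall v, S v}.

(** Minimality of the first vector that is not yet spanned makes every d k enter
   the span after at most k + 1 steps *)
Lemma gram_schmidt_step (d : nat -> H) l : (forall k, S (d k)) -> dense (range d) ->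
  Good l -> exists w, Good (rcons l w) /\
    forall k, (forall j, (j < k)%N -> fspan l (d j)) -> fspan (rcons l w) (d k).
Proof.
move=> Sd dd [ol lS].
have [k0 k0P] : exists k, ~ fspan l (d k).
  apply: contrapT => h; apply: (hilbert_infinite_dim (u := l) hH).
  apply: (fspan_closed_dense hH ol dd) => _ [k _ <-].
  by apply: contrapT => lk; apply: h; exists k.
have exk : exists k, `[< ~ fspan l (d k) >] by exists k0; exact/asboolP.
have [k /asboolP kP kmin] := ex_minnP exk.
set r := `|d k - proj dot l (d k)|^-1 *: (d k - proj dot l (d k)).
exists r; split; first split.
- exact: orthonormal_rcons.
- move=> v; rewrite mem_rcons inE => /orP[/eqP ->|]; last exact: lS.
  rewrite /r -[_ *: _]addr0; apply: Slin => //.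
  by rewrite addrC -scaleN1r; apply: Slin => //; exact: proj_sub.
- move=> k' hk'; have [kk|kk] := ltnP k k'; first by case: kP; exact: hk'.
  have [->|nk] := eqVneq k' k; first exact: fspan_rcons_residual.
  rewrite -cats1; apply: fspan_catl; apply: contrapT => lk'.
  have := kmin k' (asboolT lk'); rewrite leqNgt.
  by rewrite ltn_neqAle nk kk.
Qed.

(** Gram-Schmidt inside [S] along a dense sequence of [S]: infinite dimension
    provides a new vector at every step, and every term of the sequence is
    spanned after finitely many steps. *)
Lemma exists_hilbert_basis : exists e : nat -> H,
  hilbert_basis dot e /\ forall j, S (e j).
Proof.
have [d [Sd dd]] := dense_sequence.
have step (l : seq H) : exists w, Good l -> Good (rcons l w) /\
    forall k, (forall j, (j < k)%N -> fspan l (d j)) -> fspan (rcons l w) (d k).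
  have [/(gram_schmidt_step Sd dd)[w hw]|nl] := pselect (Good l); first by exists w.
  by exists 0.
have [nx nxP] := choice step.
pose L := fix L n := if n is n'.+1 then rcons (L n') (nx (L n')) else [::] : seq H.
have GL n : Good (L n).
  elim: n => [|n IH]; last by have [] := nxP _ IH.
  by split=> [i j|]; rewrite ?ltn0.
pose e n := nx (L n).
have Le n : L n = mkseq e n by elim: n => // n IH; rewrite mkseqS -IH.
have dL n k : (k < n)%N -> fspan (L n) (d k).
  elim: n k => // n IH k kn; have [_ h] := nxP _ (GL n).
  by apply: h => j jk; apply: IH; exact: leq_trans jk _.
exists e; split; last first.
  move=> j; have [_ h] := GL j.+1; apply: h.
  by rewrite Le mkseqS mem_rcons mem_head.
split=> [i j|O O0 oO].
  have [oL _] := GL (maxn i j).+1.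
  have := oL i j; rewrite Le size_mkseq !ltnS leq_maxl leq_maxr => /(_ isT isT).
  by rewrite !nth_mkseq ?ltnS ?leq_maxl ?leq_maxr.
have [x [Ox [k _ dk]]] := dd O O0 oO.
exists x; split=> //; exists k.+1 => //; rewrite -dk.
by rewrite -Le; exact: dL.
Qed.

End hilbert_basis.

(** * Projection on a closed convex set *)

Section convex_projection.
Context {R : realType} {H : completeNormedModType R} (dot : H -> H -> R).
Hypothesis hH : hilbert_axioms dot.

(** The identity that makes minimizing sequences Cauchy. *)
Lemma parallelogram (x y : H) :
  `|x + y| ^+ 2 + `|x - y| ^+ 2 = 2 * `|x| ^+ 2 + 2 * `|y| ^+ 2.
Proof.
rewrite -!(dot_norm hH) (dotBl hH) (dotDl hH) !(dotBr hH) !(dotDr hH).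
rewrite (dotC hH y x); ring.
Qed.

(** A minimizing sequence for the distance is Cauchy by the parallelogram
    identity, and the variational inequality follows by moving towards a
    competitor [y]. *)
Lemma convex_projection (C : set H) (h0 : H) : C !=set0 -> closed C ->
  (forall x y t, 0 <= t <= 1 -> C x -> C y -> C (t *: x + (1 - t) *: y)) ->
  exists2 p, C p & forall y, C y -> dot (h0 - p) (y - p) <= 0.
Proof.
move=> [c0 Cc0] clC cvxC.
pose A := [set `|h0 - y| ^+ 2 | y in C].
have hiA : has_inf A.
  split; first by exists (`|h0 - c0| ^+ 2), c0.
  by exists 0 => _ [y _ <-]; exact: sqr_ge0.
pose d := inf A.
have dle y : C y -> d <= `|h0 - y| ^+ 2 by move=> Cy; apply: (ge_inf hiA.2); exists y.
have ex (n : nat) : exists y, C y /\ `|h0 - y| ^+ 2 < d + n.+1%:R^-1.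
  have n0 : 0 < n.+1%:R^-1 :> R by rewrite invr_gt0 ltr0n.
  have [_ [y Cy <-] yd] := inf_adherent n0 hiA.
  by exists y.
have [y yP] := choice ex.
have yC n : C (y n) by have [] := yP n.
have yd n : `|h0 - y n| ^+ 2 < d + n.+1%:R^-1 by have [] := yP n.
have dist x z e : C x -> C z -> `|h0 - x| ^+ 2 < d + e -> `|h0 - z| ^+ 2 < d + e ->
    `|x - z| ^+ 2 < 4 * e.
  move=> Cx Cz hx hz.
  have := parallelogram (h0 - x) (h0 - z).
  have -> : h0 - x - (h0 - z) = z - x by rewrite opprB addrC addrA subrK.
  have -> : h0 - x + (h0 - z) = 2 *: (h0 - (2^-1 *: x + (1 - 2^-1) *: z)).
    rewrite (_ : 1 - 2^-1 = 2^-1 :> R); last by lra.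
    rewrite scalerBr scalerDr !scalerA divff// !scale1r scaler_nat mulr2n.
    by rewrite addrACA opprD.
  rewrite normrZ exprMn (ger0_norm (ler0n _ 2)) (distrC z x).
  have : d <= `|h0 - (2^-1 *: x + (1 - 2^-1) *: z)| ^+ 2.
    by apply: dle; apply: cvxC => //; lra.
  move: (`|h0 - (_ + _)| ^+ 2) => D dD; move: hx hz.
  move: (`|h0 - x| ^+ 2) (`|h0 - z| ^+ 2) (`|x - z| ^+ 2) => X Y Z hX hY.
  rewrite expr2 => E; lra.
have cy : cvg (y @ \oo).
  apply: cauchy_cvg; apply: cauchy_exP => e /= e0.
  have e40 : 0 < e ^+ 2 / 4 by rewrite divr_gt0// exprn_gt0.
  have [n _ hn] := near_infty_natSinv_lt (PosNum e40).
  exists (y n); exists n => // m /= nm.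
  rewrite -ball_normE /= -(@ltr_pXn2r _ 2)// ?nnegrE ?(ltW e0)//.
  apply: lt_trans (_ : 4 * n.+1%:R^-1 < _); last first.
    by have := hn n (leqnn n) => /=; rewrite -ltr_pdivlMl// mulrC.
  apply: dist => //; apply: lt_le_trans (yd m) _; rewrite lerD2l.
  by rewrite lef_pV2 ?posrE// ler_nat.
pose p := lim (y @ \oo).
have Cp : C p by apply: (@closed_cvg _ _ \oo _ y C clC) => //; exact: nearW.
have pd : `|h0 - p| ^+ 2 <= d.
  have c1 : `|h0 - y n| ^+ 2 @[n --> \oo] --> `|h0 - p| ^+ 2.
    have cn : `|h0 - y n| @[n --> \oo] --> `|h0 - p|.
      by apply: cvg_norm; apply: cvgB => //; exact: cvg_cst.
    by rewrite expr2; under eq_fun do rewrite expr2; exact: (cvgM cn cn).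
  have c2 : d + n.+1%:R^-1 @[n --> \oo] --> d + 0.
    by apply: cvgD; [exact: cvg_cst|exact: cvg_harmonic].
  rewrite -[leRHS]addr0; apply: (ler_cvg_to c1 c2).
  by apply: nearW => n; exact: ltW.
exists p => // z Cz; rewrite leNgt; apply/negP => pos.
set a := dot (h0 - p) (z - p) in pos.
pose b := `|z - p| ^+ 2.
have b0 : 0 <= b by exact: sqr_ge0.
pose t := Num.min 1 (a / (b + 1)).
have t0 : 0 < t by rewrite lt_min ltr01 divr_gt0// ltr_wpDl.
have t1 : t <= 1 by rewrite ge_min lexx.
have : d <= `|h0 - (t *: z + (1 - t) *: p)| ^+ 2.
  by apply: dle; apply: cvxC => //; rewrite t1 ltW.
have -> : h0 - (t *: z + (1 - t) *: p) = (h0 - p) - t *: (z - p).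
  by rewrite scalerBl scale1r scalerBr addrCA opprD addrA.
have -> : `|h0 - p - t *: (z - p)| ^+ 2 = `|h0 - p| ^+ 2 - 2 * (t * a) + t * (t * b).
  rewrite -!(dot_norm hH) /a /b; move: (h0 - p) (z - p) => v w.
  rewrite (dotBl hH) !(dotBr hH) !(dotZl hH) !(dotZr hH) (dotC hH w v) -(dot_norm hH); ring.
have tb : t * (b + 1) <= a by rewrite -ler_pdivlMr ?ltr_wpDl// ge_min lexx orbT.
move: pd; move: (`|h0 - p| ^+ 2) => X Xd.
have tb' : t * (t * b) <= t * a by rewrite ler_pM2l//; nra.
have ta : 0 < t * a by rewrite mulr_gt0.
by move: (t * (t * b)) (t * a) tb' ta => Y Z YZ Z0; lra.
Qed.

End convex_projection.

(** * The dual of B inside H *)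

Section dual.
Context {R : realType} {H B : normedModType R} (dot : H -> H -> R) (inc : H -> B).
Hypothesis dotPl' : forall a x y z, dot (a *: x + y) z = a * dot x z + dot y z.
Hypothesis inc_linear : linear inc.
Hypothesis inc_dense : dense (range inc).

Lemma dual_pair0 : dual_pair dot inc 0 (cst 0).
Proof.
split=> [a x y||x].
- by rewrite /= mulr0 addr0.
- by move=> x; exact: cvg_cst.
- rewrite /=; have := dotPl' (-1) 0 0 x.
  by rewrite scaler0 addr0 mulN1r addNr.
Qed.

Lemma dual_pair_lin a x y phi psi : dual_pair dot inc x phi -> dual_pair dot inc y psi ->
  dual_pair dot inc (a *: x + y) (fun z => a * phi z + psi z).
Proof.
move=> [sp cp ep] [sq cq eq]; split=> [b u v|z|z].
- by rewrite /= sp sq /=; ring.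
- by apply: cvgD; [apply: cvgM; [exact: cvg_cst|exact: cp]|exact: cq].
- by rewrite ep eq dotPl'.
Qed.

Lemma dual_pair_unique a phi psi : dual_pair dot inc a phi -> dual_pair dot inc a psi ->
  phi = psi.
Proof.
move=> [_ cp ep] [_ cq eq]; apply/funext => x; apply/eqP; rewrite -subr_eq0; apply/eqP.
have cl : closed [set y | phi y - psi y = 0].
  apply: (@closed_comp _ _ (fun y => phi y - psi y) [set 0]); last exact: closed_eq.
  by move=> y _; apply: cvgB; [exact: cp|exact: cq].
suff : closure [set y | phi y - psi y = 0] x by rewrite -((closure_id _).1 cl).
move=> A Ax.
have [z [Az [y _ yz]]] := inc_dense (ex_intro _ x Ax : A° !=set0) (open_interior A).
exists z; split; last exact: interior_subset.
by rewrite /= -yz ep eq subrr.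
Qed.

(** Such an [a] defines a functional that is continuous for the norm of [B] on
    the dense subspace [H]; it extends by uniform continuity. *)
Lemma dual_pair_extend a : (forall y, `|dot a y| <= `|inc y|) ->
  (forall c x y z, dot z (c *: x + y) = c * dot z x + dot z y) ->
  exists2 phi, dual_pair dot inc a phi & forall x, `|phi x| <= `|x|.
Proof.
move=> ha dotPr.
have inc0 : inc 0 = 0.
  by have := inc_linear (-1) 0 0; rewrite scaler0 addr0 scaleN1r addNr.
have dot0 z : dot z 0 = 0.
  by have := dotPr (-1) 0 0 z; rewrite scaler0 addr0 mulN1r addNr.
have incB x y : inc (x - y) = inc x - inc y.
  by rewrite addrC -scaleN1r inc_linear scaleN1r addrC.
have dotB x y z : dot z (x - y) = dot z x - dot z y.
  by rewrite addrC -scaleN1r dotPr mulN1r addrC.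
pose E x := [set dot a y + `|x - inc y| | y in [set: H]].
pose phi x := inf (E x).
have lb x y y' : dot a y - `|x - inc y| <= dot a y' + `|x - inc y'|.
  rewrite lerBlDr -addrA -lerBlDl -dotB (le_trans (ler_norm _))// (le_trans (ha _))//.
  rewrite incB (_ : inc y - inc y' = (x - inc y') - (x - inc y)).
    by rewrite (le_trans (ler_normB _ _)).
  by rewrite opprB [RHS]addrC addrA subrK.
have hE x : has_inf (E x).
  split; first by exists (dot a 0 + `|x - inc 0|), 0.
  by exists (dot a 0 - `|x - inc 0|) => _ [y _ <-]; exact: lb.
have key x y : `|phi x - dot a y| <= `|x - inc y|.
  rewrite ler_norml lerBlDl lerBrDl; apply/andP; split.
    apply: lb_le_inf; first by have [] := hE x.
    by move=> _ [y' _ <-]; exact: lb.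
  by apply: (ge_inf (hE x).2); exists y.
have approx x e : 0 < e -> exists y, `|x - inc y| < e.
  move=> e0.
  have [|z [/= bx [y _ yz]]] := inc_dense _ (ball_open x e).
    by exists x; exact: ballxx.
  by exists y; rewrite -ball_normE -yz in bx.
have small (z : R) : (forall e, 0 < e -> `|z| <= e) -> z = 0.
  move=> hz; apply/eqP; rewrite -normr_eq0 eq_le normr_ge0 andbT leNgt.
  by apply/negP => z0; have := hz (`|z| / 2) (divr_gt0 z0 (ltr0Sn R 1)); lra.
have philin : scalar phi.
  move=> c x y; apply/eqP; rewrite -subr_eq0; apply/eqP; apply: small => e e0.
  have d0 : 0 < e / (2 * (`|c| + 1)) by rewrite divr_gt0// mulr_gt0// ltr_wpDl.
  have [x' hx'] := approx x _ d0; have [y' hy'] := approx y _ d0.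
  have -> : phi (c *: x + y) - (c * phi x + phi y) =
    (phi (c *: x + y) - dot a (c *: x' + y')) - c * (phi x - dot a x') - (phi y - dot a y').
    by rewrite dotPr; ring.
  have k1 : `|phi (c *: x + y) - dot a (c *: x' + y')| <= `|c| * `|x - inc x'| + `|y - inc y'|.
    rewrite (le_trans (key _ _))// inc_linear opprD addrACA -scalerBr.
    by rewrite (le_trans (ler_normD _ _))// normrZ.
  have k2 : `|c * (phi x - dot a x')| <= `|c| * `|x - inc x'|.
    by rewrite normrM ler_wpM2l.
  have k3 := key y y'.
  apply: le_trans (ler_normB _ _) _.
  have : `|c| * `|x - inc x'| <= `|c| * (e / (2 * (`|c| + 1))) by rewrite ler_wpM2l// ltW.
  have : 2 * (`|c| + 1) * (e / (2 * (`|c| + 1))) = e.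
    by rewrite mulrC divfK// gt_eqF// mulr_gt0// ltr_wpDl.
  move: (e / _) d0 hx' hy' => d d0 hx' hy'.
  have := ler_normB (phi (c *: x + y) - dot a (c *: x' + y')) (c * (phi x - dot a x')).
  have := normr_ge0 c; nra.
have bnd x : `|phi x| <= `|x|.
  rewrite -subr_le0; rewrite leNgt; apply/negP => p0.
  have [y hy] := approx x _ (divr_gt0 p0 (ltr0Sn R 2)).
  have := key x y; have := ha y; have := ler_normB x (x - inc y).
  rewrite subKr; have := ler_normD (phi x - dot a y) (dot a y); rewrite subrK.
  move: hy; lra.
exists phi => //; split=> //.
- move=> x; apply/cvgrPdist_lt => e e0; near=> y.
  have -> : phi x - phi y = phi (x - y).
    by rewrite [x - y]addrC -[- y]scaleN1r philin mulN1r addrC.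
  rewrite (le_lt_trans (bnd _))//; near: y; exact: cvgr_dist_lt.
- move=> y; apply/eqP; rewrite -subr_eq0 -normr_le0 (le_trans (key _ y))//.
  by rewrite subrr normr0.
Unshelve. all: by end_near. Qed.

End dual.

Section separation.
Context {R : realType} {H : completeNormedModType R} {B : normedModType R}.
Variables (dot : H -> H -> R) (inc : H -> B).
Hypothesis hH : hilbert_axioms dot.
Hypothesis inc_linear : linear inc.
Hypothesis inc_inj : injective inc.
Hypothesis inc_dense : dense (range inc).
Hypothesis inc_cont : continuous inc.

Let inc0 : inc 0 = 0.
Proof. by have := inc_linear (-1) 0 0; rewrite scaler0 addr0 scaleN1r addNr. Qed.

Let incZ c x : inc (c *: x) = c *: inc x.
Proof. by rewrite -[c *: x]addr0 inc_linear inc0 addr0. Qed.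

(** The projection of h0 on the closed convex set {y | `|inc y| <= r} of H gives
   a separating hyperplane, whose normal vector belongs to the dual of B *)
Lemma dual_separation (h0 : H) (r : R) : 0 < r -> r < `|inc h0| ->
  exists a phi, [/\ dual_pair dot inc a phi, (forall x, `|phi x| <= `|x|) & r < phi (inc h0)].
Proof.
move=> r0 rh.
pose C := [set y | `|inc y| <= r].
have clC : closed C.
  apply: (@closed_comp _ _ (fun y => `|inc y|) [set x | x <= r]); last exact: closed_le.
  by move=> y _; apply: cvg_norm; exact: inc_cont.
have cvxC x y t : 0 <= t <= 1 -> C x -> C y -> C (t *: x + (1 - t) *: y).
  move=> /andP[t0 t1]; rewrite /C /= inc_linear incZ => hx hy.
  rewrite (le_trans (ler_normD _ _))// !normrZ (ger0_norm t0) ger0_norm ?subr_ge0//.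
  have : t * `|inc x| <= t * r by rewrite ler_wpM2l.
  have : (1 - t) * `|inc y| <= (1 - t) * r by rewrite ler_wpM2l// subr_ge0.
  lra.
have C0 : C !=set0 by exists 0; rewrite /C /= inc0 normr0 ltW.
have [p Cp hp] := convex_projection hH h0 C0 clC cvxC.
set a := h0 - p in hp.
have a0 : a != 0.
  rewrite /a subr_eq0; apply: contraTneq rh => ->; rewrite -leNgt; exact: Cp.
have na : 0 < `|a| ^+ 2 by rewrite exprn_gt0// normr_gt0.
pose sg := dot a p.
have hsg y : C y -> dot a y <= sg by move=> /hp; rewrite (dotBr hH) subr_le0.
have sg0 : 0 < sg.
  have k0 : 0 < r / (`|inc a| + 1) by rewrite divr_gt0// ltr_wpDl.
  apply: (@lt_le_trans _ _ (dot a ((r / (`|inc a| + 1)) *: a))).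
    by rewrite (dotZr hH) (dot_norm hH) mulr_gt0.
  apply: hsg; rewrite /C /= incZ normrZ (gtr0_norm k0) mulrAC ler_pdivrMr ?ltr_wpDl//.
  by rewrite ler_pM2l// lerDl.
pose a' := (r / sg) *: a.
have c0 : 0 < r / sg by rewrite divr_gt0.
have ub y : dot a' y <= `|inc y|.
  have [->|y0] := eqVneq y 0; first by rewrite (dot0r hH).
  have iy : 0 < `|inc y| by rewrite normr_gt0 -inc0 (inj_eq inc_inj).
  have : C ((r / `|inc y|) *: y).
    rewrite /C /= incZ normrZ gtr0_norm ?divr_gt0// divfK// gt_eqF//.
  move/hsg; rewrite (dotZr hH) mulrAC ler_pdivrMr// => h.
  by rewrite /a' (dotZl hH) mulrAC ler_pdivrMr// (mulrC `|inc y|).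
have hb y : `|dot a' y| <= `|inc y|.
  rewrite ler_norml ub andbT lerNl -(dotNr hH) (le_trans (ub _))//.
  by rewrite -scaleN1r incZ scaleN1r normrN.
have lr c x y z : dot z (c *: x + y) = c * dot z x + dot z y.
  by rewrite (dotDr hH) (dotZr hH).
have [phi dp bp] := dual_pair_extend inc_linear inc_dense hb lr.
exists a', phi; split => //; have [_ _ ->] := dp.
rewrite /a' (dotZl hH) -ltr_pdivrMl// invf_div mulrC mulrCA divff ?gt_eqF// mulr1.
have -> : dot a h0 = `|a| ^+ 2 + sg by rewrite -(dot_norm hH) -(dotDr hH) /a subrK.
by rewrite ltrDr.
Qed.

End separation.

(** * Measures with density and Borel measurability *)

Section density_measure.
Context d (T : measurableType d) (R : realType) (mu : {measure set T -> \bar R}) (g : T -> R).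
Hypothesis g0 : forall x, 0 <= g x.
Hypothesis mg : measurable_fun setT g.

Definition density_measure of (forall x, 0 <= g x) & measurable_fun setT g : set T -> \bar R :=
  fun A => (\int[mu]_(x in A) (g x)%:E)%E.

Let nu := density_measure g0 mg.

Let nu0 : nu set0 = 0%E.
Proof. exact: integral_set0. Qed.

Let nu_ge0 A : (0 <= nu A)%E.
Proof. by apply: integral_ge0 => x _; rewrite lee_fin. Qed.

Let nu_sigma_additive : semi_sigma_additive nu.
Proof.
move=> A mA tA mUA; rewrite /nu /density_measure ge0_integral_bigcup//.
- by apply: is_cvg_ereal_nneg_natsum_cond => n _ _; exact: nu_ge0.
- by apply/measurable_EFinP; exact: measurable_funTS.
- by move=> x _; rewrite lee_fin.
Qed.

HB.instance Definition _ := isMeasure.Build _ _ _ (density_measure g0 mg) nu0 nu_ge0 nu_sigma_additive.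

End density_measure.

Section borel.
Context {R : realType} {B : completeNormedModType R}.
Local Notation BT := (borelType B).
Local Notation RT := (measurableTypeR R).

Lemma continuous_borel_measurable (f : B -> R) : continuous f ->
  measurable_fun [set: BT] (f : BT -> RT).
Proof.
move=> cf; apply: (measurability _ (RGenOInfty.measurableE R)) => _ [_ [x ->] <-].
rewrite setTI; apply: sub_sigma_algebra.
by apply: open_comp => [y _|]; [exact: cf|exact: rray_open].
Qed.

Lemma continuous_borel_measurableB (f : B -> B) : continuous f ->
  measurable_fun [set: BT] (f : BT -> BT).
Proof.
move=> cf; apply: (@measurability _ _ BT BT setT f (@open B)) => //.
move=> _ [U oU <-]; rewrite setTI; apply: sub_sigma_algebra.
by apply: open_comp => // y _; exact: cf.
Qed.

End borel.

(** * Functionals of the dual and finite dimensional marginals *)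

Section wiener.
Context {R : realType} {H B : completeNormedModType R}.
Variables (dot : H -> H -> R) (inc : H -> B) (mu : R -> probability (borelType B) R).
Hypothesis hW : abstract_wiener dot inc mu.
Local Notation BT := (borelType B).
Local Notation RT := (measurableTypeR R).
Let hH : hilbert_axioms dot := aw_hilbert hW.

Let dPl a x y z : dot (a *: x + y) z = a * dot x z + dot y z.
Proof. by rewrite (dotDl hH) (dotZl hH). Qed.

Let incD x y : inc (x + y) = inc x + inc y.
Proof. by rewrite -[x]scale1r (aw_linear hW) !scale1r. Qed.

Let inc0 : inc 0 = 0.
Proof. by have := incD 0 0; rewrite addr0 => /eqP; rewrite -subr_eq subrr eq_sym => /eqP. Qed.

Lemma incZ c x : inc (c *: x) = c *: inc x.
Proof. by rewrite -[c *: x]addr0 (aw_linear hW) inc0 addr0. Qed.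

Definition dual_fun (a : H) : B -> R := xget (cst 0) (dual_pair dot inc a).

Lemma dual_funE a phi : dual_pair dot inc a phi -> dual_fun a = phi.
Proof.
move=> ap; have : dual_pair dot inc a (dual_fun a) by exact: (xgetPex (cst 0) (ex_intro _ phi ap)).
by move=> h; exact: (dual_pair_unique (aw_dense hW) h ap).
Qed.

Lemma dual_funP a : in_dual dot inc a -> dual_pair dot inc a (dual_fun a).
Proof. by move=> [phi ap]; rewrite (dual_funE ap). Qed.

Lemma in_dual0 : in_dual dot inc 0.
Proof. by exists (cst 0); exact: dual_pair0. Qed.

Lemma in_dual_lin c x y : in_dual dot inc x -> in_dual dot inc y -> in_dual dot inc (c *: x + y).
Proof. by move=> [p xp] [q yq]; eexists; exact: (dual_pair_lin dPl c xp yq). Qed.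

Lemma dual_fun0 z : dual_fun 0 z = 0.
Proof. by rewrite (dual_funE (dual_pair0 inc dPl)). Qed.

Lemma dual_fun_lin c x y z : in_dual dot inc x -> in_dual dot inc y ->
  dual_fun (c *: x + y) z = c * dual_fun x z + dual_fun y z.
Proof.
by move=> /dual_funP px /dual_funP py; rewrite (dual_funE (dual_pair_lin dPl c px py)).
Qed.

Lemma dual_funD a x y : in_dual dot inc a -> dual_fun a (x + y) = dual_fun a x + dual_fun a y.
Proof. by move=> /dual_funP[l _ _]; rewrite -[x]scale1r l mul1r scale1r. Qed.

Lemma dual_funZ a c x : in_dual dot inc a -> dual_fun a (c *: x) = c * dual_fun a x.
Proof.
move=> ad; have [l _ _] := dual_funP ad.
have z : dual_fun a 0 = 0.
  by have := dual_funD 0 0 ad; rewrite addr0 => /eqP; rewrite -subr_eq subrr eq_sym => /eqP.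
by rewrite -[c *: x]addr0 l z addr0.
Qed.

Lemma dual_fun_inc a x : in_dual dot inc a -> dual_fun a (inc x) = dot a x.
Proof. by move=> /dual_funP[_ _ ->]. Qed.

Lemma dual_fun_measurable a : measurable_fun [set: BT] (dual_fun a : BT -> RT).
Proof.
have [ad|nad] := pselect (in_dual dot inc a).
  by apply: continuous_borel_measurable; have [] := dual_funP ad.
by rewrite /dual_fun xgetPN => // phi ap; apply: nad; exists phi.
Qed.

Lemma in_dual_sum (I : Type) (r : seq I) (F : I -> H) (c : I -> R) :
  (forall i, in_dual dot inc (F i)) -> in_dual dot inc (\sum_(i <- r) c i *: F i).
Proof.
move=> hF; elim: r => [|i r IH]; first by rewrite big_nil; exact: in_dual0.
by rewrite big_cons; exact: in_dual_lin.
Qed.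

Lemma dual_fun_sum (I : Type) (r : seq I) (F : I -> H) (c : I -> R) z :
  (forall i, in_dual dot inc (F i)) ->
  dual_fun (\sum_(i <- r) c i *: F i) z = \sum_(i <- r) c i * dual_fun (F i) z.
Proof.
move=> hF; elim: r => [|i r IH]; first by rewrite !big_nil dual_fun0.
by rewrite !big_cons dual_fun_lin ?IH//; exact: in_dual_sum.
Qed.

Lemma ell_dual s a : in_dual dot inc a ->
  ell (T := BT) (dual_pair dot inc) (mu s) a = dual_fun a.
Proof.
move=> ad; have ap := dual_funP ad; rewrite /ell; apply: xget_unique.
  by left.
move=> l [al|[]]; last by case; exists (dual_fun a).
exact: (dual_pair_unique (aw_dense hW) al ap).
Qed.

Definition coords (u : seq H) (y : BT) : (size u).-tuple RT :=
  [tuple dual_fun u`_i y | i < size u].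

Lemma measurable_coords u : measurable_fun setT (coords u).
Proof.
apply/measurable_fun_tnthP => i.
rewrite (_ : _ \o _ = (dual_fun u`_i : BT -> RT)); first exact: dual_fun_measurable.
by apply/funext => y /=; rewrite tnth_mktuple.
Qed.

Lemma tpiB_coords s u y : {in u, forall a, in_dual dot inc a} ->
  tpiB dot inc mu s u y = lincomb (coords u y).
Proof.
move=> ud; rewrite /tpiB /tpi /lincomb; apply: eq_bigr => i _.
by rewrite ell_dual ?tnth_mktuple//; apply: ud; exact: mem_nth.
Qed.

Lemma dual_fun_span u a y : orthonormal_seq dot u -> {in u, forall a, in_dual dot inc a} ->
  fspan u a -> dual_fun a y = dot a (lincomb (coords u y)).
Proof.
move=> ou ud ua; rewrite -{1}(projK hH ou ua) /proj dual_fun_sum; last first.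
  by move=> i; apply: ud; exact: mem_nth.
rewrite /lincomb (dot_sumr hH); apply: eq_bigr => i _.
by rewrite (dotZr hH) tnth_mktuple mulrC (dotC hH a).
Qed.

Lemma coords_law s u (A : set ((size u).-tuple RT)) : 0 < s -> orthonormal_seq dot u ->
  {in u, forall a, in_dual dot inc a} -> measurable A ->
  mu s (coords u @^-1` A) = gaussian s (size u) A.
Proof.
move=> s0 ou ud mA.
have := @aw_measure _ _ _ _ _ _ hW s s0 (size u) (fun i => u`_i) (fun i => dual_fun u`_i) u A.
have -> : [set x | A [tuple dual_fun u`_i x | i < size u]] = coords u @^-1` A by [].
move=> -> //.
- congr (gaussian _ _ _); apply/seteqP; split=> t /=.
    rewrite (_ : [tuple _ | i < _] = t)//.
    by apply: eq_from_tnth => i; rewrite tnth_mktuple (dot_lincomb hH ou).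
  rewrite (_ : [tuple _ | i < _] = t)//.
  by apply: eq_from_tnth => i; rewrite tnth_mktuple (dot_lincomb hH ou).
- by move=> i; apply: dual_funP; apply: ud; exact: mem_nth.
- by move=> i; exact: fspan_nth.
Qed.

Lemma ge0_integral_coords s u (F : (size u).-tuple RT -> \bar R) : 0 < s ->
  orthonormal_seq dot u -> {in u, forall a, in_dual dot inc a} ->
  measurable_fun setT F -> (forall t, 0 <= F t)%E ->
  (\int[mu s]_y F (coords u y) = \int[gaussian s (size u)]_t F t)%E.
Proof.
move=> s0 ou ud mF F0.
rewrite -(ge0_integral_pushforward (@measurable_coords u) (mu s) measurableT)//=.
apply: eq_measure_integral; first exact: measurable_coords.
by move=> ? A mA _; exact: (coords_law s0 ou ud mA).
Qed.

End wiener.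

(** * Cylinders determine Borel measures on B *)

Section cameron_martin.
Context {R : realType} {H B : completeNormedModType R}.
Variables (dot : H -> H -> R) (inc : H -> B) (mu : R -> probability (borelType B) R).
Hypothesis hW : abstract_wiener dot inc mu.
Local Notation BT := (borelType B).
Local Notation RT := (measurableTypeR R).
Local Notation L := (dual_fun dot inc).
Let hH : hilbert_axioms dot := aw_hilbert hW.

Let inc_cont : continuous inc. Proof. exact: aw_continuous hW. Qed.

Let LB a x y : in_dual dot inc a -> L a (x - y) = L a x - L a y.
Proof.
move=> ad; rewrite (dual_funD hW _ _ ad) -scaleN1r (dual_funZ hW _ _ ad).
by rewrite mulN1r.
Qed.

(** A separable version of the Hahn-Banach theorem: functionals of norm at
    most one that almost attain the norm at the points of a countable dense
    set of [H] determine the norm of [B]. *)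
Lemma norming_functionals : exists a : nat -> H,
  [/\ forall n, in_dual dot inc (a n), forall n x, L (a n) x <= `|x| &
      forall x r, (forall n, L (a n) x <= r) -> `|x| <= r].
Proof.
have [d [_ dd]] := dense_sequence hH (S := setT) I (fun O O0 _ => let: ex_intro x Ox := O0 in ex_intro _ x (conj Ox I)).
have ex (n k : nat) : exists a, [/\ in_dual dot inc a, forall x, L a x <= `|x| &
    `|inc (d n)| - k.+1%:R^-1 <= L a (inc (d n))].
  set r := `|inc (d n)| - k.+1%:R^-1.
  have k0 : 0 < k.+1%:R^-1 :> R by rewrite invr_gt0 ltr0n.
  have [r0|r0] := leP r 0.
    exists 0; split; first exact: (in_dual0 hW).
      by move=> x; rewrite (dual_fun0 hW).
    by rewrite (dual_fun0 hW).
  have [||||| a [phi [ap bp rp]]] := @dual_separation R H B dot inc hH _ _ _ _ (d n) r r0.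
  - exact: aw_linear hW.
  - exact: aw_injective hW.
  - exact: aw_dense hW.
  - exact: aw_continuous hW.
  - by rewrite ltrBlDr ltrDl.
  exists a; rewrite (dual_funE hW ap); split; [by exists phi| |exact: ltW]. 
  by move=> x; rewrite (le_trans (ler_norm _)).
have ex' (m : nat) : exists a, [/\ in_dual dot inc a, forall x, L a x <= `|x| &
    forall n k, unpickle m = Some (n, k) -> `|inc (d n)| - k.+1%:R^-1 <= L a (inc (d n))].
  case E : (unpickle m : option (nat * nat)) => [[n k]|].
    by have [a [a1 a2 a3]] := ex n k; exists a; split=> // ? ? [<- <-].
  by have [a [a1 a2 _]] := ex 0%N 0%N; exists a.
have [a aP] := choice ex'.
exists a; split=> [n|n x|x r hr]; [by have [] := aP n|by have [_ h _] := aP n; exact: h|].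
rewrite leNgt; apply/negP => rx.
pose e := (`|x| - r) / 3; have e0 : 0 < e by rewrite divr_gt0// subr_gt0.
have [|z [xz [y _ yz]]] := aw_dense hW _ (ball_open x e); first by exists x; exact: ballxx.
have op : open (inc @^-1` ball x e).
  by apply: open_comp; [move=> w _; exact: inc_cont|exact: ball_open].
have [|w [xw [n _ nw]]] := dd _ _ op; first by exists y; rewrite /= yz.
have {xw} : `|x - inc (d n)| < e by rewrite -ball_normE /= -nw in xw.
move=> hd.
have [k _ /(_ k (leqnn k)) /= hk] := near_infty_natSinv_lt (PosNum e0).
have [ad bnd /(_ n k)] := aP (pickle (n, k)).
rewrite pickleK => /(_ erefl) h.
have hrx := hr (pickle (n, k)).
have hb := bnd (inc (d n) - x); rewrite LB// [`|inc _ - x|]distrC in hb.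
have hx := ler_normD (x - inc (d n)) (inc (d n)); rewrite subrK in hx.
have hex : `|x| = r + 3 * e by rewrite /e; lra.
have : `|x| < `|x|; last by rewrite ltxx.
rewrite {2}hex; apply: (le_lt_trans hx).
have h2 : `|inc (d n)| <= L (a (pickle (n, k))) (inc (d n)) + k.+1%:R^-1 by rewrite -lerBlDr.
have h3 : L (a (pickle (n, k))) (inc (d n)) <= `|x - inc (d n)| + r.
  by rewrite -lerBlDr; apply: le_trans hb; rewrite lerB.
have -> : r + 3 * e = e + (e + r + e) by ring.
by rewrite ltrD// (le_lt_trans h2)// ltrD// (le_lt_trans h3)// ltrD2r.
Qed.

(** Finite intersections of half spaces; they form a pi-system. *)
Definition cylinder (l : seq (H * R)) : set BT :=
  [set x | forall p, p \in l -> L p.1 x <= p.2].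

Definition cylinders : set (set BT) :=
  [set C | exists2 l, (forall p, p \in l -> in_dual dot inc p.1) & C = cylinder l].

Lemma cylinder_measurable : cylinders `<=` measurable.
Proof.
move=> _ [l _ ->].
have -> : cylinder l = \big[setI/setT]_(p <- l) [set x : BT | L p.1 x <= p.2].
  rewrite -bigcap_seq; apply/seteqP; split=> x /= h p; exact: h.
apply: bigsetI_measurable => p _.
have := dual_fun_measurable hW p.1; move/(_ measurableT `]-oo, p.2]%classic (measurable_itv _)).
by rewrite setTI; congr measurable; apply/seteqP; split=> x /=; rewrite in_itv.
Qed.

Lemma cylinders_setI : setI_closed cylinders.
Proof.
move=> _ _ [l1 h1 ->] [l2 h2 ->]; exists (l1 ++ l2).
  by move=> p; rewrite mem_cat => /orP[/h1|/h2].
apply/seteqP; split=> x /=.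
  by move=> [x1 x2] p; rewrite mem_cat => /orP[/x1|/x2].
by move=> hx; split=> p pl; apply: hx; rewrite mem_cat pl ?orbT.
Qed.

(** Open sets are countable unions of closed balls, and a closed ball is a
    countable intersection of half spaces given by the norming functionals. *)
Lemma borel_cylinders : @measurable _ BT `<=` <<s cylinders >>.
Proof.
apply: smallest_sub; first exact: smallest_sigma_algebra.
pose GT := g_sigma_algebraType cylinders.
have [a [ad bnd norming]] := norming_functionals.
have [d [_ dd]] := dense_sequence hH (S := setT) I (fun O O0 _ => let: ex_intro x Ox := O0 in ex_intro _ x (conj Ox I)).
have cball c (r : R) : @measurable _ GT [set x | `|x - c| <= r].
  have -> : [set x : B | `|x - c| <= r] = \bigcap_n [set x | L (a n) x <= r + L (a n) c].
    apply/seteqP; split=> x /=.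
      by move=> hx n _ /=; rewrite -lerBlDr -LB// (le_trans (bnd _ _)).
    move=> hx; apply: norming => n; rewrite LB// lerBlDr; exact: hx.
  apply: bigcapT_measurable => n; apply: sub_sigma_algebra.
  exists [:: (a n, r + L (a n) c)]; first by move=> p; rewrite inE => /eqP ->; exact: ad.
  apply/seteqP; split=> x /=.
    by move=> hx p; rewrite inE => /eqP ->.
  by move=> /(_ _ (mem_head _ _)).
move=> U oU.
have -> : U = \bigcup_n \bigcup_k (if `[< [set x | `|x - inc (d n)| <= k.+1%:R^-1] `<=` U >]
    then [set x | `|x - inc (d n)| <= k.+1%:R^-1] else set0).
  apply/seteqP; split=> x; last by move=> [n _ [k _]]; case: asboolP => // h; exact: h.
  move=> Ux.
  have /nbhs_ballP[e /= e0 xe] : nbhs x U by exact: open_nbhs_nbhs.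
  have e20 : 0 < e / 2 by rewrite divr_gt0.
  have [k _ /(_ k (leqnn k)) /= hk] := near_infty_natSinv_lt (PosNum e20).
  have k0 : 0 < k.+1%:R^-1 :> R by rewrite invr_gt0 ltr0n.
  have [|z [xz [y _ yz]]] := aw_dense hW _ (ball_open x k.+1%:R^-1).
    by exists x; exact: ballxx.
  have op : open (inc @^-1` ball x k.+1%:R^-1).
    by apply: open_comp; [move=> w _; exact: inc_cont|exact: ball_open].
  have [|w [xw [n _ nw]]] := dd _ _ op; first by exists y; rewrite /= yz.
  have {xw} xd : `|x - inc (d n)| < k.+1%:R^-1 by rewrite -ball_normE /= -nw in xw.
  exists n => //; exists k => //; case: asboolP => [_|]; first exact: ltW.
  case=> z' /= hz'; apply: xe; rewrite -ball_normE /=.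
  have -> : x - z' = (x - inc (d n)) - (z' - inc (d n)) by rewrite opprB addrA subrK.
  apply: le_lt_trans (ler_normB _ _) _; rewrite (splitr e) ltrD//.
    exact: lt_trans xd hk.
  exact: le_lt_trans hz' hk.
apply: (@bigcupT_measurable _ GT) => n; apply: (@bigcupT_measurable _ GT) => k.
case: asboolP => _; [exact: cball|exact: measurable0].
Qed.

(** Dynkin's theorem for the pi-system of cylinders. *)
Lemma borel_measure_unique (m1 m2 : {measure set BT -> \bar R}) :
  (m1 setT < +oo)%E -> (forall A, cylinders A -> m1 A = m2 A) ->
  forall A, measurable A -> m1 A = m2 A.
Proof.
move=> m1T m12 A mA.
have cT : cylinders setT.
  by exists [::] => //; apply/seteqP; split=> // x _ p; rewrite in_nil.
apply: (@g_sigma_algebra_measure_unique _ R BT cylinders cylinder_measurable (fun=> setT)) => //.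
- by rewrite bigcup_const.
- exact: cylinders_setI.
- exact: borel_cylinders.
Qed.

End cameron_martin.

(** * The Cameron-Martin formula *)

Section cameron_martin_shift.
Context {R : realType} {H B : completeNormedModType R}.
Variables (dot : H -> H -> R) (inc : H -> B) (mu : R -> probability (borelType B) R).
Hypothesis hW : abstract_wiener dot inc mu.
Local Notation BT := (borelType B).
Local Notation RT := (measurableTypeR R).
Local Notation L := (dual_fun dot inc).
Let hH : hilbert_axioms dot := aw_hilbert hW.

Variables (e : H) (s : R).
Hypotheses (eB : in_dual dot inc e) (ee : dot e e = 1) (s0 : 0 < s).

Definition wshift (t : R) (y : BT) : BT := (y : B) + t *: inc e.

(** The density exp (- t L y / s - t^2 / (2 s)) of the law of [y - t e] with
    respect to the law of [y]. *)
Definition cm_weight (t : R) (y : BT) : R := expR (- L e y * t / s - t ^+ 2 / (2 * s)).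

Lemma measurable_wshift t : measurable_fun setT (wshift t).
Proof.
apply: continuous_borel_measurableB => y.
by apply: cvgD => //; exact: cvg_cst.
Qed.

Lemma cm_weight_ge0 t y : 0 <= cm_weight t y. Proof. exact: expR_ge0. Qed.

Lemma measurable_cm_weight t : measurable_fun setT (cm_weight t).
Proof.
apply: measurableT_comp => //; apply: measurable_funB => //.
apply: measurable_funM => //; apply: measurable_funM => //.
by apply: measurableT_comp => //; exact: (dual_fun_measurable hW).
Qed.

Lemma dual_fun_wshift a t y : in_dual dot inc a -> L a (wshift t y) = L a y + t * dot a e.
Proof. by move=> ad; rewrite (dual_funD hW)// (dual_funZ hW)// (dual_fun_inc hW). Qed.

Let v (t : R) n (i : 'I_n) : R := if i == 0%N :> nat then t else 0.

Let coords_wshift w t y : orthonormal_seq dot (e :: w) ->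
  {in e :: w, forall a, in_dual dot inc a} ->
  coords dot inc (e :: w) (wshift t y) = taff 1 (fun i => v t i) (coords dot inc (e :: w) y).
Proof.
move=> ou ud; apply: eq_from_tnth => i; rewrite !tnth_mktuple mul1r.
have ui : in_dual dot inc (e :: w)`_i by apply: ud; exact: mem_nth.
rewrite dual_fun_wshift//; congr (_ + _).
by have := ou i 0%N (ltn_ord i) isT; rewrite /= => ->; rewrite /v; case: eqP => _; rewrite ?mulr1 ?mulr0.
Qed.

Let weight_coords w t y :
  \prod_(i < size (e :: w)) naff 1 s s (tnth (coords dot inc (e :: w) y) i) (v t i) =
  cm_weight t y.
Proof.
rewrite big_ord_recl big1 ?mulr1; last first.
  move=> i _; rewrite naff_shiftE// /v /= mulr0 mul0r expr0n/= mul0r subr0 expR0//.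
by rewrite naff_shiftE// tnth_mktuple.
Qed.

Let nu t := pushforward (density_measure (mu s) (cm_weight_ge0 t) (measurable_cm_weight t)) (wshift t).

(** Both sides are finite measures in [A], so cylinders suffice. The vectors
    of a cylinder and [e] lie in the span of a finite orthonormal family
    starting with [e], for which only the first coordinate is shifted. *)
Lemma cameron_martin_measure t A : measurable A -> mu s A = nu t A.
Proof.
move=> mA.
apply: (borel_measure_unique hW (m1 := mu s)
  (m2 := pushforward (density_measure (mu s) (cm_weight_ge0 t) (measurable_cm_weight t)) (wshift t))) => //.
- exact: measurable_wshift.
- by rewrite [X in (X < _)%E]probability_setT ltry.
move=> mw _ [l hl ->].
have oe : orthonormal_seq dot [:: e].
  by move=> [|i] [|j] //= _ _; rewrite ee.
have [||w [ou ud hw]] := gram_schmidt hH (in_dual0 hW) (in_dual_lin hW)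
  (u := [:: e]) (ys := map fst l) oe.
- by move=> x; rewrite inE => /eqP ->.
- by move=> x /mapP[p pl ->]; exact: hl.
rewrite cat1s in ou ud hw.
pose D := [set t : (size (e :: w)).-tuple RT | forall p, p \in l -> dot p.1 (lincomb t) <= p.2].
have mD : measurable D.
  have -> : D = \big[setI/setT]_(p <- l) [set t : (size (e :: w)).-tuple RT | dot p.1 (lincomb t) <= p.2].
    by rewrite -bigcap_seq; apply/seteqP; split=> x /= h p; exact: h.
  apply: bigsetI_measurable => p _.
  have ml : measurable_fun setT (fun t : (size (e :: w)).-tuple RT => dot p.1 (lincomb t) : RT).
    rewrite (_ : (fun _ => _) = tdot (fun i : 'I_(size (e :: w)) => dot p.1 (e :: w)`_i)); first exact: measurable_tdot.
    apply/funext => x; rewrite /lincomb (dot_sumr hH) /tdot; apply: eq_bigr => i _.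
    by rewrite (dotZr hH) mulrC.
  have := ml measurableT `]-oo, p.2]%classic (measurable_itv _).
  by rewrite setTI; congr measurable; apply/seteqP; split=> x /=; rewrite in_itv.
have CE : cylinder dot inc l = coords dot inc (e :: w) @^-1` D.
  apply/seteqP; split=> x /= h p pl; have := h p pl.
    by rewrite (dual_fun_span hW _ ou ud)//; apply: hw; exact: map_f.
  by rewrite (dual_fun_span hW _ ou ud)//; apply: hw; exact: map_f.
rewrite CE; transitivity (gaussian s (size (e :: w)) D); first exact: (coords_law hW s0 ou ud mD).
rewrite /pushforward /density_measure.
transitivity (\int[gaussian s (size (e :: w))]_t (\1_D t)%:E)%E.
  by rewrite integral_indic// setIT.
rewrite [LHS](ge0_integral_gaussian_affine (fun i : 'I_(size (e :: w)) => v t i) ltr01 s0 s0); last 2 first.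
- by apply/measurable_EFinP; exact: measurable_indic.
- by move=> x; rewrite lee_fin.
rewrite -[LHS](ge0_integral_coords hW s0 ou ud); last 2 first.
- apply: (@measurable_taff_naff _ (size (e :: w)) 1 s s (fun i => v t i) (fun x => (\1_D x)%:E)).
  by apply/measurable_EFinP; exact: measurable_indic.
- move=> x; rewrite mule_ge0 ?lee_fin// prodr_ge0// => i _; exact: naff_ge0.
rewrite [RHS]integral_mkcond; apply: eq_integral => y _.
rewrite weight_coords -coords_wshift// patchE indicE.
rewrite (_ : (y \in _) = (coords dot inc (e :: w) (wshift t y) \in D)); last first.
  by apply/idP/idP; rewrite !inE.
by case: ifP => _; rewrite ?mul1e ?mul0e.
Qed.

Lemma cameron_martin t (F : BT -> \bar R) : measurable_fun setT F -> (forall y, 0 <= F y)%E ->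
  (\int[mu s]_y F y = \int[mu s]_y (F (wshift t y) * (cm_weight t y)%:E))%E.
Proof.
move=> mF F0.
rewrite (eq_measure_integral (pushforward (density_measure (mu s) (cm_weight_ge0 t) (measurable_cm_weight t)) (wshift t))).
- exact: measurable_wshift.
- move=> mw'; rewrite ge0_integral_pushforward// preimage_setT.
  apply: ge0_integral_density => //.
  + by move=> y; exact: cm_weight_ge0.
  + exact: measurable_cm_weight.
  + exact: (measurableT_comp mF mw').
  + by move=> y; exact: F0.
- by move=> ? A mA _; exact: cameron_martin_measure.
Qed.

End cameron_martin_shift.

(** * Schwartz functions on a finite dimensional subspace *)

Section lipschitz_measurable.
Context {R : realType} (n : nat).
Local Notation RT := (measurableTypeR R).
Local Notation TT := (n.-tuple RT).

(** A Lipschitz function is the pointwise limit of functions that are constant on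
   the cells of the lattices of mesh 1/k, hence it is measurable *)
Lemma lipschitz_measurable (F : TT -> R) (M : R) :
  (forall t t' : TT, `|F t - F t'| <= M * \sum_(i < n) `|tnth t i - tnth t' i|) ->
  measurable_fun setT F.
Proof.
move=> FM.
pose cell (k : nat) (t : TT) : n.-tuple int := [tuple Num.floor (k.+1%:R * tnth t i) | i < n].
pose pt (k : nat) (z : n.-tuple int) : TT := [tuple (tnth z i)%:~R / k.+1%:R | i < n].
pose G k t := F (pt k (cell k t)).
have mG k : measurable_fun setT (G k).
  move=> _ Y mY; rewrite setTI.
  have -> : G k @^-1` Y = \bigcup_z (cell k @^-1` [set z] `&` [set _ | Y (F (pt k z))]).
    apply/seteqP; split=> t /=; first by move=> h; exists (cell k t).
    by move=> [z _ /= [cz h]]; rewrite /G cz.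
  apply: countable_bigcupT_measurable; first exact: countableP.
  move=> z; apply: measurableI; last first.
    have [yz|nyz] := pselect (Y (F (pt k z))).
      by rewrite (_ : [set _ | _] = setT)//; apply/seteqP; split.
    by rewrite (_ : [set _ | _] = set0)//; apply/seteqP; split.
  have -> : cell k @^-1` [set z] = \big[setI/setT]_(i < n)
      ((fun t : TT => k.+1%:R * tnth t i) @^-1` `[(tnth z i)%:~R, (tnth z i + 1)%:~R[%classic).
    rewrite -bigcap_seq; apply/seteqP; split=> t /=.
      move=> <- i _ /=; rewrite tnth_mktuple in_itv/=.
      by apply/andP; split; [exact: floor_le|exact: floorD1_gt].
    move=> h; apply: eq_from_tnth => i; rewrite tnth_mktuple.
    have := h i (mem_index_enum i); rewrite /= in_itv/= => hi.
    by apply: floor_def; rewrite ?num_real//.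
  apply: bigsetI_measurable => i _; rewrite -[X in measurable X]setTI.
  have mm : measurable_fun setT (fun t : TT => k.+1%:R * tnth t i : RT).
    by apply: measurable_funM => //; exact: measurable_tnth.
  exact: (mm measurableT _ (measurable_itv _)).
apply: (measurable_fun_cvg mG) => t _.
apply/cvgrPdist_lt => e e0.
have M0 : 0 <= `|M| * n%:R by rewrite mulr_ge0.
have d0 : 0 < e / (`|M| * n%:R + 1) by rewrite divr_gt0// ltr_wpDl.
have [k0 _ hk0] := near_infty_natSinv_lt (PosNum d0).
exists k0 => // k /= kk.
have ki : k.+1%:R^-1 < e / (`|M| * n%:R + 1) by exact: hk0.
have k1 : 0 < k.+1%:R :> R by rewrite ltr0n.
apply: (le_lt_trans (FM _ _)).
have hi i : `|tnth t i - tnth (pt k (cell k t)) i| <= k.+1%:R^-1.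
  rewrite !tnth_mktuple; set a := k.+1%:R * tnth t i.
  have -> : tnth t i = a / k.+1%:R by rewrite /a mulrAC divff ?mul1r// gt_eqF.
  rewrite -mulrBl normrM [X in _ * X]gtr0_norm ?invr_gt0// ler_piMl ?invr_ge0 ?ltW//.
  rewrite ger0_norm ?subr_ge0 ?floor_le//.
  by have := floorD1_gt a; rewrite intrD ltrBlDl.
apply: (@le_lt_trans _ _ (`|M| * (n%:R * k.+1%:R^-1))).
  apply: (@le_trans _ _ (`|M| * \sum_(i < n) `|tnth t i - tnth (pt k (cell k t)) i|)).
    by rewrite ler_wpM2r ?ler_norm// sumr_ge0.
  rewrite ler_wpM2l// mulr_natl -[X in _ *+ X](card_ord n) -sumr_const.
  by apply: ler_sum => i _; exact: hi.
rewrite mulrA; apply: (@le_lt_trans _ _ ((`|M| * n%:R + 1) * k.+1%:R^-1)).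
  by rewrite ler_wpM2r ?invr_ge0 ?ltW// ltrDl.
by rewrite -ltr_pdivlMl ?ltr_wpDl// mulrC.
Qed.

End lipschitz_measurable.

Section line_derivative.
Context {R : realType} {V : normedModType R}.

Lemma derivable_line (f : V -> R) (x v : V) (s : R) : derivable f (x + s *: v) v ->
  is_derive s (1 : R) (fun s => f (x + s *: v)) ('D_v f (x + s *: v)).
Proof.
move=> df.
have E : (fun h : R => h^-1 *: (((fun s => f (x + s *: v)) \o shift s) (h *: (1 : R)) - f (x + s *: v))) =
  (fun h : R => h^-1 *: ((f \o shift (x + s *: v)) (h *: v) - f (x + s *: v))).
  apply/funext => h /=; congr (_ *: (f _ - _)).
  by rewrite (_ : h *: (1 : R) = h) ?scalerDl 1?addrCA//; exact: mulr1.
split; first by rewrite /derivable E.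
by rewrite /derive E.
Qed.

Lemma line_lipschitz (f : V -> R) (x v : V) (M : R) :
  (forall s, derivable f (x + s *: v) v) ->
  (forall s, `|'D_v f (x + s *: v)| <= M) ->
  forall s, `|f (x + s *: v) - f x| <= M * `|s|.
Proof.
move=> df dM s.
pose g (s : R) := f (x + s *: v).
have dg r : is_derive r (1 : R) g ('D_v f (x + r *: v)) by exact: derivable_line.
have cg : continuous g.
  by move=> r; apply: differentiable_continuous; apply/derivable1_diffP.
have g0 : f x = g 0 by rewrite /g scale0r addr0.
rewrite g0 -/(g s).
have [s0|s0] := leP 0 s.
  have [c _ ->] := MVT_segment s0 (fun r _ => dg r) (continuous_subspaceT cg).
  by rewrite subr0 normrM ler_wpM2r.
have [c _ E] := MVT_segment (ltW s0) (fun r _ => dg r) (continuous_subspaceT cg).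
by rewrite distrC E sub0r normrM normrN ler_wpM2r.
Qed.

End line_derivative.

Section schwartz.
Context {R : realType} {H : completeNormedModType R} (dot : H -> H -> R).
Hypothesis hH : hilbert_axioms dot.
Variable u : seq H.
Hypothesis ou : orthonormal_seq dot u.
Local Notation RT := (measurableTypeR R).
Local Notation n := (size u).
Local Notation TT := (n.-tuple RT).
Local Notation sch := (schwartz_on dot u).

(** A list of directions followed by [v] is again a list of directions of the
    subspace. *)
Lemma schwartz_derive (f : H -> R) v : sch f -> fspan u v -> sch ('D_v f).
Proof.
move=> sf uv w wu.
have E : partials w ('D_v f) = partials (rcons w v) f.
  by rewrite /partials foldr_rcons.
rewrite E; apply: sf => x; rewrite mem_rcons inE => /orP[/eqP ->//|]; exact: wu.
Qed.

Lemma schwartz_bound (f : H -> R) N : sch f ->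
  exists M, forall x, fspan u x -> (1 + dot x x) ^+ N * `|f x| <= M.
Proof. by move=> /(_ [::]) []// _ h; exact: h. Qed.

Lemma schwartz_derivable (f : H -> R) x v : sch f -> fspan u x -> fspan u v -> derivable f x v.
Proof. by move=> /(_ [::]) []// h _; exact: h. Qed.

Lemma lincomb_span (t : TT) : fspan u (lincomb t).
Proof. by exists t. Qed.

Lemma lincombD (t s : TT) : lincomb t + lincomb s = lincomb (u := u) [tuple tnth t i + tnth s i | i < n].
Proof.
by rewrite /lincomb -big_split; apply: eq_bigr => i _ /=; rewrite tnth_mktuple scalerDl.
Qed.

Definition tset (j : 'I_n) (s : R) (t : TT) : TT := taff 1 (fun i => if i == j then s else 0) t.

Lemma lincomb_tset j s t : lincomb (tset j s t) = lincomb t + s *: u`_j.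
Proof.
rewrite /lincomb; under eq_bigr do rewrite tnth_mktuple mul1r scalerDl.
rewrite big_split/=; congr (_ + _); rewrite (bigD1 j)//= eqxx big1 ?addr0// => i ij.
by rewrite (negbTE ij) scale0r.
Qed.

(** The partial derivatives are bounded; points are joined by changing one
    coordinate at a time. *)
Lemma schwartz_lipschitz (f : H -> R) : sch f -> exists M, forall t t' : TT,
  `|f (lincomb t) - f (lincomb t')| <= M * \sum_(i < n) `|tnth t i - tnth t' i|.
Proof.
move=> sf.
have [M hM] : exists M, forall (j : 'I_n) x, fspan u x -> `|'D_(u`_j) f x| <= M.
  have ex (j : 'I_n) : exists M, forall x, fspan u x -> `|'D_(u`_j) f x| <= M.
    have [M hM] := schwartz_bound 0 (schwartz_derive sf (fspan_nth (ltn_ord j))).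
    by exists M => x ux; have := hM x ux; rewrite expr0 mul1r.
  have [M hM] := choice ex.
  exists (\sum_(j < n) `|M j|) => j x ux; apply: (le_trans (hM j x ux)).
  by apply: (le_trans (ler_norm _)); rewrite (bigD1 j)//= lerDl sumr_ge0.
exists M => t t'.
pose mid (k : nat) : TT := [tuple if (i < k)%N then tnth t i else tnth t' i | i < n].
have m0 : mid 0%N = t' by apply: eq_from_tnth => i; rewrite tnth_mktuple.
have mn : mid n = t by apply: eq_from_tnth => i; rewrite tnth_mktuple ltn_ord.
have step (j : 'I_n) : `|f (lincomb (mid j.+1)) - f (lincomb (mid j))| <=
    M * `|tnth t j - tnth t' j|.
  have -> : mid j.+1 = tset j (tnth t j - tnth t' j) (mid j).
    apply: eq_from_tnth => i; rewrite !tnth_mktuple mul1r.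
    have [->|ij] := eqVneq i j; first by rewrite ltnSn ltnn addrC subrK.
    rewrite addr0 ltnS leq_eqVlt (_ : (i : nat) == j = false)//; exact: negbTE.
  rewrite lincomb_tset; apply: line_lipschitz => s.
    apply: schwartz_derivable => //; last exact: fspan_nth.
    by apply: fspanD; [exact: lincomb_span|apply: fspanZ; exact: fspan_nth].
  by apply: hM; apply: fspanD; [exact: lincomb_span|apply: fspanZ; exact: fspan_nth].
rewrite -[in X in `|X - _|]mn -[in X in `|_ - X|]m0.
rewrite -(telescope_sumr (fun k => f (lincomb (mid k))) (leq0n n)).
rewrite big_mkord (le_trans (ler_norm_sum _ _ _))// mulr_sumr.
exact: ler_sum.
Qed.

End schwartz.

(** * Integration by parts and decay of the Wigner integral *)

Section wigner_ibp.
Context {R : realType} (h : R) (n : nat).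
Hypothesis h0 : 0 < h.
Local Notation RT := (measurableTypeR R).
Local Notation TT := (n.-tuple RT).
Local Notation W := (wigner_integral h).

Definition tstep (j : 'I_n) (s : R) (t : TT) : TT := taff 1 (fun i => if i == j then s else 0) t.

Lemma phase_tstep th b (xi t : TT) j s :
  phase h th b xi (tstep j s t) = phase h th b xi t + - (2 / h * tnth xi j) * s.
Proof.
rewrite /phase /tdot -addrA; congr (_ + _).
rewrite (bigD1 j)//= [in RHS](bigD1 j)//= addrAC; congr (_ + _).
  rewrite tnth_mktuple eqxx mul1r; ring.
apply: eq_bigr => i ij; rewrite tnth_mktuple (negbTE ij) mul1r addr0//.
Qed.

Lemma decay_tstep j s (t : TT) : -1 < s < 1 -> decay (tstep j s t) <= 3 * decay t.
Proof.
move=> /andP[s1 s2]; rewrite /decay (bigD1 j)//= [in leRHS](bigD1 j)//= mulrA.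
rewrite tnth_mktuple eqxx mul1r.
have -> : \prod_(i < n | i != j) (1 + tnth (tstep j s t) i ^+ 2)^-1 =
    \prod_(i < n | i != j) (1 + tnth t i ^+ 2)^-1.
  by apply: eq_bigr => i ij; rewrite tnth_mktuple (negbTE ij) mul1r addr0.
rewrite ler_wpM2r ?prodr_ge0//.
  by move=> i _; rewrite invr_ge0 addr_ge0 ?sqr_ge0.
move: (tnth t j) => a.
have p1 : 0 < 1 + a ^+ 2 by rewrite ltr_pwDl ?sqr_ge0.
have p2 : 0 < 1 + (a + s) ^+ 2 by rewrite ltr_pwDl ?sqr_ge0.
rewrite -[3 * _]invrK invfM invrK lef_pV2 ?posrE ?mulr_gt0// mulrC ler_pdivrMr//.
have s21 : s ^+ 2 <= 1 by rewrite expr2; nra.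
have := sqr_ge0 (a + 3 / 2 * s); lra.
Qed.

Lemma cos_subpihalf (y : R) : cos (y - pi / 2) = sin y.
Proof. by rewrite cosB cos_pihalf sin_pihalf mulr0 add0r mulr1. Qed.

Lemma phaseB th th' b (xi t : TT) : phase h (th - th') b xi t = phase h th b xi t - th'.
Proof. by rewrite /phase addrAC. Qed.

(** Multiplying the transform by the [j]-th frequency amounts to
    differentiating in [t], up to a quarter turn of the phase. It is obtained
    by differentiating the translation invariance of the weighted integral,
    under the integral sign. *)
Lemma wigner_integral_by_parts (p p' : TT -> R) (C : R) j th b xi : 0 <= C ->
  measurable_fun setT p -> measurable_fun setT p' ->
  (forall t, `|p t| <= C * decay t) -> (forall t, `|p' t| <= C * decay t) ->
  (forall t s, is_derive s (1 : R) (fun s => p (tstep j s t)) (p' (tstep j s t))) ->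
  2 / h * tnth xi j * W (th - pi / 2) b p xi = - W th b p' xi.
Proof.
move=> C0 mp mp' pC p'C dp.
set k := 2 / h * tnth xi j.
pose e (t : TT) := expR (tnorm2 t / h).
have e0 t : 0 <= e t by exact: expR_ge0.
have me : measurable_fun setT e by exact: measurable_expn2.
pose f s (t : TT) := cos (phase h th b xi (tstep j s t)) * p (tstep j s t) * e t.
pose f' s (t : TT) := (k * sin (phase h th b xi (tstep j s t)) * p (tstep j s t) +
   cos (phase h th b xi (tstep j s t)) * p' (tstep j s t)) * e t.
have df s t : is_derive s (1 : R) (f ^~ t) (f' s t).
  rewrite /f /f'; have d1 : is_derive s (1 : R)
      (fun s => cos (phase h th b xi t + - k * s)) (k * sin (phase h th b xi t + - k * s)).
    by apply: is_derive_eq; rewrite /GRing.scale/=; ring.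
  have -> : (fun s => cos (phase h th b xi (tstep j s t)) * p (tstep j s t) * e t) =
    (fun s => cos (phase h th b xi t + - k * s)) \* (fun s => p (tstep j s t)) \* cst (e t).
    by apply/funext => r /=; rewrite phase_tstep.
  have dps := dp t s.
  by apply: is_derive_eq; rewrite /GRing.scale/= phase_tstep -/k; ring.
have sb (y : R) : `|sin y| <= 1 by rewrite ler_norml sin_geN1 sin_le1.
have cb (y : R) : `|cos y| <= 1 by rewrite ler_norml cos_geN1 cos_le1.
have mph : measurable_fun setT (fun t : TT => phase h th b xi t).
  exact: (measurableT_comp (measurable_phase h th b) (measurable_pair1 xi)).
have mts s : measurable_fun setT (tstep j s) by exact: measurable_taff.
have dec3 s t : -1 < s < 1 -> C * decay (tstep j s t) * e t <= 3 * C * (e t * decay t).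
  move=> s1; rewrite mulrAC [3 * C]mulrC -mulrA -[leRHS]mulrA ler_wpM2l//.
  by rewrite mulrCA ler_wpM2l//; exact: decay_tstep.
have ib (K : R) : (gaussian (h / 2) n).-integrable setT (EFin \o (fun t => K * (e t * decay t))).
  rewrite (_ : EFin \o _ = fun t => (K%:E * (EFin \o (fun t => expR (tnorm2 t / h) * decay t)%R) t)%E)//.
  by apply: integrableZl => //; exact: integrable_decay.
have mcos s : measurable_fun setT (fun t : TT => cos (phase h th b xi (tstep j s t))).
  by apply: measurable_cos_comp; exact: (measurableT_comp mph (mts s)).
have Hi s : `]-1, 1[%classic s -> (gaussian (h / 2) n).-integrable setT (EFin \o f s).
  rewrite /= in_itv/= => s1; apply: (intble_le _ (ib (3 * C))).
    apply: measurable_funM => //; apply: measurable_funM => //.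
    exact: (measurableT_comp mp (mts s)).
  move=> t; apply: le_trans (dec3 s t s1); rewrite /f !normrM (ger0_norm (e0 t)).
  rewrite ler_wpM2r// (@le_trans _ _ (1 * `|p (tstep j s t)|))//.
    by rewrite ler_wpM2r.
  by rewrite mul1r.
have I0 : `]-1, 1[%classic (0 : R) by rewrite /= in_itv/= ltrN10 ltr01.
have Hd s t : `]-1, 1[%classic s -> setT t -> derivable (f ^~ t) s 1.
  by move=> _ _; have [] := df s t.
have D s t : partial1of2 f s t = f' s t by rewrite partial1of2E; have [_ ->] := df s t.
have HG t : 0 <= (`|k| + 1) * (3 * C) * (e t * decay t).
  by rewrite !mulr_ge0 ?addr_ge0// ltW// decay_gt0.
have Hb s t : `]-1, 1[%classic s -> setT t ->
    `|partial1of2 f s t| <= (`|k| + 1) * (3 * C) * (e t * decay t).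
  rewrite /= in_itv/= => s1 _; rewrite D /f' normrM (ger0_norm (e0 t)) -[leRHS]mulrA.
  apply: (@le_trans _ _ ((`|k| + 1) * (C * decay (tstep j s t) * e t))); last first.
    by rewrite ler_wpM2l ?addr_ge0//; exact: dec3.
  rewrite mulrA ler_wpM2r// mulrDl mul1r (le_trans (ler_normD _ _))// lerD//.
    rewrite !normrM ler_pM// ?mulr_ge0// -[leRHS]mulr1 ler_wpM2l//.
  by rewrite normrM -[leRHS]mul1r ler_pM.
have := @differentiation_under_integral R _ TT (gaussian (h / 2) n) f setT measurableT 0 (-1) 1
  I0 Hi Hd _ HG (ib _) Hb.
rewrite (_ : (fun _ => _) = cst (\int[gaussian (h / 2) n]_t (cos (phase h th b xi t) * p t * e t))); last first.
  apply/funext => s; rewrite /f.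
  apply: (@Rintegral_lebesgue_shift _ n h _ (fun t => cos (phase h th b xi t) * p t)) => //.
  by apply: measurable_funM => //; exact: measurable_cos_comp.
rewrite derive1_cst.
have t0 t : tstep j 0 t = t.
  by apply: eq_from_tnth => i; rewrite tnth_mktuple if_same mul1r addr0.
have f'0 t : f' 0 t = k * (cos (phase h (th - pi / 2) b xi t) * (p t * e t)) +
    cos (phase h th b xi t) * (p' t * e t).
  by rewrite /f' t0 phaseB cos_subpihalf; ring.
under eq_Rintegral do rewrite D f'0.
have i1 : (gaussian (h / 2) n).-integrable setT
    (EFin \o (fun t => cos (phase h (th - pi / 2) b xi t) * (p t * e t))).
  have := integrable_ft_kernel h0 mp pC (th - pi / 2) b xi.
  by apply: eq_integrable => // t _; rewrite /ft_kernel /= mulrA.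
have i2 : (gaussian (h / 2) n).-integrable setT
    (EFin \o (fun t => cos (phase h th b xi t) * (p' t * e t))).
  have := integrable_ft_kernel h0 mp' p'C th b xi.
  by apply: eq_integrable => // t _; rewrite /ft_kernel /= mulrA.
rewrite RintegralD//; last first.
  rewrite (_ : EFin \o _ = fun t => (k%:E * (EFin \o (fun t => cos (phase h (th - pi / 2) b xi t) * (p t * e t))%R) t)%E)//.
  exact: integrableZl.
rewrite RintegralZl// => /esym/eqP; rewrite addr_eq0 => /eqP.
rewrite /wigner_integral => E.
under eq_Rintegral do rewrite -mulrA.
by under [in RHS]eq_Rintegral do rewrite -mulrA.
Qed.

End wigner_ibp.

Section wigner_decay.
Context {R : realType} {H : completeNormedModType R} (dot : H -> H -> R) (h : R).
Hypothesis hH : hilbert_axioms dot.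
Hypothesis h0 : 0 < h.
Variable u : seq H.
Hypothesis ou : orthonormal_seq dot u.
Local Notation RT := (measurableTypeR R).
Local Notation n := (size u).
Local Notation TT := (n.-tuple RT).
Local Notation sch := (schwartz_on dot u).
Local Notation W := (wigner_integral h).
Implicit Types (f g : H -> R) (c t xi : TT).

Definition addt (z : TT * TT) : TT := [tuple tnth z.1 i + tnth z.2 i | i < n].
Definition subt (z : TT * TT) : TT := [tuple tnth z.1 i - tnth z.2 i | i < n].

Lemma measurable_addt : measurable_fun setT addt.
Proof.
apply/measurable_fun_tnthP => i.
rewrite (_ : _ \o _ = fun z : TT * TT => (tnth z.1 i + tnth z.2 i : RT)); last first.
  by apply/funext => z /=; rewrite tnth_mktuple.
by apply: measurable_funD; [exact: (measurableT_comp (measurable_tnth i) measurable_fst)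
  |exact: (measurableT_comp (measurable_tnth i) measurable_snd)].
Qed.

Lemma measurable_subt : measurable_fun setT subt.
Proof.
apply/measurable_fun_tnthP => i.
rewrite (_ : _ \o _ = fun z : TT * TT => (tnth z.1 i - tnth z.2 i : RT)); last first.
  by apply/funext => z /=; rewrite tnth_mktuple.
by apply: measurable_funB; [exact: (measurableT_comp (measurable_tnth i) measurable_fst)
  |exact: (measurableT_comp (measurable_tnth i) measurable_snd)].
Qed.

(** The product f (z + t) g (z - t) of the Wigner function, in coordinates. *)
Definition wprod f g c t : R := f (lincomb (addt (c, t))) * g (lincomb (subt (c, t))).

Lemma wprodE f g c t : wprod f g c t = f (lincomb c + lincomb t) * g (lincomb c - lincomb t).
Proof.
rewrite /wprod lincombD; congr (f _ * g _).
rewrite /lincomb -sumrB; apply: eq_bigr => i _.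
by rewrite tnth_mktuple scalerBl.
Qed.

Lemma schwartz_measurable f : sch f -> measurable_fun setT (fun t : TT => f (lincomb t)).
Proof.
by move=> /schwartz_lipschitz[M hM]; exact: lipschitz_measurable hM.
Qed.

Lemma measurable_wprod f g : sch f -> sch g ->
  measurable_fun setT (fun z : TT * TT => wprod f g z.1 z.2).
Proof.
move=> sf sg; apply: measurable_funM.
  have := measurableT_comp (schwartz_measurable sf) measurable_addt.
  by apply: eq_measurable_fun => -[].
have := measurableT_comp (schwartz_measurable sg) measurable_subt.
by apply: eq_measurable_fun => -[].
Qed.

Lemma measurable_wprod2 f g c : sch f -> sch g -> measurable_fun setT (wprod f g c).
Proof. by move=> sf sg; exact: (measurableT_comp (measurable_wprod sf sg) (measurable_pair1 c)). Qed.

Lemma dot_lincomb_norm t : dot (lincomb (u := u) t) (lincomb t) = tnorm2 t.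
Proof. by rewrite (dot_lincomb2 hH ou); apply: eq_bigr => i _; rewrite expr2. Qed.

Lemma tnorm2_ge0 m (t : m.-tuple RT) : 0 <= tnorm2 t.
Proof. by apply: sumr_ge0 => i _; exact: sqr_ge0. Qed.

Lemma prod_le_tnorm2 m (t : m.-tuple RT) (A : R) : tnorm2 t <= A ->
  (1 + A) ^- m <= decay t.
Proof.
move=> tA; rewrite /decay prodfV lef_pV2 ?posrE; last 2 first.
- by rewrite exprn_gt0// ltr_pwDl// (le_trans (tnorm2_ge0 t)).
- by apply: prodr_gt0 => i _; rewrite ltr_pwDl ?sqr_ge0.
rewrite -[X in _ ^+ X](card_ord m) -prodr_const; apply: ler_prod => i _.
rewrite addr_ge0 ?sqr_ge0//= lerD2l (le_trans _ tA)//.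
by rewrite /tnorm2 (bigD1 i)//= lerDl sumr_ge0// => j _; exact: sqr_ge0.
Qed.

(** As |c + t|^2 + |c - t|^2 = 2 (|c|^2 + |t|^2), the decay of [f] and [g]
    controls both variables at once. *)
Lemma wprod_bound f g : sch f -> sch g -> exists C, 0 <= C /\
  forall c t, `|wprod f g c t| <= C * decay c * decay t.
Proof.
move=> sf sg.
have [Mf hf] := schwartz_bound (n + n) sf.
have [Mg hg] := schwartz_bound (n + n) sg.
have sp x : fspan u x -> 0 < (1 + dot x x) ^+ (n + n).
  by move=> _; rewrite exprn_gt0// ltr_pwDl ?(dot_ge0 hH).
have Mf0 : 0 <= Mf.
  by apply: le_trans (hf 0 (fspan0 u)); rewrite mulr_ge0// ltW// sp//; exact: fspan0.
have Mg0 : 0 <= Mg.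
  by apply: le_trans (hg 0 (fspan0 u)); rewrite mulr_ge0// ltW// sp//; exact: fspan0.
exists (Mf * Mg); split=> [|c t]; first exact: mulr_ge0.
rewrite /wprod; set x := lincomb (addt (c, t)); set y := lincomb (subt (c, t)).
have xs : fspan u x by exact: lincomb_span.
have ys : fspan u y by exact: lincomb_span.
have bf : `|f x| <= Mf * (1 + dot x x) ^- (n + n) by rewrite ler_pdivlMr ?sp// mulrC hf.
have bg : `|g y| <= Mg * (1 + dot y y) ^- (n + n) by rewrite ler_pdivlMr ?sp// mulrC hg.
rewrite normrM (le_trans (ler_pM (normr_ge0 _) (normr_ge0 _) bf bg))//.
rewrite mulrACA -[leRHS]mulrA ler_wpM2l ?mulr_ge0// -invfM -exprMn.
pose A := tnorm2 c + tnorm2 t.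
have A0 : 0 <= A by rewrite addr_ge0 ?tnorm2_ge0.
apply: (@le_trans _ _ ((1 + A) ^- n * (1 + A) ^- n)); last first.
  have pA : 0 <= (1 + A) ^- n by rewrite invr_ge0 exprn_ge0// (addr_ge0 ler01 A0).
  apply: ler_pM => //.
    by apply: prod_le_tnorm2; rewrite lerDl tnorm2_ge0.
  by apply: prod_le_tnorm2; rewrite lerDr tnorm2_ge0.
have p1 : 0 < 1 + A by rewrite ltr_pwDl.
have p2 : 0 < (1 + dot x x) * (1 + dot y y) by rewrite mulr_gt0// ltr_pwDl ?(dot_ge0 hH).
rewrite -invfM -exprD lef_pV2 ?posrE ?exprn_gt0//.
apply: lerXn2r; rewrite ?nnegrE ?(ltW p1) ?(ltW p2)//.
have xy : dot x x + dot y y = 2 * A.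
  rewrite !dot_lincomb_norm /A /tnorm2 -!big_split/= mulr_sumr; apply: eq_bigr => i _.
  rewrite !tnth_mktuple; ring.
move: (dot x x) (dot y y) (dot_ge0 hH x) (dot_ge0 hH y) xy => a b a0 b0 ab.
have := mulr_ge0 a0 b0; rewrite mulrDl mul1r mulrDr mulr1; move: (a * b) => ab' ab0.
by clearbody A; lra.
Qed.

Lemma wprod_derive f g c t (j : 'I_n) s : sch f -> sch g ->
  is_derive s (1 : R) (fun s => wprod f g c (tstep j s t))
   (wprod ('D_(u`_j) f) g c (tstep j s t) - wprod f ('D_(u`_j) g) c (tstep j s t)).
Proof.
move=> sf sg.
have uj : fspan u u`_j by exact: fspan_nth.
have e1 r : lincomb c + lincomb (tstep j r t) = lincomb c + lincomb t + r *: u`_j.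
  by rewrite -[tstep j r t]/(tset j r t) lincomb_tset addrA.
have e2 r : lincomb c - lincomb (tstep j r t) = lincomb c - lincomb t + (- r) *: u`_j.
  by rewrite -[tstep j r t]/(tset j r t) lincomb_tset opprD addrA scaleNr.
rewrite !wprodE !e1 !e2.
have -> : (fun s => wprod f g c (tstep j s t)) =
    (fun s => f (lincomb c + lincomb t + s *: u`_j)) \*
    (fun s => g (lincomb c - lincomb t + (- s) *: u`_j)).
  by apply/funext => r /=; rewrite wprodE e1 e2.
have d1 : is_derive s (1 : R) (fun s => f (lincomb c + lincomb t + s *: u`_j))
    ('D_(u`_j) f (lincomb c + lincomb t + s *: u`_j)).
  apply: derivable_line; apply: (schwartz_derivable sf) => //.
  by apply: fspanD; [apply: fspanD; exact: lincomb_span|exact: fspanZ].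
have d2 : is_derive s (1 : R) (fun s => g (lincomb c - lincomb t + (- s) *: u`_j))
    (- 'D_(u`_j) g (lincomb c - lincomb t + (- s) *: u`_j)).
  have d3 : is_derive (- s) (1 : R) (fun s => g (lincomb c - lincomb t + s *: u`_j))
      ('D_(u`_j) g (lincomb c - lincomb t + (- s) *: u`_j)).
    apply: derivable_line; apply: (schwartz_derivable sg) => //.
    by apply: fspanD; [apply: fspanB; exact: lincomb_span|exact: fspanZ].
  have d4 : is_derive s (1 : R) (fun s => - s) (-1) by apply: is_derive_eq.
  by have := is_derive1_comp d3 d4; rewrite mulrN1.
by apply: is_derive_eq; rewrite /GRing.scale/=; ring.
Qed.

Let I0 : R := \int[gaussian (h / 2) n]_t (expR (tnorm2 t / h) * decay t).

Let I0_ge0 : 0 <= I0.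
Proof. by apply: Rintegral_ge0 => t _; rewrite mulr_ge0 ?expR_ge0// ltW// decay_gt0. Qed.

Lemma wigner_integral_le (p : TT -> R) C th b xi : 0 <= C -> measurable_fun setT p ->
  (forall t, `|p t| <= C * decay t) -> `|W th b p xi| <= C * I0.
Proof.
move=> C0 mp pC; rewrite /wigner_integral.
have ik := integrable_ft_kernel h0 mp pC th b xi.
apply: (le_trans (le_normr_Rintegral measurableT ik)).
rewrite /I0 -RintegralZl//; last exact: integrable_decay.
apply: le_Rintegral => //.
- exact: integrable_norm ik.
- exact: integrable_Cdecay.
- by move=> t _; exact: (ft_kernel_le h pC th b (xi, t)).
Qed.

(** Induction on the power of the frequency, each integration by parts
    replacing the pair (f, g) by a derivative of one of them. *)
Lemma wigner_decay1 (j : 'I_n) k : forall f g, sch f -> sch g -> exists C, 0 <= C /\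
  forall c xi th b, `|tnth xi j| ^+ k * `|W th b (wprod f g c) xi| <= C * decay c.
Proof.
elim: k => [|k IH] f g sf sg.
  have [C [C0 hC]] := wprod_bound sf sg.
  exists (C * I0); split=> [|c xi th b]; first exact: mulr_ge0.
  rewrite expr0 mul1r mulrAC; apply: wigner_integral_le; last exact: hC.
    by rewrite mulr_ge0// ltW// decay_gt0.
  exact: measurable_wprod2.
have uj : fspan u u`_j by exact: fspan_nth.
have sf' := schwartz_derive sf uj; have sg' := schwartz_derive sg uj.
have [C1 [C10 hC1]] := IH _ _ sf' sg; have [C2 [C20 hC2]] := IH _ _ sf sg'.
have [D1 [D10 hD1]] := wprod_bound sf' sg; have [D2 [D20 hD2]] := wprod_bound sf sg'.
have [D3 [D30 hD3]] := wprod_bound sf sg.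
have h20 : 0 <= h / 2 by rewrite divr_ge0// ltW.
exists (h / 2 * (C1 + C2)); split=> [|c xi th b]; first by rewrite mulr_ge0// addr_ge0.
have dc0 : 0 <= decay c by rewrite ltW// decay_gt0.
pose p1 := wprod ('D_(u`_j) f) g c; pose p2 := wprod f ('D_(u`_j) g) c.
have mp1 : measurable_fun setT p1 by exact: measurable_wprod2.
have mp2 : measurable_fun setT p2 by exact: measurable_wprod2.
have p1b t : `|p1 t| <= D1 * decay c * decay t by exact: hD1.
have p2b t : `|p2 t| <= D2 * decay c * decay t by exact: hD2.
have E := @wigner_integral_by_parts R h n h0 (wprod f g c) (fun t => p1 t - p2 t)
  ((D1 + D2 + D3) * decay c) j (th + pi / 2) b xi.
rewrite addrK in E.
have {}E : 2 / h * tnth xi j * W th b (wprod f g c) xi =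
    - (W (th + pi / 2) b p1 xi - W (th + pi / 2) b p2 xi).
  have dt0 t : 0 <= decay c * decay t by rewrite mulr_ge0// ltW// decay_gt0.
  have e1 : 0 <= (D1 + D2 + D3) * decay c by rewrite mulr_ge0// !addr_ge0.
  have e2 : measurable_fun setT (wprod f g c) by exact: measurable_wprod2.
  have e3 : measurable_fun setT (fun t => p1 t - p2 t) by exact: measurable_funB.
  have e4 t : `|wprod f g c t| <= (D1 + D2 + D3) * decay c * decay t.
    apply: le_trans (hD3 c t) _; rewrite -!mulrA ler_wpM2r//.
    by rewrite lerDr addr_ge0.
  have e5 t : `|p1 t - p2 t| <= (D1 + D2 + D3) * decay c * decay t.
    apply: le_trans (ler_normB _ _) _; apply: le_trans (lerD (p1b t) (p2b t)) _.
    by rewrite -!mulrA -mulrDl ler_wpM2r// lerDl.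
  rewrite (E e1 e2 e3 e4 e5 (fun t s => wprod_derive c t j s sf sg)).
  congr (- _); rewrite /wigner_integral -RintegralB//.
  - by apply: eq_Rintegral => t _; ring.
  - exact: (integrable_ft_kernel h0 mp1 p1b).
  - exact: (integrable_ft_kernel h0 mp2 p2b).
have {}E : tnth xi j * W th b (wprod f g c) xi =
    h / 2 * - (W (th + pi / 2) b p1 xi - W (th + pi / 2) b p2 xi).
  by rewrite -E; field; exact: lt0r_neq0.
rewrite exprSr -mulrA -normrM E normrM normrN (ger0_norm h20) mulrCA -[leRHS]mulrA.
rewrite ler_wpM2l// [leRHS]mulrDl.
apply: (@le_trans _ _ (`|tnth xi j| ^+ k *
  (`|W (th + pi / 2) b p1 xi| + `|W (th + pi / 2) b p2 xi|))).
  by rewrite ler_wpM2l ?exprn_ge0//; exact: ler_normB.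
by rewrite [leLHS]mulrDr lerD//; [exact: hC1|exact: hC2].
Qed.

(** All factors 1 + xi_i^2 are bounded in terms of the largest coordinate
    xi_j, so one power 2 n of a single frequency is enough. *)
Lemma wigner_decay f g : sch f -> sch g -> exists C, 0 <= C /\
  forall c xi th b, `|W th b (wprod f g c) xi| <= C * decay c * decay xi.
Proof.
move=> sf sg.
have [C0 [C00 hC0]] := wprod_bound sf sg.
have ex (j : 'I_n) : exists C, 0 <= C /\ forall c xi th b,
   `|tnth xi j| ^+ (n + n) * `|W th b (wprod f g c) xi| <= C * decay c.
  exact: wigner_decay1.
have [C hC] := choice ex.
have S0 : 0 <= \sum_(j < n) C j by apply: sumr_ge0 => j _; have [] := hC j.
exists (2 ^+ n * (C0 * I0 + \sum_(j < n) C j)); split=> [|c xi th b].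
  by rewrite mulr_ge0 ?exprn_ge0// addr_ge0// mulr_ge0.
have dc : 0 < decay c by exact: decay_gt0.
rewrite -ler_pdivrMr ?decay_gt0// /decay -prodfV.
under eq_bigr do rewrite invrK.
set w := `|W th b (wprod f g c) xi|.
have w0 : w <= C0 * I0 * decay c.
  rewrite mulrAC; apply: wigner_integral_le.
  - by rewrite mulr_ge0// ltW.
  - exact: measurable_wprod2.
  - exact: hC0.
rewrite -/(decay c).
have [n0|n0] := posnP n.
  rewrite big1; last by move=> i; have := ltn_ord i; rewrite {2}n0.
  rewrite mulr1; apply: (le_trans w0); rewrite ler_wpM2r ?(ltW dc)//.
  rewrite -[leLHS]mul1r; apply: ler_pM; rewrite ?mulr_ge0 ?lerDl//.
  by rewrite exprn_ege1// ler1n.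
pose j := [arg max_(j > Ordinal n0) `|tnth xi j|]%O.
have jmax i : `|tnth xi i| <= `|tnth xi j|.
  by rewrite /j; case: arg_maxP => // k _; exact.
have pr : \prod_(i < n) (1 + tnth xi i ^+ 2) <= (1 + `|tnth xi j| ^+ 2) ^+ n.
  rewrite -[X in _ ^+ X](card_ord n) -prodr_const; apply: ler_prod => i _.
  rewrite addr_ge0 ?sqr_ge0//= lerD2l -[leLHS]real_normK ?num_real//.
  by rewrite ler_pXn2r ?nnegrE.
have pr2 : (1 + `|tnth xi j| ^+ 2) ^+ n <= 2 ^+ n * (1 + `|tnth xi j| ^+ (n + n)).
  have [a1|a1] := leP `|tnth xi j| 1.
    apply: (@le_trans _ _ (2 ^+ n * 1)); last by rewrite ler_wpM2l ?exprn_ge0// lerDl exprn_ge0.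
    rewrite mulr1 ler_pXn2r ?nnegrE ?addr_ge0 ?sqr_ge0//.
    by rewrite (_ : 2 = 1 + 1)// lerD2l; exact: (exprn_ile1 2 (normr_ge0 _) a1).
  apply: (@le_trans _ _ (2 ^+ n * `|tnth xi j| ^+ (n + n))); last by rewrite ler_wpM2l ?exprn_ge0// lerDr.
  rewrite addnn -mul2n exprM -exprMn ler_pXn2r ?nnegrE ?addr_ge0 ?mulr_ge0 ?sqr_ge0//.
  by have := exprn_ege1 2 (ltW a1); lra.
have w00 : 0 <= w by exact: normr_ge0.
rewrite (le_trans (ler_wpM2l w00 (le_trans pr pr2)))// mulrCA -mulrA ler_wpM2l ?exprn_ge0//.
rewrite mulrDr mulr1 mulrDl lerD// mulrC.
apply: (le_trans ((hC j).2 c xi th b)); rewrite ler_wpM2r ?(ltW dc)//.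
by rewrite (bigD1 j)//= lerDl sumr_ge0// => i _; have [] := hC i.
Qed.

End wigner_decay.

(** * The phase space integral of the Wigner density *)

Section product_integral.
Context d1 d2 (T1 : measurableType d1) (T2 : measurableType d2) (R : realType).
Variables (m1 : probability T1 R) (m2 : probability T2 R) (f : T1 -> R) (g : T2 -> R).
Hypotheses (fi : m1.-integrable setT (EFin \o f)) (gi : m2.-integrable setT (EFin \o g)).

Lemma integrable_prod_mul : (m1 \x m2)%E.-integrable setT (EFin \o (fun z => f z.1 * g z.2)).
Proof.
have mf : measurable_fun setT f by apply/measurable_EFinP; exact: measurable_int fi.
have mg : measurable_fun setT g by apply/measurable_EFinP; exact: measurable_int gi.
apply: integrable_prodP.
  by apply: measurable_funM; [exact: (measurableT_comp mf measurable_fst)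
    |exact: (measurableT_comp mg measurable_snd)].
under eq_integral => x _.
  under eq_integral do rewrite /= normrM EFinM.
  rewrite ge0_integralZl//; last by apply/measurable_EFinP; exact: measurableT_comp.
  over.
have gf : (\int[m2]_x (`|g x|)%:E \is a fin_num)%E.
  have := integrable_fin_num measurableT (integrable_norm gi); exact.
rewrite /= ge0_integralZr//.
- have ff : (\int[m1]_x (`|f x|)%:E \is a fin_num)%E.
    have := integrable_fin_num measurableT (integrable_norm fi); exact.
  by rewrite -(fineK ff) -(fineK gf) -EFinM ltry.
- by apply/measurable_EFinP; exact: measurableT_comp.
- by apply: integral_ge0.
Qed.

Lemma Rintegral_prod_mul :
  \int[(m1 \x m2)%E]_z (f z.1 * g z.2) = \int[m1]_x f x * \int[m2]_y g y.
Proof.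
rewrite (Rintegral_fubini integrable_prod_mul)/=.
under eq_Rintegral do rewrite RintegralZl//.
by rewrite RintegralZr.
Qed.

End product_integral.

Section wigner_phase_space.
Context {R : realType} {H : completeNormedModType R} (dot : H -> H -> R) (h : R).
Hypothesis hH : hilbert_axioms dot.
Hypothesis h0 : 0 < h.
Variable u : seq H.
Hypothesis ou : orthonormal_seq dot u.
Local Notation RT := (measurableTypeR R).
Local Notation n := (size u).
Local Notation TT := (n.-tuple RT).
Local Notation sch := (schwartz_on dot u).
Local Notation W := (wigner_integral h).
Variables (f g : H -> R).
Hypotheses (sf : sch f) (sg : sch g).
Local Notation gam := (gaussian (h / 2) n).

(** The integrand, with respect to the product of two Gaussians, of the
    pairing of a wave with the Wigner function; both weights exp (|.|^2 / h)
    are kept, so that it is a Lebesgue integral in disguise. *)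
Definition wigner_density th (a b : 'I_n -> R) (z : TT * TT) : R :=
  W (th + tdot a z.1) b (wprod f g z.1) z.2 * (expR (tnorm2 z.1 / h) * expR (tnorm2 z.2 / h)).

Lemma measurable_expn : measurable_fun setT (fun t : TT => expR (tnorm2 t / h)).
Proof. exact: measurable_expn2. Qed.

Lemma decay_le1 m (t : m.-tuple RT) : decay t <= 1.
Proof.
apply: prodr_ile1 => i _; rewrite invr_ge0 addr_ge0 ?sqr_ge0//=.
by rewrite invf_le1 ?lerDl ?sqr_ge0// ltr_pwDl ?sqr_ge0.
Qed.

Lemma measurable_wigner_density th a b : measurable_fun setT (wigner_density th a b).
Proof.
apply: measurable_funM; last first.
  by apply: measurable_funM; [exact: (measurableT_comp measurable_expn measurable_fst)
    |exact: (measurableT_comp measurable_expn measurable_snd)].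
have [C [C0 hC]] := wprod_bound hH ou sf sg.
pose K (y : (TT * TT) * TT) := cos (phase h (th + tdot a y.1.1) b y.1.2 y.2) *
  wprod f g y.1.1 y.2 * expR (tnorm2 y.2 / h).
have m11 : measurable_fun setT (fun y : (TT * TT) * TT => y.1.1).
  exact: (measurableT_comp measurable_fst measurable_fst).
have m12 : measurable_fun setT (fun y : (TT * TT) * TT => y.1.2).
  exact: (measurableT_comp measurable_snd measurable_fst).
have mK : measurable_fun setT K.
  apply: measurable_funM; last exact: (measurableT_comp measurable_expn measurable_snd).
  apply: measurable_funM.
    apply: measurable_cos_comp.
    rewrite (_ : (fun _ => _) = (fun y : (TT * TT) * TT => phase h th b y.1.2 y.2 + tdot a y.1.1)).
      apply: measurable_funD; last exact: (measurableT_comp (measurable_tdot a) m11).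
      have m := measurable_fun_pair m12 (@measurable_snd _ _ (TT * TT)%type TT).
      exact: (measurableT_comp (measurable_phase h th b) m).
    by apply/funext => y; rewrite /phase addrAC.
  have m := measurable_fun_pair m11 (@measurable_snd _ _ (TT * TT)%type TT).
  exact: (measurableT_comp (measurable_wprod sf sg) m).
have iK : (product_probability gam gam \x gam)%E.-integrable setT (EFin \o K).
  have i1 : (product_probability gam gam).-integrable setT (EFin \o (cst 1)).
    exact: finite_measure_integrable_cst.
  have := integrable_prod_mul i1 (integrable_Cdecay n h0 C).
  move=> ii; apply: (intble_le _ ii) => // y; rewrite /cst mul1r /K normrM (ger0_norm (expR_ge0 _)).
  rewrite [leRHS]mulrCA [leLHS]mulrC ler_wpM2l ?expR_ge0//.
  apply: (@le_trans _ _ (1 * (C * decay y.1.1 * decay y.2))).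
    rewrite normrM; apply: (ler_pM (normr_ge0 _) (normr_ge0 _) _ (hC _ _)).
    by rewrite ler_norml cos_geN1 cos_le1.
  rewrite mul1r -mulrA ler_wpM2l// ler_piMl ?decay_le1// ltW// decay_gt0//.
have := measurable_fubini_F iK.
by move=> mF; apply: (measurableT_comp _ mF).
Qed.

Lemma integrable_wigner_density th a b :
  (gam \x gam)%E.-integrable setT (EFin \o wigner_density th a b).
Proof.
have [C [C0 hC]] := wigner_decay hH h0 ou sf sg.
have id := integrable_decay n h0.
have := integrable_prod_mul (integrable_Cdecay n h0 C) id.
move=> ii; apply: (intble_le _ ii); first exact: measurable_wigner_density.
move=> z; rewrite /wigner_density normrM [X in _ * X]ger0_norm ?mulr_ge0 ?expR_ge0//.
have -> : C * (expR (tnorm2 z.1 / h) * decay z.1) * (expR (tnorm2 z.2 / h) * decay z.2) =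
  C * decay z.1 * decay z.2 * (expR (tnorm2 z.1 / h) * expR (tnorm2 z.2 / h)) by ring.
by rewrite ler_wpM2r ?mulr_ge0 ?expR_ge0.
Qed.

Lemma lipschitz_cvg m (F : m.-tuple RT -> R) M (t_ : nat -> m.-tuple RT) t :
  (forall t t', `|F t - F t'| <= M * \sum_(i < m) `|tnth t i - tnth t' i|) ->
  (forall i, tnth (t_ k) i @[k --> \oo] --> tnth t i) ->
  F (t_ k) @[k --> \oo] --> F t.
Proof.
move=> FM tt.
have S : \sum_(i < m) `|tnth (t_ k) i - tnth t i| @[k --> \oo] --> (0 : R).
  elim: (index_enum _) => [|i r IH].
    by under eq_fun do rewrite big_nil; exact: cvg_cst.
  under eq_fun do rewrite big_cons.
  have h1 : `|tnth (t_ k) i - tnth t i| @[k --> \oo] --> (0 : R).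
    by have := cvg_norm (cvgB (tt i) (cvg_cst (tnth t i))); rewrite subrr normr0; apply.
  by have := cvgD h1 IH; rewrite addr0; apply.
have Z : M * \sum_(i < m) `|tnth (t_ k) i - tnth t i| @[k --> \oo] --> (0 : R).
  by have := cvgM (cvg_cst M) S; rewrite mulr0; apply.
apply/cvgrPdist_le => e e0.
near=> k.
have : `|0 - M * \sum_(i < m) `|tnth (t_ k) i - tnth t i| | <= e.
  by near: k; move/cvgrPdist_le : Z; exact.
rewrite sub0r normrN => h1; rewrite distrC.
by apply: le_trans (FM _ _) _; apply: le_trans h1; exact: ler_norm.
Unshelve. all: by end_near. Qed.

Lemma wprod_cvg c (t_ : nat -> TT) t :
  (forall i, tnth (t_ k) i @[k --> \oo] --> tnth t i) ->
  wprod f g c (t_ k) @[k --> \oo] --> wprod f g c t.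
Proof.
move=> tt; have [Mf hf] := schwartz_lipschitz sf; have [Mg hg] := schwartz_lipschitz sg.
apply: cvgM.
  apply: (lipschitz_cvg (F := fun t : TT => f (lincomb t)) (t_ := fun k => addt (c, t_ k)) hf) => i.
  under eq_fun do rewrite tnth_mktuple.
  rewrite tnth_mktuple; by have := cvgD (cvg_cst (tnth c i)) (tt i); apply.
apply: (lipschitz_cvg (F := fun t : TT => g (lincomb t)) (t_ := fun k => subt (c, t_ k)) hg) => i.
under eq_fun do rewrite tnth_mktuple.
by rewrite tnth_mktuple; have := cvgB (cvg_cst (tnth c i)) (tt i); apply.
Qed.

(** The inversion formula in the frequency variable, integrated in the
    position: integrating out the frequency [xi] against the wave [b]
    evaluates the product at t = h / 2 * b. *)
Theorem wigner_phase_space_integral th (a b : 'I_n -> R) :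
  \int[(gam \x gam)%E]_z wigner_density th a b z =
  \int[gam]_c (cos (th + tdot a c) * wprod f g c [tuple h / 2 * b i | i < n] *
    expR (tnorm2 c / h)).
Proof.
rewrite (Rintegral_fubini (integrable_wigner_density th a b)).
have [C [C0 hC]] := wigner_decay hH h0 ou sf sg.
have [D [D0 hD]] := wprod_bound hH ou sf sg.
apply: eq_Rintegral => c _; rewrite /wigner_density /=.
have mp : measurable_fun setT (wprod f g c) := measurable_wprod2 c sf sg.
have pC t : `|wprod f g c t| <= D * decay c * decay t by exact: hD.
have iW : gam.-integrable setT (EFin \o (fun xi =>
    W (th + tdot a c) b (wprod f g c) xi * expR (tnorm2 xi / h))).
  have := integrable_Cdecay n h0 (C * decay c).
  move=> ii; apply: (intble_le _ ii).
    apply: measurable_funM; last exact: measurable_expn.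
    exact: (measurable_wigner_integral h0 mp pC).
  move=> xi; rewrite normrM (ger0_norm (expR_ge0 _)) [leRHS]mulrCA [leLHS]mulrC ler_wpM2l ?expR_ge0//.
under eq_Rintegral do rewrite mulrCA mulrC.
rewrite RintegralZr// (wigner_inversion h0 mp pC)//.
move=> r t r0; apply: wprod_cvg => i.
under eq_fun do rewrite tnth_mktuple.
rewrite tnth_mktuple.
have := cvgD (cvgM r0 (cvg_cst (tnth t i))) (cvg_cst (h / 2 * b i)).
by rewrite mul0r add0r; apply.
Qed.

End wigner_phase_space.

(** * Waves in an arbitrary direction of the dual *)

Lemma cos_norm_le1 (R : realType) (x : R) : `|cos x| <= 1.
Proof. by rewrite ler_norml cos_geN1 cos_le1. Qed.

Lemma integrableZl_fin d (T : measurableType d) (R : realType) (m : {measure set T -> \bar R})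
  (k : R) (f : T -> R) : m.-integrable setT (EFin \o f) ->
  m.-integrable setT (EFin \o (fun x => k * f x)).
Proof.
move=> fi; rewrite (_ : EFin \o _ = fun x => (k%:E * (EFin \o f) x)%E); last by [].
exact: integrableZl.
Qed.

Lemma Rintegral_pullback d1 d2 (T1 : measurableType d1) (T2 : measurableType d2) (R : realType)
  (m1 : {measure set T1 -> \bar R}) (m2 : {measure set T2 -> \bar R}) (p : T2 -> T1) (f : T1 -> R) :
  measurable_fun setT p ->
  (forall F : T1 -> \bar R, measurable_fun setT F -> (forall x, 0 <= F x)%E ->
    (\int[m1]_x F x = \int[m2]_t F (p t))%E) ->
  m1.-integrable setT (EFin \o f) ->
  m2.-integrable setT (EFin \o (fun t => f (p t))) /\ \int[m2]_t f (p t) = \int[m1]_x f x.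
Proof.
move=> mp E fi.
have mf : measurable_fun setT f by apply/measurable_EFinP; exact: measurable_int fi.
have E1 (F : T1 -> \bar R) : measurable_fun setT F -> (forall x, 0 <= F x)%E ->
    (\int[m1]_x F x = \int[m2]_t (F (p t) * (cst 1 t)%:E))%E.
  by move=> mF F0; rewrite E//; apply: eq_integral => t _; rewrite mule1.
have h1 : forall t : T2, 0 <= cst (1 : R) t by move=> t; exact: ler01.
split.
  have [i _] := integrable_transfer mp (measurable_cst _) h1 E1 mf.
  have := i fi; congr (_.-integrable _ _).
  by apply/funext => t; rewrite /= mulr1.
rewrite (Rintegral_transfer h1 E1 mf).
by apply: eq_Rintegral => t _; rewrite mulr1.
Qed.

Section phase_product.
Context d1 d2 (T1 : measurableType d1) (T2 : measurableType d2) (R : realType).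
Variables (m1 : probability T1 R) (m2 : probability T2 R).

(** If [A] is independent of the rest and has a symmetric law, only the cosine
    part of cos (A + .) survives, with a constant factor [E]. *)
Lemma phase_product (A : T1 -> R) (q q' : T2 -> R) (E : R) : measurable_fun setT A ->
  (forall th, \int[m1]_z cos (th + A z) = cos th * E) ->
  m2.-integrable setT (EFin \o q) -> m2.-integrable setT (EFin \o q') ->
  (m1 \x m2)%E.-integrable setT
    (EFin \o (fun p => cos (A p.1) * q p.2 - cos (- (pi / 2) + A p.1) * q' p.2)) /\
  \int[(m1 \x m2)%E]_p (cos (A p.1) * q p.2 - cos (- (pi / 2) + A p.1) * q' p.2) =
    E * \int[m2]_x q x.
Proof.
move=> mA EA iq iq'.
have ic th : m1.-integrable setT (EFin \o (fun z => cos (th + A z))).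
  by apply: (intble_bounded _ _ (fun z => cos_norm_le1 _)); apply: measurable_cos_comp; exact: measurable_funD.
have ic0 : m1.-integrable setT (EFin \o (fun z => cos (A z))).
  by have := ic 0; congr (_.-integrable _ _); apply/funext => z; rewrite /= add0r.
have i1 := integrable_prod_mul ic0 iq; have i2 := integrable_prod_mul (ic (- (pi / 2))) iq'.
split; first by have := integrableB measurableT i1 i2; exact.
rewrite (RintegralB _ i1 i2)// (Rintegral_prod_mul ic0 iq) (Rintegral_prod_mul (ic (- (pi / 2))) iq').
rewrite (EA (- (pi / 2))) cosN cos_pihalf !mul0r subr0; congr (_ * _).
by under eq_Rintegral do rewrite -[A _]add0r; rewrite EA cos0 mul1r.
Qed.

End phase_product.

Section master.
Context {R : realType} {H B : completeNormedModType R}.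
Variables (dot : H -> H -> R) (inc : H -> B) (mu : R -> probability (borelType B) R).
Hypothesis hW : abstract_wiener dot inc mu.
Local Notation BT := (borelType B).
Local Notation RT := (measurableTypeR R).
Local Notation L := (dual_fun dot inc).
Let hH : hilbert_axioms dot := aw_hilbert hW.
Variables (h : R) (e : H) (u : seq H).
Hypotheses (h0 : 0 < h) (eB : in_dual dot inc e) (ee : dot e e = 1).
Hypotheses (ou : orthonormal_seq dot u) (ud : {in u, forall a, in_dual dot inc a}).
Local Notation n := (size u).
Local Notation TT := (n.-tuple RT).
Local Notation X := (coords dot inc u).
Local Notation nrm := (normal_prob 0 (Num.sqrt (h / 2))).
Local Notation gam := (gaussian (h / 2) n).

Let h20 : 0 < h / 2. Proof. by rewrite divr_gt0. Qed.

(** If [e] is not in the span of [u], its normalised residual is taken;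
    otherwise any unit vector of the dual orthogonal to [u] will do, and the
    component of [e] along it is zero. *)
Lemma orthogonal_direction : exists e', [/\ in_dual dot inc e', orthonormal_seq dot (e' :: u) &
  fspan (e' :: u) e].
Proof.
have [y yB uy] : exists2 y, in_dual dot inc y & ~ fspan u y /\ (fspan u e \/ y = e).
  have [ue|ue] := pselect (fspan u e); last by exists e => //; split=> //; right.
  by have [y Sy uy] := not_span hH (aw_dual_dense hW) ou; exists y => //; split=> //; left.
case: uy => uy ue.
set e' := `|y - proj dot u y|^-1 *: (y - proj dot u y).
have or := orthonormal_rcons hH ou uy; rewrite -/e' in or.
have e'B : in_dual dot inc e'.
  rewrite /e' -[_ *: _]addr0; apply: (in_dual_lin hW); last exact: (in_dual0 hW).
  rewrite addrC -scaleN1r; apply: (in_dual_lin hW) => //.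
  by apply: proj_sub => //; [exact: (in_dual0 hW)|exact: (in_dual_lin hW)].
have ntu : nth 0 (rcons u e') n = e' by rewrite nth_rcons ltnn eqxx.
have nt i : (i < n)%N -> nth 0 (rcons u e') i = u`_i by move=> iu; rewrite nth_rcons iu.
have oe' : orthonormal_seq dot (e' :: u).
  move=> [|i] [|j] //= iu ju.
  - by have := or n n; rewrite size_rcons ltnSn => /(_ isT isT); rewrite ntu eqxx.
  - have := or n j; rewrite size_rcons => /(_ (ltnSn _) (leqW ju)).
    by rewrite ntu nt// gtn_eqF.
  - have := or i n; rewrite size_rcons => /(_ (leqW iu) (ltnSn _)).
    by rewrite ntu nt// ltn_eqF.
  - exact: ou.
exists e'; split=> //.
have sub v : v \in rcons u e' -> fspan (e' :: u) v.
  by rewrite mem_rcons => ve; exact: fspan_mem.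
case: ue => [|<-]; last by apply: (fspan_sub sub); exact: fspan_rcons_residual.
apply: fspan_sub => v vu; apply: fspan_mem; rewrite inE vu orbT//.
Qed.

Section direction.
Variable e' : H.
Hypotheses (e'B : in_dual dot inc e') (oe' : orthonormal_seq dot (e' :: u)).
Hypothesis ue : fspan (e' :: u) e.

Let vd : {in e' :: u, forall a, in_dual dot inc a}.
Proof. by move=> v; rewrite inE => /orP[/eqP ->//|]; exact: ud. Qed.

Definition dirr : R := dot e e'.
Definition dirc (i : 'I_n) : R := dot e u`_i.

Lemma dir_norm : dirr ^+ 2 + \sum_(i < n) dirc i ^+ 2 = 1.
Proof.
have := ee; rewrite -{2}(projK hH oe' ue) /proj (dot_sumr hH) big_ord_recl /= => <-.
rewrite (dotZr hH) (dotC hH e' e) -expr2; congr (_ + _).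
by apply: eq_bigr => i _; rewrite (dotZr hH) /= (dotC hH _ e) expr2.
Qed.

(** This expresses [L e] through two independent groups of coordinates under
    the Wiener measure. *)
Lemma dual_fun_dir y : L e y = dirr * L e' y + tdot dirc (X y).
Proof.
rewrite (dual_fun_span hW y oe' vd ue) /lincomb (dot_sumr hH) big_ord_recl.
rewrite (dotZr hH) tnth_mktuple mulrC; congr (_ + _).
by apply: eq_bigr => i _; rewrite (dotZr hH) !tnth_mktuple mulrC.
Qed.

Lemma ge0_integral_dir (F : RT * TT -> \bar R) : measurable_fun setT F ->
  (forall p, 0 <= F p)%E ->
  (\int[mu (h / 2)]_y F (L e' y, X y) = \int[nrm]_z \int[gam]_x F (z, x))%E.
Proof.
move=> mF F0.
pose G (t : (size (e' :: u)).-tuple RT) := F (thead t, [tuple of behead t]).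
have mG : measurable_fun setT G.
  apply: (measurableT_comp mF); apply: measurable_fun_pair; first exact: measurable_tnth.
  exact: measurable_behead.
have -> : (\int[nrm]_z \int[gam]_x F (z, x) = \int[gaussian (h / 2) (size (e' :: u))]_t G t)%E.
  have := ge0_integral_gaussianS (h / 2) mG (fun t => F0 _).
  move=> ->; apply: eq_integral => z _; apply: eq_integral => x _.
  by rewrite /G theadE; congr (F (_, _)); exact: val_inj.
rewrite -[RHS](ge0_integral_coords hW h20 oe' vd mG (fun t => F0 _)).
apply: eq_integral => y _; rewrite /G; congr (F (_, _)).
  by rewrite /thead tnth_mktuple.
apply: eq_from_tnth => i; rewrite tnth_behead !tnth_mktuple.
by congr (L _ y); rewrite /= inordK ?ltnS.
Qed.

Local Notation PP := ((RT * RT) * (TT * TT))%type.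
(** The four groups of coordinates on which waves and cylindrical functions
    depend; positions and frequencies are put together so that the law is a
    product of a law of directions and a law of cylinders. *)
Definition dirmap (x : BT * BT) : PP := ((L e' x.1, L e' x.2), (X x.1, X x.2)).

Lemma measurable_dirmap : measurable_fun setT dirmap.
Proof.
have m1 := dual_fun_measurable hW e'; have m2 := measurable_coords hW (u := u).
by apply: measurable_fun_pair; apply: measurable_fun_pair;
  do [exact: (measurableT_comp m1 measurable_fst)|exact: (measurableT_comp m1 measurable_snd)
     |exact: (measurableT_comp m2 measurable_fst)|exact: (measurableT_comp m2 measurable_snd)].
Qed.

Local Notation m12 := (product_probability nrm nrm \x product_probability gam gam)%E.

(** Tonelli: [mu2] is a product over the two copies of [B], and in each copy
    the coordinates along [e'] and [u] are independent Gaussians. *)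
Lemma ge0_integral_dirmap (F : PP -> \bar R) : measurable_fun setT F ->
  (forall p, 0 <= F p)%E ->
  (\int[m12]_p F p = \int[mu2 mu (h / 2)]_x F (dirmap x))%E.
Proof.
move=> mF F0.
have mFd : measurable_fun setT (fun x : BT * BT => F (dirmap x)).
  exact: (measurableT_comp mF measurable_dirmap).
rewrite [LHS](fubini_tonelli1 F)// [RHS](fubini_tonelli1 (fun x => F (dirmap x)))//.
rewrite /fubini_F.
have mz : measurable_fun setT (fun z : RT * RT => (\int[product_probability gam gam]_x F (z, x))%E).
  exact: measurable_fun_fubini_tonelli_F.
rewrite [LHS](fubini_tonelli1 (fun z => (\int[product_probability gam gam]_x F (z, x))%E))//; last first.
  by move=> z; exact: integral_ge0.
rewrite /fubini_F.
pose G (p : RT * TT) := (\int[nrm]_z' \int[gam]_x' F ((p.1, z'), (p.2, x')))%E.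
have mcurry (p : RT * TT) : measurable_fun setT (fun q : RT * TT => F ((p.1, q.1), (p.2, q.2))).
  apply: (measurableT_comp mF); apply: measurable_fun_pair; apply: measurable_fun_pair => //.
have G0 p : (0 <= G p)%E by apply: integral_ge0 => z _; exact: integral_ge0.
have mG : measurable_fun setT G.
  pose K (y : (RT * TT) * (RT * TT)) := F ((y.1.1, y.2.1), (y.1.2, y.2.2)).
  have mK : measurable_fun setT K.
    apply: (measurableT_comp mF); apply: measurable_fun_pair; apply: measurable_fun_pair;
    do [exact: (measurableT_comp measurable_fst measurable_fst)
       |exact: (measurableT_comp measurable_fst measurable_snd)
       |exact: (measurableT_comp measurable_snd measurable_fst)
       |exact: (measurableT_comp measurable_snd measurable_snd)].
  have mf := @measurable_fun_fubini_tonelli_F _ _ _ _ _ (product_probability nrm gam) K mK.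
  rewrite (_ : G = fubini_F (product_probability nrm gam) K).
  exact: (mf (fun y => F0 _)).
  by apply/funext => p; rewrite /fubini_F [RHS](fubini_tonelli1 (fun q => K (p, q)) (mcurry p) (fun q => F0 _)).
transitivity (\int[mu (h / 2)]_y G (L e' y, X y))%E; last first.
  apply: eq_integral => y _; rewrite /G /=.
  by rewrite -(ge0_integral_dir (mcurry (L e' y, X y))).
rewrite (ge0_integral_dir mG G0).
apply: eq_integral => z _.
transitivity (\int[nrm]_z' \int[gam]_x \int[gam]_x' F ((z, z'), (x, x')))%E.
  apply: eq_integral => z' _.
  have m : measurable_fun setT (fun q : TT * TT => F ((z, z'), q)).
    by apply: (measurableT_comp mF); apply: measurable_fun_pair.
  exact: (fubini_tonelli1 _ m (fun=> F0 _)).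
pose J (q : RT * TT) := (\int[gam]_x' F ((z, q.1), (q.2, x')))%E.
have mJ : measurable_fun setT J.
  apply: (@measurable_fun_fubini_tonelli_F _ _ _ _ _ gam
    (fun y : (RT * TT) * TT => F ((z, y.1.1), (y.1.2, y.2)))) => //.
  apply: (measurableT_comp mF); apply: measurable_fun_pair; apply: measurable_fun_pair => //;
    do [exact: (measurableT_comp measurable_fst measurable_fst)
       |exact: (measurableT_comp measurable_snd measurable_fst)].
have J0 q : (0 <= J q)%E by exact: integral_ge0.
exact: (@fubini_tonelli _ _ _ _ _ nrm gam J mJ J0).
Qed.

Section phase_space_wave.
Variables (al be : R).

Let Az (z : RT * RT) : R := dirr * (al * z.1 + be * z.2).
Let a1 (i : 'I_n) : R := al * dirc i.
Let b1 (i : 'I_n) : R := be * dirc i.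

Lemma normal_phase th q : \int[nrm]_z cos (th + q * z) = cos th * expR (- (h / 4 * q ^+ 2)).
Proof.
rewrite (normal_charfun h20); congr (_ * expR _); lra.
Qed.

Lemma measurable_Az : measurable_fun setT Az.
Proof.
by apply: measurable_funM => //; apply: measurable_funD; apply: measurable_funM.
Qed.

Lemma normal2_phase th : \int[product_probability nrm nrm]_z cos (th + Az z) =
  cos th * expR (- (h / 4 * (dirr ^+ 2 * (al ^+ 2 + be ^+ 2)))).
Proof.
have ii : (nrm \x nrm)%E.-integrable setT (EFin \o (fun z => cos (th + Az z))).
  by apply: (intble_bounded _ _ (fun z => cos_norm_le1 _)); apply: measurable_cos_comp; apply: measurable_funD => //; exact: measurable_Az.
rewrite [LHS](Rintegral_fubini ii) /=.
transitivity (\int[nrm]_x (cos (th + dirr * al * x) * expR (- (h / 4 * (dirr * be) ^+ 2)))).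
  apply: eq_Rintegral => x _; rewrite -normal_phase; apply: eq_Rintegral => y _.
  by congr cos; rewrite /Az /=; ring.
rewrite RintegralZr//; last first.
  by apply: (intble_bounded _ _ (fun z => cos_norm_le1 _)); apply: measurable_cos_comp; apply: measurable_funD => //; exact: measurable_funM.
rewrite normal_phase -[LHS]mulrA -expRD; congr (_ * expR _); ring.
Qed.

End phase_space_wave.

Section master_formula.
Variables (al be th kap : R) (phi psi f g : H -> R).
Hypotheses (kap0 : 0 < kap).
Hypothesis fE : forall y, f y = kap * expR (- dot y y / (2 * h)) * phi y.
Hypothesis gE : forall y, g y = kap * expR (- dot y y / (2 * h)) * psi y.
Hypotheses (sf : schwartz_on dot u f) (sg : schwartz_on dot u g).

Let Az (z : RT * RT) : R := dirr * (al * z.1 + be * z.2).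
Let a1 (i : 'I_n) : R := al * dirc i.
Let b1 (i : 'I_n) : R := be * dirc i.

Let phE y : phi y = kap^-1 * expR (dot y y / (2 * h)) * f y.
Proof.
rewrite fE; set E := expR (dot y y / _); set E' := expR (- _ / _).
have EE : E * E' = 1 by rewrite /E /E' -expRD -mulrDl subrr mul0r expR0.
transitivity ((kap^-1 * kap) * (E * E') * phi y); last by ring.
by rewrite EE mulVf ?gt_eqF// !mul1r.
Qed.

Let psE y : psi y = kap^-1 * expR (dot y y / (2 * h)) * g y.
Proof.
rewrite gE; set E := expR (dot y y / _); set E' := expR (- _ / _).
have EE : E * E' = 1 by rewrite /E /E' -expRD -mulrDl subrr mul0r expR0.
transitivity ((kap^-1 * kap) * (E * E') * psi y); last by ring.
by rewrite EE mulVf ?gt_eqF// !mul1r.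
Qed.

Local Notation wd t := (wigner_density h f g t a1 b1).

Let parallelogram_exp (Z c : TT) :
  expR (dot (lincomb Z + lincomb c) (lincomb Z + lincomb c) / (2 * h)) *
  expR (dot (lincomb Z - lincomb c) (lincomb Z - lincomb c) / (2 * h)) =
  expR (tnorm2 Z / h) * expR (tnorm2 c / h).
Proof.
rewrite -!expRD; congr expR.
rewrite -(dot_lincomb_norm hH ou) -(dot_lincomb_norm hH ou).
rewrite !(dotDl hH, dotDr hH, dotNl hH, dotNr hH) (dotC hH (lincomb c) (lincomb Z)).
have hn : h != 0 by rewrite gt_eqF.
field; exact: hn.
Qed.

Let wprodC (Z c : TT) : phi (lincomb Z + lincomb c) * psi (lincomb Z - lincomb c) =
  kap^-1 ^+ 2 * (expR (tnorm2 Z / h) * expR (tnorm2 c / h)) * wprod f g Z c.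
Proof.
rewrite -parallelogram_exp wprodE phE psE; set A := expR _; set B' := expR _.
rewrite expr2; ring.
Qed.

(** The product of a wave of phase [th] and of the Wigner function of the
    cylindrical functions given by [phi] and [psi], for real-valued [phi] and
    [psi]. *)
Definition weyl_kernel (x : BT * BT) : R :=
  let z := lincomb (X x.1) in let zeta := lincomb (X x.2) in
  expR (dot zeta zeta / h) * \int[gam]_c
    (cos (th + al * L e x.1 + be * L e x.2 - 2 * dot zeta (lincomb c) / h) *
     (phi (z + lincomb c) * psi (z - lincomb c))).

Let integrable_kernel t b Z xi :
  gam.-integrable setT (EFin \o (fun c => ft_kernel h t b (wprod f g Z) (xi, c))).
Proof.
have [C [C0 hC]] := wprod_bound hH ou sf sg.
exact: (integrable_ft_kernel h0 (measurable_wprod2 Z sf sg) (hC Z)).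
Qed.

Lemma integrable_weyl_inner t (Z xi : TT) : gam.-integrable setT (EFin \o (fun c =>
    cos (t - 2 * dot (lincomb xi) (lincomb c) / h) *
    (phi (lincomb Z + lincomb c) * psi (lincomb Z - lincomb c)))).
Proof.
have := integrableZl_fin (kap^-1 ^+ 2 * expR (tnorm2 Z / h)) (integrable_kernel t (fun=> 0) Z xi).
congr (_.-integrable _ _); apply/funext => c; congr EFin.
rewrite wprodC /ft_kernel /=.
have -> : t - 2 * dot (lincomb xi) (lincomb c) / h = phase h t (fun=> 0) xi c.
  rewrite (dot_lincomb2 hH ou) /phase; congr (_ + _).
  rewrite mulrAC -mulNr mulr_sumr; apply: eq_bigr => i _; ring.
ring.
Qed.

(** The Gaussian factors of [f] and [g] absorb the exponentials; the
    independent direction only contributes a phase. *)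
Lemma weyl_kernelE x : weyl_kernel x =
  kap^-1 ^+ 2 * wd (th + Az (L e' x.1, L e' x.2)) (X x.1, X x.2).
Proof.
rewrite /weyl_kernel /wigner_density /=; set Z := X x.1; set xi := X x.2.
rewrite (dot_lincomb_norm hH ou).
set t := th + Az _ + _.
have E c : cos (th + al * L e x.1 + be * L e x.2 - 2 * dot (lincomb xi) (lincomb c) / h) *
     (phi (lincomb Z + lincomb c) * psi (lincomb Z - lincomb c)) =
  (kap^-1 ^+ 2 * expR (tnorm2 Z / h)) * ft_kernel h t b1 (wprod f g Z) (xi, c).
  rewrite wprodC /ft_kernel /=.
  have -> : th + al * L e x.1 + be * L e x.2 - 2 * dot (lincomb xi) (lincomb c) / h = phase h t b1 xi c.
    rewrite !dual_fun_dir (dot_lincomb2 hH ou) /phase /t /Az /= -/Z -/xi.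
    have -> : tdot (fun i => b1 i - 2 / h * tnth c i) xi =
        be * tdot dirc xi - 2 / h * \sum_(i < n) tnth xi i * tnth c i.
      rewrite /tdot !mulr_sumr -sumrB; apply: eq_bigr => i _; rewrite /b1; ring.
    have -> : tdot a1 Z = al * tdot dirc Z.
      by rewrite /tdot mulr_sumr; apply: eq_bigr => i _; rewrite /a1 mulrA.
    have -> : 2 * (\sum_(i < n) tnth xi i * tnth c i) / h = 2 / h * (\sum_(i < n) tnth xi i * tnth c i).
      by rewrite mulrAC.
    ring.
  ring.
under eq_Rintegral => c _ do rewrite E.
rewrite (RintegralZl _ measurableT (integrable_kernel _ _ _ _))//.
rewrite -[\int[gam]_c ft_kernel _ _ _ _ _]/(wigner_integral h t b1 (wprod f g Z) xi).
ring.
Qed.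

Let cos_add (A B' : R) : cos (A + B') = cos A * cos B' - cos (- (pi / 2) + A) * cos (B' - pi / 2).
Proof. by rewrite cosD [- _ + A]addrC !cos_subpihalf. Qed.

Lemma wigner_density_add t A z : wd (t + A) z = cos A * wd t z - cos (- (pi / 2) + A) * wd (t - pi / 2) z.
Proof.
rewrite /wigner_density.
have W b (r : R) : wigner_integral h (r + A) b (wprod f g z.1) z.2 =
  cos A * wigner_integral h r b (wprod f g z.1) z.2 -
  cos (- (pi / 2) + A) * wigner_integral h (r - pi / 2) b (wprod f g z.1) z.2.
  have i1 := integrable_kernel r b z.1 z.2; have i2 := integrable_kernel (r - pi / 2) b z.1 z.2.
  rewrite /wigner_integral -(RintegralZl _ measurableT i1) -(RintegralZl _ measurableT i2).
  rewrite -(RintegralB _ (integrableZl_fin (cos A) i1) (integrableZl_fin (cos (- (pi / 2) + A)) i2))//.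
  apply: eq_Rintegral => c _; rewrite /ft_kernel /= phaseB.
  rewrite (_ : phase h (r + A) b z.2 c = A + phase h r b z.2 c); last by rewrite /phase; ring.
  rewrite cos_add; ring.
rewrite (_ : t + A + tdot a1 z.1 = t + tdot a1 z.1 + A); last by ring.
rewrite W (_ : t - pi / 2 + tdot a1 z.1 = t + tdot a1 z.1 - pi / 2); last by rewrite addrAC.
ring.
Qed.

Lemma weyl_kernel_integral :
  (mu2 mu (h / 2)).-integrable setT (EFin \o weyl_kernel) /\
  \int[mu2 mu (h / 2)]_x weyl_kernel x = kap^-1 ^+ 2 *
    (expR (- (h / 4 * (dirr ^+ 2 * (al ^+ 2 + be ^+ 2)))) *
     \int[gam]_c (cos (th + tdot a1 c) * wprod f g c [tuple h / 2 * b1 i | i < n] *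
       expR (tnorm2 c / h))).
Proof.
have i1 := integrable_wigner_density hH h0 ou sf sg th a1 b1.
have i2 := integrable_wigner_density hH h0 ou sf sg (th - pi / 2) a1 b1.
have [ip Ep] := phase_product (m1 := product_probability nrm nrm) (m2 := product_probability gam gam)
  (measurable_Az al be) (normal2_phase al be) i1 i2.
have [iq Eq] := Rintegral_pullback measurable_dirmap ge0_integral_dirmap (integrableZl_fin (kap^-1 ^+ 2) ip).
have kE : weyl_kernel = fun x => kap^-1 ^+ 2 * (cos (Az (dirmap x).1) * wd th (dirmap x).2 -
    cos (- (pi / 2) + Az (dirmap x).1) * wd (th - pi / 2) (dirmap x).2).
  by apply/funext => x; rewrite weyl_kernelE wigner_density_add.
rewrite kE; split; first exact: iq.
apply: (eq_trans Eq); rewrite (RintegralZl _ measurableT ip); congr (_ * _).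
apply: (eq_trans Ep); congr (_ * _).
exact: (wigner_phase_space_integral hH h0 ou sf sg th a1 b1).
Qed.

Let tb : TT := [tuple h / 2 * b1 i | i < n].

Let coords_shift t y : X (wshift inc e (h / 2 * be * t) y) = [tuple tnth (X y) i + t * tnth tb i | i < n].
Proof.
apply: eq_from_tnth => i; rewrite !tnth_mktuple (dual_fun_wshift hW); last by apply: ud; exact: mem_nth.
by rewrite (dotC hH _ e) /b1 /dirc; congr (_ + _); ring.
Qed.

(** The integrand of the inner product of a Weyl translate, after it has been
    symmetrised by the Cameron-Martin formula. *)
Definition shifted_product (y : BT) : R := cos (th + al * L e y) *
  (phi (lincomb (X (wshift inc e (h / 2 * be) y))) *
   psi (lincomb (X (wshift inc e (- (h / 2 * be)) y)))).

Let q t (c : TT) : R := cos (t + tdot a1 c) * wprod f g c tb * expR (tnorm2 c / h).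

Let integrable_q t : gam.-integrable setT (EFin \o q t).
Proof.
have [C [C0 hC]] := wprod_bound hH ou sf sg.
have ii := integrable_Cdecay n h0 C.
apply: (intble_le _ ii) => [|c].
  apply: measurable_funM; last exact: measurable_expn2.
  apply: measurable_funM.
    by apply: measurable_cos_comp; apply: measurable_funD => //; exact: measurable_tdot.
  have mct : measurable_fun setT (fun c : TT => (c, tb)) by exact: measurable_fun_pair.
  exact: (measurableT_comp (measurable_wprod sf sg) mct).
rewrite /q normrM (ger0_norm (expR_ge0 _)) [leRHS]mulrCA [leLHS]mulrC ler_wpM2l ?expR_ge0//.
rewrite normrM; apply: (@le_trans _ _ (1 * (C * decay c * decay tb))).
  exact: (ler_pM (normr_ge0 _) (normr_ge0 _) (cos_norm_le1 _) (hC _ _)).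
by rewrite mul1r ler_piMr ?decay_le1// mulr_ge0// ltW// decay_gt0.
Qed.

(** The shift moves the coordinates along [u] only: the cylindrical functions
    do not see the direction [e'], which contributes a characteristic
    function. *)
Lemma shifted_product_integral :
  (mu (h / 2)).-integrable setT (EFin \o shifted_product) /\
  \int[mu (h / 2)]_y shifted_product y = kap^-1 ^+ 2 * expR (tnorm2 tb / h) *
    (expR (- (h / 4 * (dirr * al) ^+ 2)) * \int[gam]_c q th c).
Proof.
have mA : measurable_fun setT (fun z : RT => dirr * al * z) by exact: measurable_funM.
have [ip Ep] := phase_product (T1 := RT) (T2 := TT) (m1 := nrm) (m2 := gam)
  (A := fun z : RT => dirr * al * z) mA (fun t => normal_phase t (dirr * al)) (integrable_q th) (integrable_q (th - pi / 2)).
have mp : measurable_fun setT (fun y : BT => (L e' y, X y) : RT * TT).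
  by apply: measurable_fun_pair; [exact: (dual_fun_measurable hW e')|exact: (measurable_coords hW (u := u))].
have E (F : RT * TT -> \bar R) : measurable_fun setT F -> (forall x, 0 <= F x)%E ->
    (\int[(nrm \x gam)%E]_x F x = \int[mu (h / 2)]_y F (L e' y, X y))%E.
  by move=> mF F0; rewrite (ge0_integral_dir mF F0); exact: (fubini_tonelli1 _ mF F0).
have [iq Eq] := Rintegral_pullback (T1 := (RT * TT)%type) (m1 := (nrm \x gam)%E) (p := fun y : BT => (L e' y, X y)) mp E (integrableZl_fin (kap^-1 ^+ 2 * expR (tnorm2 tb / h)) ip).
have kE : shifted_product = fun y => kap^-1 ^+ 2 * expR (tnorm2 tb / h) *
    (cos (dirr * al * L e' y) * q th (X y) - cos (- (pi / 2) + dirr * al * L e' y) * q (th - pi / 2) (X y)).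
  apply/funext => y; rewrite /shifted_product.
  have -> : X (wshift inc e (h / 2 * be) y) = addt (X y, tb).
    rewrite -[h / 2 * be]mulr1 coords_shift; apply: eq_from_tnth => i.
    by rewrite !tnth_mktuple mul1r.
  have -> : X (wshift inc e (- (h / 2 * be)) y) = subt (X y, tb).
    rewrite -mulrN1 coords_shift; apply: eq_from_tnth => i.
    by rewrite !tnth_mktuple mulN1r.
  have -> : lincomb (addt (X y, tb)) = lincomb (X y) + lincomb tb by rewrite lincombD.
  have -> : lincomb (subt (X y, tb)) = lincomb (X y) - lincomb tb.
    by rewrite /lincomb -sumrB; apply: eq_bigr => i _; rewrite tnth_mktuple scalerBl.
  rewrite wprodC dual_fun_dir.
  have -> : th + al * (dirr * L e' y + tdot dirc (X y)) = dirr * al * L e' y + (th + tdot a1 (X y)).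
    have -> : tdot a1 (X y) = al * tdot dirc (X y).
      by rewrite /tdot mulr_sumr; apply: eq_bigr => i _; rewrite /a1 mulrA.
    ring.
  rewrite cos_add /q.
  have -> : th - pi / 2 + tdot a1 (X y) = th + tdot a1 (X y) - pi / 2 by rewrite addrAC.
  ring.
rewrite kE; split; first exact: iq.
apply: (eq_trans Eq); rewrite (RintegralZl _ measurableT ip); congr (_ * _).
exact: Ep.
Qed.

(** Both sides are the same finite dimensional integral. Their exponential
    factors agree because the squares of the components of [e] add up to one.
    *)
Lemma master_formula_dir : \int[mu2 mu (h / 2)]_x weyl_kernel x =
  expR (- (h / 4 * be ^+ 2)) * \int[mu (h / 2)]_y shifted_product y.
Proof.
rewrite weyl_kernel_integral.2 shifted_product_integral.2.
rewrite -[\int[gam]_c (cos _ * wprod f g c _ * _)]/(\int[gam]_c q th c).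
have -> : tnorm2 tb / h = h / 4 * (be ^+ 2 * (1 - dirr ^+ 2)).
  have -> : 1 - dirr ^+ 2 = \sum_(i < n) dirc i ^+ 2.
    by apply/eqP; rewrite subr_eq addrC eq_sym; apply/eqP; exact: dir_norm.
  rewrite /tnorm2 mulr_suml !mulr_sumr.
  apply: eq_bigr => i _; rewrite tnth_mktuple /b1; field.
  by rewrite gt_eqF.
set S := Rintegral _ _ _.
transitivity (kap^-1 ^+ 2 * S * (expR (- (h / 4 * be ^+ 2)) * expR (h / 4 * (be ^+ 2 * (1 - dirr ^+ 2))) *
  expR (- (h / 4 * (dirr * al) ^+ 2)))); last by ring.
have ex : - (h / 4 * be ^+ 2) + h / 4 * (be ^+ 2 * (1 - dirr ^+ 2)) + - (h / 4 * (dirr * al) ^+ 2) =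
  - (h / 4 * (dirr ^+ 2 * (al ^+ 2 + be ^+ 2))) by ring.
rewrite -!expRD ex.
ring.
Qed.

End master_formula.
End direction.

Theorem master_formula (al be th kap : R) (phi psi f g : H -> R) : 0 < kap ->
  (forall y, f y = kap * expR (- dot y y / (2 * h)) * phi y) ->
  (forall y, g y = kap * expR (- dot y y / (2 * h)) * psi y) ->
  schwartz_on dot u f -> schwartz_on dot u g ->
  [/\ forall t (Z xi : TT), gam.-integrable setT (EFin \o (fun c =>
        cos (t - 2 * dot (lincomb xi) (lincomb c) / h) *
        (phi (lincomb Z + lincomb c) * psi (lincomb Z - lincomb c)))),
      (mu2 mu (h / 2)).-integrable setT (EFin \o weyl_kernel al be th phi psi),
      (mu (h / 2)).-integrable setT (EFin \o shifted_product al be th phi psi) &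
      \int[mu2 mu (h / 2)]_x weyl_kernel al be th phi psi x =
      expR (- (h / 4 * be ^+ 2)) * \int[mu (h / 2)]_y shifted_product al be th phi psi y].
Proof.
move=> kap0 fE gE sf sg; have [e' [e'B oe' ue]] := orthogonal_direction.
split.
- by move=> t Z xi; exact: (integrable_weyl_inner kap0 fE gE sf sg t Z xi).
- exact: (weyl_kernel_integral e'B oe' ue al be th kap0 fE gE sf sg).1.
- exact: (shifted_product_integral e'B oe' ue al be th kap0 fE gE sf sg).1.
- exact: (master_formula_dir e'B oe' ue al be th kap0 fE gE sf sg).
Qed.
End master.

(** * Derivatives of sums of waves and symbol classes *)

Section cosine_symbols.
Context {R : realType} {V : normedModType R}.
Implicit Types (l : V -> R) (w : seq V) (z v : V).

Definition cos_wave l (th c : R) z : R := c * cos (l z + th).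

(** A derivative of a cosine is a quarter turn of its phase, so that all
    derivatives stay in the same family. *)
Lemma is_derive_cos_wave l th c z v : scalar l ->
  is_derive z v (cos_wave l th c) (cos_wave l (th + pi / 2) (l v * c) z).
Proof.
move=> ll.
have lv t : l (t *: v + z) = t * l v + l z by rewrite ll.
pose k (t : R) := c * cos (t * l v + (l z + th)).
have dk : is_derive (0 : R) 1 k (cos_wave l (th + pi / 2) (l v * c) z).
  apply: is_derive_eq.
  rewrite mul0r add0r /cos_wave addrA cosDpihalf /GRing.scale /=; ring.
have kE t : cos_wave l th c (t *: v + z) = k (t *: 1 + 0).
  by rewrite /cos_wave /k lv addr0 /GRing.scale /= mulr1 addrA.
have E : (fun t : R => t^-1 *: (((cos_wave l th c) \o shift z) (t *: v) - cos_wave l th c z)) =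
    (fun t : R => t^-1 *: ((k \o shift 0) (t *: (1 : R)) - k 0)).
  apply/funext => t /=; rewrite kE; congr (_ *: (_ - _)).
  by rewrite /k mul0r add0r /cos_wave.
have [dk1 dk2] := dk.
split; first by rewrite /derivable E.
by rewrite -dk2 /derive E.
Qed.

Variables (I : Type) (ks : seq I) (c : I -> R) (l : I -> V -> R) (th : I -> R).
Hypothesis ll : forall k, scalar (l k).
Hypothesis lc : forall k, continuous (l k).

(** The candidate for the iterated derivative along [w] of the sum of waves.
    *)
Definition cos_sum w z : R :=
  \sum_(k <- ks) cos_wave (l k) (th k + (size w)%:R * (pi / 2)) ((\prod_(v <- w) l k v) * c k) z.

Lemma is_derive_cos_sum w z v : is_derive z v (cos_sum w) (cos_sum (v :: w) z).
Proof.
have -> : cos_sum w = fun z => \sum_(k <- ks)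
    cos_wave (l k) (th k + (size w)%:R * (pi / 2)) ((\prod_(v <- w) l k v) * c k) z by [].
rewrite /cos_sum; elim: ks => [|k s IH].
  under eq_fun do rewrite big_nil; rewrite big_nil; exact: is_derive_cst.
under eq_fun do rewrite big_cons; rewrite big_cons.
apply: (@is_deriveD _ _ _ (cos_wave (l k) (th k + (size w)%:R * (pi / 2)) ((\prod_(v <- w) l k v) * c k))
  (fun z => \sum_(k <- s) cos_wave (l k) (th k + (size w)%:R * (pi / 2)) ((\prod_(v <- w) l k v) * c k) z)) => //.
have := @is_derive_cos_wave (l k) (th k + (size w)%:R * (pi / 2)) ((\prod_(v <- w) l k v) * c k) z v (@ll k).
have -> : th k + (size w)%:R * (pi / 2) + pi / 2 = th k + (size (v :: w))%:R * (pi / 2).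
  have aux (a b : R) n : a + n%:R * b + b = a + n.+1%:R * b by rewrite -addn1 natrD mulrDl mul1r addrA.
  exact: aux.
by move=> Hd; rewrite big_cons -[l k v * _ * _]mulrA; exact: Hd.
Qed.

Lemma partials_cos_sum w : partials w (cos_sum [::]) = cos_sum w.
Proof.
elim: w => //= v w ->; apply/funext => z.
by have [_ ->] := is_derive_cos_sum w z v.
Qed.

Lemma has_partials_cos_sum w : has_partials w (cos_sum [::]).
Proof.
elim: w => //= v w IH; split=> // z; rewrite partials_cos_sum.
by have [] := is_derive_cos_sum w z v.
Qed.

Lemma continuous_sum (J : Type) (js : seq J) (f : J -> V -> R) :
  (forall j, continuous (f j)) -> continuous (fun z => \sum_(j <- js) f j z).
Proof.
move=> fc; elim: js => [|j js IH] z.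
  rewrite (_ : (fun _ => _) = cst 0); first exact: cvg_cst.
  by apply/funext => y; rewrite big_nil.
rewrite (_ : (fun _ => _) = f j \+ (fun y => \sum_(j <- js) f j y)).
  by apply: cvgD; [exact: fc|exact: IH].
by apply/funext => y; rewrite big_cons.
Qed.

Lemma continuous_cos_sum w : continuous (cos_sum w).
Proof.
apply: continuous_sum => k z; apply: cvgM; first exact: cvg_cst.
apply: (@continuous_comp _ _ _ (fun z => l k z + _) (@cos R)); last exact: continuous_cos.
by apply: cvgD; [exact: lc|exact: cvg_cst].
Qed.

Lemma cos_sum_le w z :
  `|cos_sum w z| <= \sum_(k <- ks) (\prod_(v <- w) `|l k v|) * `|c k|.
Proof.
apply: le_trans (ler_norm_sum _ _ _) _; apply: ler_sum => k _.
rewrite /cos_wave !normrM normr_prod -[leRHS]mulr1 ler_wpM2l ?mulr_ge0 ?prodr_ge0//.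
by rewrite ler_norml cos_geN1 cos_le1.
Qed.

End cosine_symbols.

Section symbol_class.
Context {R : realType} {H : completeNormedModType R} (dot : H -> H -> R).
Hypothesis hH : hilbert_axioms dot.
Variables (e : nat -> H) (ks : seq (R * (R * R))).
Hypothesis oe : forall i j, dot (e i) (e j) = (i == j)%:R.

Definition wave_form (k : R * (R * R)) (z : H * H) : R :=
  k.2.1 * dot (e 0%N) z.1 + k.2.2 * dot (e 0%N) z.2.

Definition cos_symbol (z : H * H) : R := \sum_(k <- ks) k.1 * cos (wave_form k z).

Lemma wave_form_scalar k : scalar (wave_form k).
Proof.
move=> a x y; rewrite /wave_form /= !(dotDr hH) !(dotZr hH) /GRing.scale /=; ring.
Qed.

Lemma wave_form_continuous k : continuous (wave_form k).
Proof.
move=> z; apply: cvgD; apply: cvgM; do ?exact: cvg_cst.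
  by apply: (@continuous_comp _ _ _ fst (dot (e 0%N))); [exact: cvg_fst|exact: dot_continuous].
by apply: (@continuous_comp _ _ _ snd (dot (e 0%N))); [exact: cvg_snd|exact: dot_continuous].
Qed.

Lemma cos_symbolE : cos_symbol = cos_sum ks (fun k => k.1) wave_form (cst 0) [::].
Proof.
apply/funext => z; apply: eq_bigr => k _.
by rewrite /cos_wave big_nil mul1r mul0r !addr0.
Qed.

Lemma prod_multi_directions (g : H * H -> R) N alpha beta :
  \prod_(v <- multi_directions e N alpha beta) g v =
  \prod_(j < N) (g (e j, 0) ^+ alpha j * g (0, e j) ^+ beta j).
Proof.
rewrite -(big_mkord xpredT (fun j => g (e j, 0) ^+ alpha j * g (0, e j) ^+ beta j)).
rewrite /multi_directions big_flatten big_map /index_iota subn0.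
by apply: eq_bigr => j _; rewrite big_cat /= !big_nseq !iter_mulr_1.
Qed.

(** A derivative along [e j] with j > 0 vanishes, since the waves depend on
    the first coordinates only; along [e 0] it costs a frequency, at most [m]
    times for each of the two variables. *)
Lemma cos_symbol_class m : symbol_class m e (fun j => (j == 0%N)%:R) cos_symbol.
Proof.
rewrite cos_symbolE; have ws := wave_form_scalar; have wc := wave_form_continuous.
split.
- exact: continuous_cos_sum.
- exists (\sum_(k <- ks) (\prod_(v <- [::]) `|wave_form k v|) * `|k.1|) => z.
  exact: cos_sum_le.
pose K (k : R * (R * R)) := (1 + `|k.2.1|) ^+ m * (1 + `|k.2.2|) ^+ m.
have K1 k : 1 <= K k by rewrite mulr_ege1// exprn_ege1// lerDl.
exists (\sum_(k <- ks) K k * `|k.1|).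
  by apply: sumr_ge0 => k _; rewrite mulr_ge0// (le_trans ler01 (K1 k)).
move=> N alpha beta _ abm /=; split.
- exact: has_partials_cos_sum.
- by rewrite partials_cos_sum//; exact: continuous_cos_sum.
move=> z; rewrite partials_cos_sum//; apply: le_trans (cos_sum_le _ _ _ _ _ _) _.
rewrite mulr_suml; apply: ler_sum => k _; rewrite mulrAC ler_wpM2r//.
rewrite (prod_multi_directions (fun v => `|wave_form k v|)).
have w1 j : `|wave_form k (e j, 0)| = `|k.2.1| * (j == 0%N)%:R.
  by rewrite /wave_form /= (dot0r hH) mulr0 addr0 oe normrM eq_sym normr_nat.
have w2 j : `|wave_form k (0, e j)| = `|k.2.2| * (j == 0%N)%:R.
  by rewrite /wave_form /= (dot0r hH) mulr0 add0r oe normrM eq_sym normr_nat.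
rewrite (eq_bigr (fun j : 'I_N => (`|k.2.1| * (val j == 0%N)%:R) ^+ alpha j *
  (`|k.2.2| * (val j == 0%N)%:R) ^+ beta j)); last by move=> j _; rewrite -w1 -w2.
have pw (x : R) n : 0 <= x -> (n <= m)%N -> x ^+ n <= (1 + x) ^+ m.
  move=> x0 nm; apply: (@le_trans _ _ ((1 + x) ^+ n)).
    by rewrite lerXn2r ?nnegrE// ?addr_ge0// lerDr.
  by apply: ler_weXn2l => //; rewrite lerDl.
case: N => [|N]; first by rewrite !big_ord0 mulr1.
rewrite !big_ord_recl /= !mulr1 !expr1n mul1r.
have -> : \prod_(i < N) ((`|k.2.1| * (bump 0 i == 0%N)%:R) ^+ alpha (bump 0 i) *
    (`|k.2.2| * (bump 0 i == 0%N)%:R) ^+ beta (bump 0 i)) =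
  \prod_(i < N) (bump 0 i == 0%N)%:R ^+ (alpha (bump 0 i) + beta (bump 0 i)) :> R.
  by apply: eq_bigr => i _; rewrite /= !mulr0 -exprD.
apply: ler_wpM2r; first by apply: prodr_ge0 => i _; exact: exprn_ge0.
have [a0 b0] := abm 0%N.
by apply: ler_pM; rewrite ?exprn_ge0//; exact: pw.
Qed.

End symbol_class.

(** * Square norms and completeness of L^2 *)

Lemma cvge0P (R : realType) (u : nat -> \bar R) : (forall n, 0 <= u n)%E ->
  u @ \oo --> 0%E <-> forall e : R, 0 < e -> \forall n \near \oo, (u n <= e%:E)%E.
Proof.
move=> u0; split.
  move=> /fine_cvgP[uf /cvgrPdist_le u1] e e0.
  near=> n.
  have fn : u n \is a fin_num by near: n.
  have : `|0 - (fine \o u) n| <= e by near: n; exact: u1.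
  rewrite sub0r normrN => un; rewrite -(fineK fn) lee_fin.
  by apply: le_trans un; exact: ler_norm.
move=> ue; apply/fine_cvgP; split.
  near=> n.
  have un : (u n <= 1%:E)%E by near: n; exact: ue.
  by rewrite ge0_fin_numE// (le_lt_trans un)// ltry.
apply/cvgrPdist_le => e e0; near=> n.
have un : (u n <= e%:E)%E by near: n; exact: ue.
rewrite sub0r normrN /= ger0_norm ?fine_ge0//.
have fn : u n \is a fin_num by rewrite ge0_fin_numE// (le_lt_trans un)// ltry.
by rewrite -lee_fin fineK.
Unshelve. all: by end_near. Qed.

Section square_norm.
Context d (T : measurableType d) (R : realType) (m : probability T R).
Implicit Types f g : T -> R.

Definition sqnorm f : \bar R := (\int[m]_x (f x ^+ 2)%:E)%E.

Lemma sqnorm_ge0 f : (0 <= sqnorm f)%E.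
Proof. by apply: integral_ge0 => x _; rewrite lee_fin sqr_ge0. Qed.

Lemma Lnorm2_sqnorm f : ('N[m]_2%:E[EFin \o f] `^ 2 = sqnorm f)%E.
Proof.
rewrite poweR_Lnorm//; apply: eq_integral => x _.
by rewrite /= powR_mulrn// real_normK// num_real.
Qed.

Lemma Lnorm2_le f (c : R) : 0 <= c -> ('N[m]_2%:E[EFin \o f] <= c%:E)%E <->
  (sqnorm f <= (c ^+ 2)%:E)%E.
Proof.
move=> c0; rewrite -Lnorm2_sqnorm.
have := Lnorm_ge0 m 2%:E (EFin \o f).
case: ('N[m]_2%:E[EFin \o f])%E => [r|_|//]; last by rewrite poweRyr// leye_eq.
by rewrite !lee_fin => r0; rewrite powR_mulrn// ler_sqr ?nnegrE.
Qed.

(** Convergence in L^2 is expressed by [sqnorm] in what follows, which avoids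
    real powers of extended real numbers. *)
Lemma Lnorm2_cvg0 (f : nat -> T -> R) :
  'N[m]_2%:E[EFin \o f n]%E @[n --> \oo] --> 0%E <-> sqnorm (f n) @[n --> \oo] --> 0%E.
Proof.
split=> h; apply/cvge0P => [n|e e0].
- exact: sqnorm_ge0.
- have s0 : 0 < Num.sqrt e by rewrite sqrtr_gt0.
  have := (cvge0P (fun n => Lnorm_ge0 _ _ _)).1 h _ s0; apply: filterS => n.
  by rewrite Lnorm2_le ?sqrtr_ge0// sqr_sqrtr// ltW.
- exact: Lnorm_ge0.
- have e2 : 0 < e ^+ 2 by rewrite exprn_gt0.
  have := (cvge0P (fun n => sqnorm_ge0 (f n))).1 h _ e2; apply: filterS => n.
  by rewrite -Lnorm2_le// ltW.
Qed.

Lemma sqnormZ c f : measurable_fun setT f -> sqnorm (fun x => c * f x) = ((c ^+ 2)%:E * sqnorm f)%E.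
Proof.
move=> mf; rewrite /sqnorm; under eq_integral do rewrite exprMn EFinM.
rewrite ge0_integralZl//; last by rewrite lee_fin sqr_ge0.
  by apply/measurable_EFinP; exact: measurable_funX.
by move=> x _; rewrite lee_fin sqr_ge0.
Qed.

Lemma le_sqnorm f g : measurable_fun setT f -> measurable_fun setT g ->
  (forall x, `|f x| <= `|g x|) -> (sqnorm f <= sqnorm g)%E.
Proof.
move=> mf mg fg; apply: ge0_le_integral => //.
- by move=> x _; rewrite lee_fin sqr_ge0.
- by apply/measurable_EFinP; exact: measurable_funX.
- by apply/measurable_EFinP; exact: measurable_funX.
by move=> x _; rewrite lee_fin -(real_normK (num_real (f x))) -(real_normK (num_real (g x))) lerXn2r ?nnegrE.
Qed.

Lemma sqnormD f g : measurable_fun setT f -> measurable_fun setT g ->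
  (sqnorm (fun x => f x + g x)%R <= 2%:E * sqnorm f + 2%:E * sqnorm g)%E.
Proof.
move=> mf mg.
have m1 : measurable_fun setT (fun x => (f x ^+ 2)%:E) by apply/measurable_EFinP; exact: measurable_funX.
have m2 : measurable_fun setT (fun x => (g x ^+ 2)%:E) by apply/measurable_EFinP; exact: measurable_funX.
have p1 x : (0 <= (f x ^+ 2)%:E)%E by rewrite lee_fin sqr_ge0.
have p2 x : (0 <= (g x ^+ 2)%:E)%E by rewrite lee_fin sqr_ge0.
rewrite /sqnorm -!ge0_integralZl// -ge0_integralD//; last 4 first.
- by move=> x _; rewrite mule_ge0.
- exact: measurable_funeM.
- by move=> x _; rewrite mule_ge0.
- exact: measurable_funeM.
apply: ge0_le_integral => //.
- by move=> x _; rewrite lee_fin sqr_ge0.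
- by apply/measurable_EFinP; apply: measurable_funX; exact: measurable_funD.
- by apply: emeasurable_funD; exact: measurable_funeM.
move=> x _; rewrite -!EFinM -EFinD lee_fin.
have := sqr_ge0 (f x - g x); rewrite !expr2 => h; lra.
Qed.

Lemma sqnorm_Lfun f : measurable_fun setT f -> (sqnorm f < +oo)%E -> f \in Lfun m 2%:E.
Proof.
move=> mf ff; rewrite inE; apply/andP; split; rewrite inE//=.
rewrite /finite_norm; move: ff; rewrite -Lnorm2_sqnorm.
have := Lnorm_ge0 m 2%:E (EFin \o f).
case: ('N[m]_2%:E[EFin \o f])%E => [r _ _|_|_ _]; [exact: ltry|by rewrite poweRyr|by []].
Qed.

Lemma Lfun_sqnorm f : f \in Lfun m 2%:E -> measurable_fun setT f /\ (sqnorm f < +oo)%E.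
Proof.
rewrite inE => /andP[]; rewrite !inE /= => mf; rewrite /finite_norm => ff; split=> //.
rewrite -Lnorm2_sqnorm; have := Lnorm_ge0 m 2%:E (EFin \o f); move: ff.
by case: ('N[m]_2%:E[EFin \o f])%E => [r _ _| |]; [exact: ltry|rewrite ltxx|].
Qed.

Lemma bounded_Lfun f (C : R) : measurable_fun setT f -> (forall x, `|f x| <= C) ->
  f \in Lfun m 2%:E.
Proof.
move=> mf fC; apply: sqnorm_Lfun => //.
have C0 : 0 <= C := le_trans (normr_ge0 _) (fC point).
apply: (@le_lt_trans _ _ (sqnorm (cst C))).
  by apply: le_sqnorm => // x; rewrite (ger0_norm C0).
rewrite /sqnorm (_ : (fun x => _) = cst (C ^+ 2)%:E)// integral_cst//.
by rewrite [X in (_ * X)%E]probability_setT mule1 ltry.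
Qed.

End square_norm.

Section riesz_fischer.
Context d (T : measurableType d) (R : realType) (m : probability T R).
Variables (phi : nat -> T -> R) (C : R).
Hypotheses (mphi : forall n, measurable_fun setT (phi n)) (C0 : 0 <= C).
Hypothesis phiC : forall n, (sqnorm m (fun x => phi n.+1 x - phi n x)%R <= (C * 2^-1 ^+ n * 2^-1 ^+ n)%:E)%E.

Let psi n x := phi n.+1 x - phi n x.
Let w n x := 2 ^+ n * psi n x ^+ 2.
Let G x : \bar R := (\sum_(n <oo) (w n x)%:E)%E.

Let w0 n x : 0 <= w n x. Proof. by apply: mulr_ge0; [exact: exprn_ge0|exact: sqr_ge0]. Qed.

Let mw n : measurable_fun setT (fun x => (w n x)%:E).
Proof.
apply/measurable_EFinP; apply: measurable_funM => //; apply: measurable_funX.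
exact: measurable_funB.
Qed.

Let geo k n : \sum_(k <= i < n) (2^-1 ^+ i : R) <= 2 * 2^-1 ^+ k.
Proof.
have [nk|kn] := leqP n k; first by rewrite big_geq// mulr_ge0// exprn_ge0.
suff -> : \sum_(k <= i < n) (2^-1 ^+ i : R) = 2 * 2^-1 ^+ k - 2 * 2^-1 ^+ n.
  by rewrite gerBl mulr_ge0// exprn_ge0.
elim: n kn => // n IH; rewrite ltnS => kn.
rewrite big_nat_recr//; have [->|kn'] := eqVneq n k.
  by rewrite big_geq// exprS; rewrite -[LHS]/(0 + 2^-1 ^+ k); field.
have kn2 : (k < n)%N by rewrite ltn_neqAle eq_sym kn'.
apply: (eq_trans (congr1 (fun r => r + _) (IH kn2))).
by rewrite /= [2^-1 ^+ n.+1]exprS; field.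
Qed.

Let intG : (\int[m]_x G x <= (2 * C)%:E)%E.
Proof.
rewrite /G integral_nneseries//; last by move=> n x _; rewrite lee_fin.
apply: lime_le.
  by apply: is_cvg_nneseries => n _ _; apply: integral_ge0 => x _; rewrite lee_fin.
near=> n; apply: (@le_trans _ _ (\sum_(0 <= i < n) (C * 2^-1 ^+ i)%:E)%E).
  apply: lee_sum => i _.
  rewrite /w; under eq_integral do rewrite EFinM.
  have mp : measurable_fun setT (fun x => (psi i x ^+ 2)%:E).
    by apply/measurable_EFinP; apply: measurable_funX; exact: measurable_funB.
  have p0 x : setT x -> (0 <= (psi i x ^+ 2)%:E)%E by move=> _; rewrite lee_fin sqr_ge0.
  have k0 : (0 <= (2 ^+ i : R)%:E)%E by rewrite lee_fin exprn_ge0.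
  rewrite (ge0_integralZl m measurableT mp p0 k0).
  apply: (@le_trans _ _ ((2 ^+ i)%:E * (C * 2^-1 ^+ i * 2^-1 ^+ i)%:E)%E).
    by apply: lee_wpmul2l => //; exact: phiC.
  rewrite -EFinM lee_fin.
  rewrite (_ : 2 ^+ i * (C * 2^-1 ^+ i * 2^-1 ^+ i) = C * 2^-1 ^+ i * (2^-1 * 2) ^+ i).
    by rewrite mulVf ?pnatr_eq0// expr1n mulr1.
  by rewrite [(2^-1 * 2) ^+ i]exprMn; set q := 2^-1 ^+ i; ring.
rewrite sumEFin lee_fin -mulr_sumr mulrC ler_wpM2r//.
by apply: (le_trans (geo 0 n)); rewrite expr0 mulr1.
Unshelve. all: by end_near. Qed.

Let weighted_cs a b p q A B' : 0 <= p -> 0 <= q -> 0 <= A -> 0 <= B' ->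
  a ^+ 2 <= p * A -> b ^+ 2 <= q * B' -> (a + b) ^+ 2 <= (p + q) * (A + B') :> R.
Proof.
move=> p0 q0 A0 B0 aA bB.
have h : a * b *+ 2 <= p * B' + q * A.
  have [ab|ab] := leP (a * b) 0.
    by apply: (@le_trans _ _ 0); [rewrite mulrn_wle0|rewrite addr_ge0 ?mulr_ge0].
  rewrite -ler_sqr ?nnegrE ?mulrn_wge0 ?(ltW ab) ?addr_ge0 ?mulr_ge0//.
  have k : a ^+ 2 * b ^+ 2 <= (p * B') * (q * A).
    by rewrite (_ : p * B' * (q * A) = p * A * (q * B')); [rewrite ler_pM ?sqr_ge0|ring].
  rewrite (_ : (a * b *+ 2) ^+ 2 = 4 * (a ^+ 2 * b ^+ 2)); last by rewrite -mulr_natr; ring.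
  rewrite (_ : (p * B' + q * A) ^+ 2 = (p * B' - q * A) ^+ 2 + 4 * ((p * B') * (q * A))); last by ring.
  by apply: ler_wpDl; [exact: sqr_ge0|exact: ler_wpM2l].
rewrite (_ : (p + q) * (A + B') = p * A + q * B' + (p * B' + q * A)); last by ring.
by rewrite sqrrD addrAC; exact: lerD (lerD aA bB) h.
Qed.

Let phi_cs k n x : (k <= n)%N -> (phi n x - phi k x) ^+ 2 <=
  (\sum_(k <= i < n) 2^-1 ^+ i) * \sum_(k <= i < n) w i x.
Proof.
elim: n => [|n IH].
  by rewrite leqn0 => /eqP ->; rewrite subrr expr0n /= big_geq// mul0r.
rewrite leq_eqVlt => /predU1P[->|]; first by rewrite subrr expr0n /= big_geq// mul0r.
rewrite ltnS => kn; rewrite !big_nat_recr//=.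
rewrite (_ : phi n.+1 x - phi k x = (phi n x - phi k x) + psi n x); last by rewrite /psi; ring.
apply: weighted_cs.
- by apply: sumr_ge0 => i _; exact: exprn_ge0.
- exact: exprn_ge0.
- by apply: sumr_ge0 => i _; exact: w0.
- exact: w0.
- exact: IH.
by rewrite /w mulrA -exprMn mulVf// expr1n mul1r.
Qed.

Let phi_G k n x : (k <= n)%N -> (((phi n x - phi k x) ^+ 2)%:E <= (2 * 2^-1 ^+ k)%:E * G x)%E.
Proof.
move=> kn; apply: (@le_trans _ _ ((2 * 2^-1 ^+ k) * \sum_(k <= i < n) w i x)%:E).
  rewrite lee_fin; apply: (le_trans (phi_cs x kn)); rewrite ler_wpM2r//.
  by apply: sumr_ge0 => i _; exact: w0.
rewrite EFinM; apply: lee_wpmul2l; first by rewrite lee_fin mulr_ge0// exprn_ge0.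
apply: (@le_trans _ _ (\sum_(0 <= i < n) (w i x)%:E)%E).
  rewrite sumEFin lee_fin (@big_cat_nat _ _ _ k 0%N n)//= lerDr.
  by apply: sumr_ge0 => i _; exact: w0.
by apply: nneseries_lim_ge => i _ _; rewrite lee_fin.
Qed.

Let limit x : R := fine (limn_esup (fun n => (phi n x)%:E)).

Let limitP x : (G x < +oo)%E -> phi n x @[n --> \oo] --> limit x.
Proof.
move=> Gx.
have G0 : (0 <= G x)%E by apply: nneseries_ge0 => n _ _; rewrite lee_fin.
have Gf : G x \is a fin_num by rewrite ge0_fin_numE.
have ph k n : (k <= n)%N -> (phi n x - phi k x) ^+ 2 <= 2 * 2^-1 ^+ k * fine (G x).
  by move=> /(phi_G x); rewrite -{1}(fineK Gf) -EFinM lee_fin.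
have z : 2 * 2^-1 ^+ k * fine (G x) @[k --> \oo] --> (0 : R).
  have g : (2^-1 ^+ k : R) @[k --> \oo] --> (0 : R).
    by apply: cvg_expr; rewrite ger0_norm// invf_lt1// ltr1n.
  by have := cvgM (cvgM (cvg_cst (2 : R)) g) (cvg_cst (fine (G x))); rewrite mulr0 mul0r; apply.
have c : cvgn (fun n => phi n x).
  apply/cauchy_cvgP/cauchy_ballP => e e0; near_simpl.
  have [k hk] : exists k, 2 * 2^-1 ^+ k * fine (G x) < (e / 2) ^+ 2.
    have e20 : 0 < (e / 2) ^+ 2 by rewrite exprn_gt0// divr_gt0.
    have [k _ /(_ k (leqnn k)) hk] := ((cvgrPdist_lt _ _).1 z) _ e20.
    by exists k; apply: le_lt_trans hk; rewrite sub0r normrN ler_norm.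
  have hn n : (k <= n)%N -> `|phi n x - phi k x| < e / 2.
    move=> kn; rewrite -ltr_sqr ?nnegrE ?divr_ge0 ?(ltW e0)// real_normK ?num_real//.
    exact: le_lt_trans (ph k n kn) hk.
  near=> n1 n2.
  have k1 : (k <= n1)%N by near: n1; exists k.
  have k2 : (k <= n2)%N by near: n2; exists k.
  rewrite /ball/= /ball_; have := hn _ k1; have := hn _ k2.
  rewrite (_ : phi n1 x - phi n2 x = (phi n1 x - phi k x) - (phi n2 x - phi k x)); last by ring.
  move=> h2 h1; apply: (le_lt_trans (ler_normB _ _)).
  rewrite [ltRHS]splitr; exact: ltrD.
have cE : (fun n => (phi n x)%:E) @ \oo --> (lim (phi n x @[n --> \oo]))%:E by apply: cvg_EFin => //; near=> n.
by rewrite /limit (cvg_limn_einf_sup cE).2.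
Unshelve. all: by end_near. Qed.

(** If the increments are small enough in square norm, the sum [G] of their
    squares weighted by 2^n is integrable, and it dominates all tails by a
    weighted Cauchy-Schwarz inequality; the bound also holds, trivially, where
    [G] is infinite. *)
Lemma riesz_fischer : exists l : T -> R, measurable_fun setT l /\
  sqnorm m (fun x => phi n x - l x) @[n --> \oo] --> 0%E.
Proof.
have ml : measurable_fun setT limit.
  apply: measurableT_comp => //.
  by apply: measurable_fun_limn_esup => n; exact/measurable_EFinP.
exists limit; split=> //; apply/cvge0P => [n|e e0]; first exact: sqnorm_ge0.
have z : 2 * 2^-1 ^+ k * (2 * C) @[k --> \oo] --> (0 : R).
  have g : (2^-1 ^+ k : R) @[k --> \oo] --> (0 : R).
    by apply: cvg_expr; rewrite ger0_norm// invf_lt1// ltr1n.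
  by have := cvgM (cvgM (cvg_cst (2 : R)) g) (cvg_cst (2 * C)); rewrite mulr0 mul0r; apply.
near=> k.
have zk : 2 * 2^-1 ^+ k * (2 * C) <= e.
  have : `|0 - 2 * 2^-1 ^+ k * (2 * C)| <= e by near: k; exact: ((cvgrPdist_le _ _).1 z).
  by rewrite sub0r normrN; apply: le_trans; exact: ler_norm.
have mG : measurable_fun setT G.
  by apply: ge0_emeasurable_sum => // n x _ _; rewrite lee_fin.
have G0 x : (0 <= G x)%E by apply: nneseries_ge0 => n _ _; rewrite lee_fin.
apply: (@le_trans _ _ (\int[m]_x ((2 * 2^-1 ^+ k)%:E * G x))%E); last first.
  have k0 : (0 <= (2 * 2^-1 ^+ k : R)%:E)%E by rewrite lee_fin mulr_ge0// exprn_ge0.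
  rewrite (ge0_integralZl m measurableT mG (fun x _ => G0 x) k0).
  apply: (@le_trans _ _ ((2 * 2^-1 ^+ k)%:E * (2 * C)%:E)%E); last by rewrite -EFinM lee_fin.
  by apply: lee_wpmul2l => //; rewrite lee_fin mulr_ge0// exprn_ge0.
apply: ge0_le_integral => //.
- by move=> x _; rewrite lee_fin sqr_ge0.
- by apply/measurable_EFinP; apply: measurable_funX; exact: measurable_funB.
- exact: measurable_funeM.
move=> x _; have [Gx|] := ltP (G x) +oo%E; last first.
  by rewrite leye_eq => /eqP ->; rewrite gt0_muley ?leey// lte_fin mulr_gt0// exprn_gt0.
have Gf : G x \is a fin_num by rewrite ge0_fin_numE.
rewrite -(fineK Gf) -EFinM lee_fin -sqrrN opprB.
have c : (phi n x - phi k x) ^+ 2 @[n --> \oo] --> (limit x - phi k x) ^+ 2.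
  have c1 : phi n x - phi k x @[n --> \oo] --> limit x - phi k x.
    by apply: cvgB; [exact: limitP|exact: cvg_cst].
  by rewrite expr2; under eq_fun do rewrite expr2; exact: (cvgM c1 c1).
apply: (cvgr_to_le c); near=> n.
have kn : (k <= n)%N by near: n; exists k.
by have := phi_G x kn; rewrite -{1}(fineK Gf) -EFinM lee_fin.
Unshelve. all: by end_near. Qed.

End riesz_fischer.

(** * Stochastic extensions of linear forms and of sums of waves *)

Lemma cos_lipschitz (R : realType) (x y : R) : `|cos x - cos y| <= `|x - y|.
Proof.
have dc (s : R) : derivable (@cos R : R -> R) (y + s *: 1) 1 by exact: ex_derive.
have bc (s : R) : `|'D_1 (@cos R : R -> R) (y + s *: 1)| <= 1.
  by rewrite derive_val ler_norml; apply/andP; split; have := sin_geN1 (y + s *: 1);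
    have := sin_le1 (y + s *: 1); rewrite /GRing.scale /= ?mulr1 => h1 h2; lra.
have := @line_lipschitz R R (@cos R : R -> R) y 1 1 dc bc (x - y).
by rewrite /GRing.scale /= mulr1 [y + _]addrC subrK mul1r.
Qed.

Lemma open_norm_ball (R : realType) (V : normedModType R) (x : V) (r : R) :
  open [set y | `|x - y| < r].
Proof.
apply: (@open_comp _ _ (fun y => `|x - y|) [set t | t < r]); last exact: open_lt.
by move=> y _; apply: cvg_norm; apply: cvgB; [exact: cvg_cst|exact: cvg_id].
Qed.

Section extension.
Context {R : realType} {H B : completeNormedModType R}.
Variables (dot : H -> H -> R) (inc : H -> B) (mu : R -> probability (borelType B) R).
Hypothesis hW : abstract_wiener dot inc mu.
Variable s : R.
Hypothesis s0 : 0 < s.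
Local Notation BT := (borelType B).
Local Notation BB := (BT * BT)%type.
Local Notation RT := (measurableTypeR R).
Local Notation L := (dual_fun dot inc).
Local Notation D := (in_dual dot inc).
Local Notation m2 := (mu2 mu s).
Local Notation dual2 := (dual_pair (dot2 dot) (inc2 inc)).
Let hH : hilbert_axioms dot := aw_hilbert hW.
Implicit Types (a b : H * H) (l : BB -> R).

Definition dual_fun2 b (x : B * B) : R := L b.1 x.1 + L b.2 x.2.

Let inc0 : inc 0 = 0. Proof. by have := incZ hW 0 0; rewrite !scale0r. Qed.

(** A continuous functional on [B * B] is the sum of its restrictions to the
    two factors. *)
Lemma dual_pair2E b (phi : B * B -> R) : dual2 b phi -> [/\ D b.1, D b.2 & phi = dual_fun2 b].
Proof.
move=> [sc co ph].
have i1 : dual_pair dot inc b.1 (fun y => phi (y, 0)).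
  split=> [c x y|y|x].
  - rewrite -(sc c (x, 0) (y, 0)); congr phi.
    by transitivity (c *: x + y, c *: (0 : B) + 0); first by rewrite scaler0 addr0.
  - apply: (@continuous_comp _ _ _ (fun y : B => (y, 0 : B)) phi); last exact: co.
    by apply: cvg_pair; [exact: cvg_id|exact: cvg_cst].
  - by have := ph (x, 0); rewrite /inc2 /dot2 /= inc0 (dot0r hH) addr0.
have i2 : dual_pair dot inc b.2 (fun y => phi (0, y)).
  split=> [c x y|y|x].
  - rewrite -(sc c (0, x) (0, y)); congr phi.
    by transitivity (c *: (0 : B) + 0, c *: x + y); first by rewrite scaler0 addr0.
  - apply: (@continuous_comp _ _ _ (fun y : B => (0 : B, y)) phi); last exact: co.
    by apply: cvg_pair; [exact: cvg_cst|exact: cvg_id].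
  - by have := ph (0, x); rewrite /inc2 /dot2 /= inc0 (dot0r hH) add0r.
split; [by eexists; exact: i1|by eexists; exact: i2|].
apply/funext => -[x x']; rewrite /dual_fun2 (dual_funE hW i1) (dual_funE hW i2) /=.
have := sc 1 (x, 0) (0, x'); rewrite /GRing.scale /= mul1r => <-; congr phi.
by transitivity (1 *: x + 0, 1 *: (0 : B) + x'); first by rewrite !scale1r addr0 add0r.
Qed.

Lemma dual_pair2P b : D b.1 -> D b.2 -> dual2 b (dual_fun2 b).
Proof.
move=> b1 b2; have [s1 c1 p1] := dual_funP hW b1; have [s2 c2 p2] := dual_funP hW b2.
split.
- move=> c x y; rewrite /dual_fun2 /= s1 s2 /GRing.scale /=; ring.
- move=> x; apply: cvgD.
    by apply: (@continuous_comp _ _ _ fst (L b.1)); [exact: cvg_fst|exact: c1].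
  by apply: (@continuous_comp _ _ _ snd (L b.2)); [exact: cvg_snd|exact: c2].
- by move=> x; rewrite /dual_fun2 /inc2 /dot2 /= p1 p2.
Qed.

Lemma dual_fun2_lin c a b x : D a.1 -> D a.2 -> D b.1 -> D b.2 ->
  dual_fun2 (c *: a + b) x = c * dual_fun2 a x + dual_fun2 b x.
Proof.
by move=> a1 a2 b1 b2; rewrite /dual_fun2 /= !(dual_fun_lin hW)//; ring.
Qed.

Lemma measurable_dual_fun2 b : measurable_fun setT (dual_fun2 b : BB -> R).
Proof.
apply: measurable_funD.
  exact: (measurableT_comp (dual_fun_measurable hW b.1) measurable_fst).
exact: (measurableT_comp (dual_fun_measurable hW b.2) measurable_snd).
Qed.

Lemma normal_square : (\int[normal_prob 0 (Num.sqrt s)]_x (x ^+ 2)%:E)%E = s%:E.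
Proof.
have [ii E] := normal_x2_cos s0 0.
transitivity (\int[normal_prob 0 (Num.sqrt s)]_x (x ^+ 2 * cos (0 * x)))%:E; last first.
  by rewrite E expr0n /= !mulr0 subr0 mul0r oppr0 expR0 !mulr1.
rewrite /Rintegral fineK; last exact: (integrable_fin_num measurableT ii).
by apply: eq_integral => x _; rewrite /= mul0r cos0 mulr1.
Qed.

Lemma sqnorm_dual_fun (a : H) : D a -> sqnorm (mu s) (L a : BT -> R) = (s * dot a a)%:E.
Proof.
move=> aB; have [->|a0] := eqVneq a 0.
  rewrite (dot0l hH) mulr0 /sqnorm; under eq_integral do rewrite (dual_fun0 hW) expr0n /=.
  by rewrite integral0.
have na : `|a| != 0 by rewrite normr_eq0.
pose v := `|a|^-1 *: a.
have vB : D v by rewrite /v -[_ *: _]addr0; apply: (in_dual_lin hW) => //; exact: (in_dual0 hW).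
have ov : orthonormal_seq dot [:: v].
  move=> [|i] [|j] //= _ _; rewrite /v (dotZl hH) (dotZr hH) (dot_norm hH) mulrA -expr2 -exprMn.
  by rewrite mulVf// expr1n.
have vd : {in [:: v], forall c : H, D c} by move=> w; rewrite inE => /eqP ->.
have mF : measurable_fun setT (fun t : (size [:: v]).-tuple RT => (tnth t ord0 ^+ 2)%:E).
  by apply/measurable_EFinP; apply: measurable_funX; exact: measurable_tnth.
have F0 (t : (size [:: v]).-tuple RT) : (0 <= (tnth t ord0 ^+ 2)%:E)%E by rewrite lee_fin sqr_ge0.
have E := ge0_integral_coords hW s0 ov vd mF F0.
have E2 : (\int[gaussian s (size [:: v])]_t (tnth t ord0 ^+ 2)%:E)%E = s%:E.
  apply: (eq_trans (ge0_integral_gaussianS s mF F0)); rewrite -[RHS]normal_square.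
  apply: eq_integral => x _.
  rewrite (_ : (fun t => _) = cst (x ^+ 2)%:E); last by apply/funext.
  by rewrite integral_cst// [X in (_ * X)%E]probability_setT mule1.
have E3 : sqnorm (mu s) (L v : BT -> R) = s%:E.
  by rewrite -E2 -E; apply: eq_integral => y _; rewrite tnth_mktuple.
have -> : (L a : BT -> R) = (fun y => `|a| * L v y).
  apply/funext => y; have := dual_fun_lin hW `|a| y vB (in_dual0 hW).
  by rewrite (dual_fun0 hW) !addr0 /v scalerA mulfV// scale1r.
rewrite sqnormZ; last exact: (dual_fun_measurable hW v).
by rewrite E3 -EFinM (dot_norm hH) mulrC.
Qed.

Lemma norm_pair a : `|a.1| <= `|a| /\ `|a.2| <= `|a|.
Proof. by rewrite [`|a|]prod_normE !le_max !lexx orbT. Qed.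

Lemma sqnorm_dual_fun2 b : D b.1 -> D b.2 ->
  (sqnorm m2 (dual_fun2 b : BB -> R) <= (4 * s * `|b| ^+ 2)%:E)%E.
Proof.
move=> b1 b2.
have ml (a : H) : measurable_fun setT (L a : BT -> R) := dual_fun_measurable hW a.
have m1' (a : H) : measurable_fun setT (fun x : BB => L a x.1) := measurableT_comp (ml a) measurable_fst.
have m2' (a : H) : measurable_fun setT (fun x : BB => L a x.2) := measurableT_comp (ml a) measurable_snd.
have S1 : sqnorm m2 (fun x : BB => L b.1 x.1) = (s * dot b.1 b.1)%:E.
  rewrite -(sqnorm_dual_fun b1) /sqnorm.
  have mm : measurable_fun setT (fun x : BB => (L b.1 x.1 ^+ 2)%:E).
    by apply/measurable_EFinP; exact: measurable_funX.
  apply: (eq_trans (fubini_tonelli1 _ mm (fun x => _))) => [x|]; first by rewrite lee_fin sqr_ge0.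
  apply: eq_integral => x _; rewrite /fubini_F /=.
  rewrite (_ : (fun y => _) = cst (L b.1 x ^+ 2)%:E)// integral_cst//.
  by rewrite [X in (_ * X)%E]probability_setT mule1.
have S2 : sqnorm m2 (fun x : BB => L b.2 x.2) = (s * dot b.2 b.2)%:E.
  rewrite -(sqnorm_dual_fun b2) /sqnorm.
  have mm : measurable_fun setT (fun x : BB => (L b.2 x.2 ^+ 2)%:E).
    by apply/measurable_EFinP; exact: measurable_funX.
  apply: (eq_trans (fubini_tonelli1 _ mm (fun x => _))) => [x|]; first by rewrite lee_fin sqr_ge0.
  rewrite /fubini_F /= (_ : (fun x => _) = cst (\int[mu s]_y (L b.2 y ^+ 2)%:E)%E)// integral_cst//.
  by rewrite [X in (_ * X)%E]probability_setT mule1.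
apply: (le_trans (sqnormD m2 (m1' b.1) (m2' b.2))).
rewrite S1 S2 -!EFinM -EFinD lee_fin.
have [n1 n2] := norm_pair b; rewrite !(dot_norm hH).
have q1 : `|b.1| ^+ 2 <= `|b| ^+ 2 by rewrite lerXn2r ?nnegrE.
have q2 : `|b.2| ^+ 2 <= `|b| ^+ 2 by rewrite lerXn2r ?nnegrE.
have p1 := ler_wpM2l (ltW s0) q1; have p2 := ler_wpM2l (ltW s0) q2; lra.
Qed.

(** All that is used of ell_a: it is a limit in L^2 of functionals of the dual
    whose vectors tend to [a]. It is stable under linear combinations, unlike
    the choice of a representative. *)
Definition ell_limit a l := measurable_fun setT l /\ exists b : nat -> H * H,
  [/\ forall n, D (b n).1 /\ D (b n).2, b @ \oo --> a &
      sqnorm m2 (fun x => dual_fun2 (b n) x - l x) @[n --> \oo] --> 0%E].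

Lemma ell_limit_dual a : D a.1 -> D a.2 -> ell_limit a (dual_fun2 a).
Proof.
move=> a1 a2; split; first exact: measurable_dual_fun2.
exists (fun=> a); split=> //; first exact: cvg_cst.
rewrite (_ : (fun n => _) = cst 0%E); first exact: cvg_cst.
by apply/funext => n; rewrite /sqnorm; under eq_integral do rewrite subrr expr0n /=; rewrite integral0.
Qed.

Let sqnorm_sub (f g : BB -> R) : measurable_fun setT f -> measurable_fun setT g ->
  sqnorm m2 (fun x : BB => f x - g x) = sqnorm m2 (fun x => g x - f x).
Proof. by move=> mf mg; apply: eq_integral => x _; rewrite -sqrrN opprB. Qed.

(** Vectors of the dual converging geometrically to [a] give functionals
    converging geometrically in square norm. *)
Lemma ell_limit_exists a : exists l, ell_limit a l.
Proof.
have ex (x : H) k : exists2 b, D b & `|x - b| < 2^-1 ^+ k.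
  have e0 : 0 < (2^-1 : R) ^+ k by rewrite exprn_gt0.
  have dd := aw_dual_dense hW.
  have bx : [set y | `|x - y| < 2^-1 ^+ k] x by rewrite /= subrr normr0.
  have [b [xb Db]] := dd _ (ex_intro _ x bx) (open_norm_ball x (2^-1 ^+ k)).
  by exists b => //; exact: xb.
have [b1 hb1] := choice (fun k => let: ex_intro2 b p q := ex a.1 k in ex_intro _ b (conj p q)).
have [b2 hb2] := choice (fun k => let: ex_intro2 b p q := ex a.2 k in ex_intro _ b (conj p q)).
pose b k := (b1 k, b2 k).
have bB k : D (b k).1 /\ D (b k).2 by split; [exact: (hb1 k).1|exact: (hb2 k).1].
have ba k : `|a - b k| <= 2^-1 ^+ k.
  by rewrite prod_normE /= ge_max (ltW (hb1 k).2) (ltW (hb2 k).2).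
have cb : b @ \oo --> a.
  apply/cvgrPdist_le => e e0.
  have g : (2^-1 ^+ k : R) @[k --> \oo] --> (0 : R).
    by apply: cvg_expr; rewrite ger0_norm// invf_lt1// ltr1n.
  near=> k; apply: le_trans (ba k) _.
  have hk : `|0 - 2^-1 ^+ k| <= e by near: k; exact: ((cvgrPdist_le _ _).1 g).
  by apply: le_trans hk; rewrite sub0r normrN; exact: ler_norm.
have mb k := measurable_dual_fun2 (b k).
have C0 : 0 <= 16 * s by rewrite mulr_ge0// ltW.
have hC k : (sqnorm m2 (fun x => dual_fun2 (b k.+1) x - dual_fun2 (b k) x)%R <=
    (16 * s * 2^-1 ^+ k * 2^-1 ^+ k)%:E)%E.
  have [d1 d2] := bB k; have [d3 d4] := bB k.+1.
  have -> : (fun x : BB => dual_fun2 (b k.+1) x - dual_fun2 (b k) x) = dual_fun2 (-1 *: b k + b k.+1).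
    by apply/funext => x; rewrite dual_fun2_lin// mulN1r addrC.
  apply: (le_trans (sqnorm_dual_fun2 _ _)); do ?[by apply: (in_dual_lin hW)].
  rewrite lee_fin -[leRHS]mulrA -expr2 (_ : 16 * s * (2^-1 ^+ k) ^+ 2 = 4 * s * (2 * 2^-1 ^+ k) ^+ 2); last by ring.
  apply: ler_wpM2l; first by rewrite mulr_ge0// ltW.
  rewrite lerXn2r ?nnegrE ?mulr_ge0 ?exprn_ge0//.
  rewrite scaleN1r (_ : - b k + b k.+1 = (a - b k) - (a - b k.+1)); last first.
    by rewrite opprB [RHS]addrC addrA subrK addrC.
  apply: (le_trans (ler_normB _ _)); rewrite mulr_natl mulr2n lerD//.
  apply: (le_trans (ba _)); rewrite exprS ler_piMl ?exprn_ge0//.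
  by rewrite invf_le1 ?ler1n.
have [l [ml hl]] := riesz_fischer mb C0 hC.
by exists l; split=> //; exists b.
Unshelve. all: by end_near. Qed.

Local Notation ell2 := (ell (V := (H * H)%type) (T := BB) dual2 m2).

Lemma ell_limit_ell a : ell_limit a (ell2 a).
Proof.
have [hd|nd] := pselect (exists phi, dual2 a phi).
  have : is_ell (V := (H * H)%type) (T := BB) dual2 m2 a (ell2 a).
    by case: hd => phi hp; rewrite /ell; apply: xgetPex; exists phi; left.
  case; last by case.
  by move=> /dual_pair2E[a1 a2 ->]; exact: ell_limit_dual.
have [l [ml [b [bB ba bl]]]] := ell_limit_exists a.
have : is_ell (V := (H * H)%type) (T := BB) dual2 m2 a (ell2 a).
  rewrite /ell; apply: xgetPex; exists l; right; split=> //; split=> //.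
  exists b, (fun n => dual_fun2 (b n)); split=> //.
    by move=> n; have [? ?] := bB n; exact: dual_pair2P.
  have key := (Lnorm2_cvg0 m2 (fun n (x : BB) => dual_fun2 (b n) x - l x)).2 bl.
  exact: key.
case=> [hp|]; first by case: nd; exists (ell2 a).
move=> [_ [ml' [b' [phi [hphi b'a hl]]]]]; split=> //; exists b'; split=> //.
  by move=> n; have [? ? _] := dual_pair2E (hphi n).
have -> : (fun n => sqnorm m2 (fun x => dual_fun2 (b' n) x - ell2 a x)%R) =
    (fun n => sqnorm m2 (fun x => phi n x - ell2 a x)%R).
  by apply/funext => n; have [_ _ ->] := dual_pair2E (hphi n).
exact: ((Lnorm2_cvg0 _ (fun n x => phi n x - ell2 a x)).1 hl).
Qed.

Lemma ell_limit_lin c a a' l l' : ell_limit a l -> ell_limit a' l' ->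
  ell_limit (c *: a + a') (fun x => c * l x + l' x).
Proof.
move=> [ml [b [bB ba bl]]] [ml' [b' [bB' ba' bl']]]; split.
  by apply: measurable_funD => //; exact: measurable_funM.
exists (fun n => c *: b n + b' n); split.
- move=> n; have [? ?] := bB n; have [? ?] := bB' n.
  by split; apply: (in_dual_lin hW).
- by apply: cvgD => //; apply: cvgZr.
apply/cvge0P => [n|e e0]; first exact: sqnorm_ge0.
have e1 : 0 < e / (4 * (c ^+ 2 + 1)) by rewrite divr_gt0// mulr_gt0// ltr_wpDl ?sqr_ge0.
have e2 : 0 < e / 4 by rewrite divr_gt0.
have h1 := (cvge0P (fun n => sqnorm_ge0 _ _)).1 bl _ e1.
have h2 := (cvge0P (fun n => sqnorm_ge0 _ _)).1 bl' _ e2.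
near=> n.
have q1 : (sqnorm m2 (fun x => dual_fun2 (b n) x - l x)%R <= (e / (4 * (c ^+ 2 + 1)))%:E)%E by near: n.
have q2 : (sqnorm m2 (fun x => dual_fun2 (b' n) x - l' x)%R <= (e / 4)%:E)%E by near: n.
have [d1 d2] := bB n; have [d3 d4] := bB' n.
have m1 := measurable_funB (measurable_dual_fun2 (b n)) ml.
have m1' := measurable_funB (measurable_dual_fun2 (b' n)) ml'.
rewrite (_ : (fun x => _) = (fun x : BB => c * (dual_fun2 (b n) x - l x) + (dual_fun2 (b' n) x - l' x))); last first.
  by apply/funext => x; rewrite dual_fun2_lin//; ring.
apply: (le_trans (sqnormD _ _ _)) => //; first exact: measurable_funM.
rewrite sqnormZ//; apply: (@le_trans _ _ (2%:E * ((c ^+ 2)%:E * (e / (4 * (c ^+ 2 + 1)))%:E) + 2%:E * (e / 4)%:E)%E).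
  apply: leeD; apply: lee_wpmul2l => //.
  by apply: lee_wpmul2l => //; rewrite lee_fin sqr_ge0.
rewrite -!EFinM -EFinD lee_fin.
have -> : 2 * (c ^+ 2 * (e / (4 * (c ^+ 2 + 1)))) = e / 2 * (c ^+ 2 / (c ^+ 2 + 1)).
  by field; rewrite gt_eqF// ltr_wpDl ?sqr_ge0.
have : c ^+ 2 / (c ^+ 2 + 1) <= 1 by rewrite ler_pdivrMr ?mul1r ?lerDl// ltr_wpDl ?sqr_ge0.
move=> /(ler_wpM2l (ltW (divr_gt0 e0 (@ltr0Sn R 1)))); lra.
Unshelve. all: by end_near. Qed.

Lemma ell_limit_sum (u : seq (H * H)) (c : nat -> R) n :
  ell_limit (\sum_(i < n) c i *: u`_i) (fun x => \sum_(i < n) c i * ell2 u`_i x).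
Proof.
elim: n => [|n IH].
  rewrite big_ord0 (_ : (fun x => _) = dual_fun2 0).
    by apply: ell_limit_dual; exact: (in_dual0 hW).
  by apply/funext => x; rewrite big_ord0 /dual_fun2 /= !(dual_fun0 hW) addr0.
rewrite big_ord_recr /= addrC.
rewrite (_ : (fun x => _) = (fun x => c n * ell2 u`_n x + \sum_(i < n) c i * ell2 u`_i x)).
  by apply: ell_limit_lin => //; exact: ell_limit_ell.
by apply/funext => x; rewrite big_ord_recr /= addrC.
Qed.

(** The isometry property up to a constant, by passing to the limit in
    [sqnorm_dual_fun2]. *)
Lemma ell_limit_small a l (dl : R) : 0 < dl -> ell_limit a l -> `|a| < dl ->
  (sqnorm m2 l <= (8 * s * dl ^+ 2 + 2 * dl)%:E)%E.
Proof.
move=> d0 [ml [b [bB ba bl]]] adl.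
have h1 := (cvge0P (fun n => sqnorm_ge0 _ _)).1 bl _ d0.
have h2 : \forall n \near \oo, `|b n| < dl.
  have r0 : 0 < dl - `|a| by rewrite subr_gt0.
  near=> n; have hn : `|a - b n| < dl - `|a| by near: n; exact: ((cvgrPdist_lt _ _).1 ba).
  rewrite -[b n](subrK a) (le_lt_trans (ler_normD _ _))// distrC -ltrBrDr//.
have : \forall n \near \oo, (sqnorm m2 l <= (8 * s * dl ^+ 2 + 2 * dl)%:E)%E.
  near=> n.
  have q1 : (sqnorm m2 (fun x => dual_fun2 (b n) x - l x)%R <= dl%:E)%E by near: n.
  have q2 : `|b n| < dl by near: n.
  have [d1 d2] := bB n.
  have m1 := measurable_dual_fun2 (b n).
  rewrite (_ : l = (fun x : BB => (l x - dual_fun2 (b n) x) + dual_fun2 (b n) x)); last first.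
    by apply/funext => x; rewrite subrK.
  apply: (le_trans (sqnormD _ _ _)) => //; first exact: measurable_funB.
  rewrite (sqnorm_sub ml m1).
  apply: (@le_trans _ _ (2%:E * dl%:E + 2%:E * (4 * s * `|b n| ^+ 2)%:E)%E).
    by apply: leeD; apply: lee_wpmul2l => //; exact: sqnorm_dual_fun2.
  rewrite -!EFinM -EFinD lee_fin.
  have : `|b n| ^+ 2 <= dl ^+ 2 by rewrite lerXn2r ?nnegrE ?(ltW q2) ?(ltW d0).
  move=> /(ler_wpM2l (ltW s0)); lra.
by case=> N _ /(_ N (leqnn N)).
Unshelve. all: by end_near. Qed.

Let dot2_lin c x y z : dot2 dot (c *: x + y) z = c * dot2 dot x z + dot2 dot y z.
Proof. by rewrite /dot2 /= !(dotDl hH) !(dotZl hH); ring. Qed.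

Let dot2C x y : dot2 dot x y = dot2 dot y x.
Proof. by rewrite /dot2 (dotC hH x.1) (dotC hH x.2). Qed.

Let dot2_sum (u : seq (H * H)) (c : nat -> R) n z :
  dot2 dot (\sum_(i < n) c i *: u`_i) z = \sum_(i < n) c i * dot2 dot u`_i z.
Proof.
elim: n => [|n IH]; first by rewrite !big_ord0 /dot2 /= !(dot0l hH) addr0.
by rewrite !big_ord_recr /= addrC dot2_lin IH addrC.
Qed.

Let coef (u : seq (H * H)) a (i : nat) := dot2 dot a u`_i.

Lemma norm_dot2 x : `|x| ^+ 2 <= dot2 dot x x <= 2 * `|x| ^+ 2.
Proof.
rewrite /dot2 !(dot_norm hH); have [n1 n2] := norm_pair x.
have q1 : `|x.1| ^+ 2 <= `|x| ^+ 2 by rewrite lerXn2r ?nnegrE.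
have q2 : `|x.2| ^+ 2 <= `|x| ^+ 2 by rewrite lerXn2r ?nnegrE.
apply/andP; split; last by lra.
rewrite prod_normE; case: (leP `|x.1| `|x.2|) => _; first by rewrite lerDr sqr_ge0.
by rewrite lerDl sqr_ge0.
Qed.

(** The projection is the best approximation for the scalar product, which is
    equivalent to the norm of the product space up to a factor two. *)
Lemma best_approximation (u : seq (H * H)) a x : orthonormal_seq (dot2 dot) u -> fspan u x ->
  `|\sum_(i < size u) coef u a i *: u`_i - a| ^+ 2 <= 2 * `|x - a| ^+ 2.
Proof.
move=> ou [t _ <-]; set P := \sum_(i < _) _.
have dP (i : 'I_(size u)) : dot2 dot (P - a) u`_i = 0.
  rewrite addrC -scaleN1r dot2_lin dot2_sum mulN1r.
  rewrite (bigD1 i)//= ou// eqxx mulr1 big1 ?addr0 ?addNr// => j ji.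
  by rewrite ou// (negPf (ji : val j != val i)) mulr0.
have dx : dot2 dot (lincomb t - P) (P - a) = 0.
  have -> : lincomb t - P = \sum_(i < size u) (fun k => nth 0 t k - coef u a k) i *: u`_i.
    rewrite /lincomb /P -sumrB; apply: eq_bigr => i _.
    by rewrite scalerBl (tnth_nth 0).
  by rewrite (dot2_sum u (fun k => nth 0 t k - coef u a k)) big1// => i _; rewrite dot2C dP mulr0.
have /andP[h1 _] := norm_dot2 (P - a); apply: (le_trans h1).
have /andP[_ h2] := norm_dot2 (lincomb t - a); apply: le_trans h2.
have sq (v w : H * H) : dot2 dot (v + w) (v + w) = dot2 dot v v + 2 * dot2 dot v w + dot2 dot w w.
  by rewrite /dot2 /= !(dotDl hH, dotDr hH) (dotC hH w.1) (dotC hH w.2); ring.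
have -> : lincomb t - a = (lincomb t - P) + (P - a) by rewrite addrA subrK.
rewrite (sq (lincomb t - P) (P - a)) dx mulr0 addr0 lerDr.
have /andP[p1 _] := norm_dot2 (lincomb t - P); exact: le_trans (sqr_ge0 _) p1.
Qed.

Variables (e : nat -> H) (ks : seq (R * (R * R))).
Hypothesis eB : D (e 0%N).

Definition cos_extension (x : B * B) : R :=
  \sum_(k <- ks) k.1 * cos (k.2.1 * L (e 0%N) x.1 + k.2.2 * L (e 0%N) x.2).

Let wave (p q : BB -> R) x := \sum_(k <- ks) k.1 * cos (k.2.1 * p x + k.2.2 * q x).

Let wave_measurable p q : measurable_fun setT p -> measurable_fun setT q ->
  measurable_fun setT (wave p q).
Proof.
move=> mp mq; apply: measurable_sum => k; apply: measurable_funM => //.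
apply: measurable_cos_comp; apply: measurable_funD; exact: measurable_funM.
Qed.

Let wave_bounded p q x : `|wave p q x| <= \sum_(k <- ks) `|k.1|.
Proof.
apply: (le_trans (ler_norm_sum _ _ _)); apply: ler_sum => k _.
by rewrite normrM ler_piMr// ler_norml cos_geN1 cos_le1.
Qed.

Let wave_Lfun p q : measurable_fun setT p -> measurable_fun setT q -> wave p q \in Lfun m2 2%:E.
Proof. by move=> mp mq; exact: (bounded_Lfun m2 (wave_measurable mp mq) (wave_bounded p q)). Qed.

Let K := \sum_(k <- ks) `|k.1| * (`|k.2.1| + `|k.2.2|).

Let K0 : 0 <= K. Proof. by apply: sumr_ge0 => k _; rewrite mulr_ge0// addr_ge0. Qed.

Let wave_lipschitz p q p' q' x : `|wave p q x - wave p' q' x| <=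
  K * `|p x - p' x| + K * `|q x - q' x|.
Proof.
rewrite /wave -sumrB -mulrDr mulr_suml; apply: (le_trans (ler_norm_sum _ _ _)).
apply: ler_sum => k _; rewrite -mulrBr normrM -mulrA; apply: ler_wpM2l => //.
apply: (le_trans (cos_lipschitz _ _)).
rewrite (_ : _ - _ = k.2.1 * (p x - p' x) + k.2.2 * (q x - q' x)); last by ring.
apply: (le_trans (ler_normD _ _)); rewrite !normrM mulrDl.
by apply: lerD; apply: ler_wpM2l => //; [rewrite lerDl|rewrite lerDr].
Qed.

Local Notation tpi2 := (tpi (V := (H * H)%type) (T := BB) dual2 m2).

(** On the subspace [E n] the linear form is the ell of the projection of its
    vector. Projections converge by [best_approximation], so the square norm
    of the difference tends to zero by [ell_limit_small]; sums of waves are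
    bounded and Lipschitz in the two linear forms. *)
Theorem cos_symbol_extension : stochastic_extension2 dot inc mu s 2 (cos_symbol dot e ks) cos_extension.
Proof.
pose w1 : H * H := (e 0%N, 0); pose w2 : H * H := (0, e 0%N).
have m1 := measurableT_comp (dual_fun_measurable hW (e 0%N)) (@measurable_fst _ _ BT BT).
have m2' := measurableT_comp (dual_fun_measurable hW (e 0%N)) (@measurable_snd _ _ BT BT).
split; first exact: (wave_Lfun m1 m2').
move=> E oE EE dE.
pose Q w n (y : BB) := \sum_(i < size (E n)) coef (E n) w i * ell2 (E n)`_i y.
have EQ w n := ell_limit_sum (E n) (coef (E n) w) (size (E n)).
have mQ w n : measurable_fun setT (Q w n) by exact: (EQ w n).1.
have FE n : (cos_symbol dot e ks \o tpi2 (E n)) = wave (Q w1 n) (Q w2 n).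
  apply/funext => y; rewrite /= /cos_symbol /wave; apply: eq_bigr => k _.
  have q w : Q w n y = dot2 dot (tpi2 (E n) y) w.
    rewrite /tpi (dot2_sum (E n) (fun i => ell2 (E n)`_i y)).
    by apply: eq_bigr => i _; rewrite mulrC dot2C.
  rewrite /wave_form !q /dot2 /= !(dot0r hH) addr0 add0r.
  by rewrite (dotC hH (tpi _ _ _ _).1) (dotC hH (tpi _ _ _ _).2).
split=> [n|]; first by rewrite FE; exact: wave_Lfun.
apply: (Lnorm2_cvg0 m2 (fun n x => (cos_symbol dot e ks \o tpi2 (E n)) x - cos_extension x)).2.
apply/cvge0P => [n|eps eps0]; first exact: sqnorm_ge0.
have k0 : 0 < 4 * K ^+ 2 * (8 * s + 2) + 1.
  by rewrite ltr_wpDl// !mulr_ge0 ?sqr_ge0// addr_ge0// mulr_ge0// ltW.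
(* chosen such that 4 K^2 (8 s dl^2 + 2 dl) <= eps *)
pose dl := Num.min 1 (eps / (4 * K ^+ 2 * (8 * s + 2) + 1)).
have d0 : 0 < dl by rewrite lt_min ltr01 divr_gt0.
have near_w w : \forall n \near \oo,
    `|-1 *: w + \sum_(i < size (E n)) coef (E n) w i *: (E n)`_i| < dl.
  have d20 : 0 < dl / 2 by rewrite divr_gt0.
  have bx : [set y | `|w - y| < dl / 2] w by rewrite /= subrr normr0.
  have [x [xw [N _ xN]]] := dE _ (ex_intro _ w bx) (open_norm_ball w (dl / 2)).
  near=> n.
  have Nn : (N <= n)%N by near: n; exists N.
  have xn : fspan (E n) x.
    by have := Nn; elim: (n) => [|j IH]; [rewrite leqn0 => /eqP <-|
      rewrite leq_eqVlt => /predU1P[<-//|/IH]; exact: EE].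
  have := best_approximation w (oE n) xn.
  rewrite scaleN1r addrC -(@ltr_pXn2r _ 2)// ?nnegrE ?(ltW d0)// => hb.
  apply: (le_lt_trans hb); rewrite distrC.
  have : `|w - x| ^+ 2 < (dl / 2) ^+ 2 by rewrite ltr_pXn2r ?nnegrE ?(ltW d20).
  have : 0 < dl ^+ 2 by rewrite exprn_gt0.
  by rewrite expr_div_n; lra.
have near1 := near_w w1; have near2 := near_w w2.
near=> n.
have small w l : ell_limit w l -> `|-1 *: w + \sum_(i < size (E n)) coef (E n) w i *: (E n)`_i| < dl ->
    (sqnorm m2 (fun x => Q w n x - l x)%R <= (8 * s * dl ^+ 2 + 2 * dl)%:E)%E.
  move=> wl hn; have := ell_limit_small d0 (ell_limit_lin (-1) wl (EQ w n)) hn.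
  by congr (sqnorm _ _ <= _)%E; apply/funext => x; rewrite mulN1r addrC.
have l1 : ell_limit w1 (fun x : BB => L (e 0%N) x.1).
  have := ell_limit_dual (a := w1) eB (in_dual0 hW).
  by congr ell_limit; apply/funext => x; rewrite /dual_fun2 /= (dual_fun0 hW) addr0.
have l2 : ell_limit w2 (fun x : BB => L (e 0%N) x.2).
  have := ell_limit_dual (a := w2) (in_dual0 hW) eB.
  by congr ell_limit; apply/funext => x; rewrite /dual_fun2 /= (dual_fun0 hW) add0r.
have s1 := small _ _ l1 (near near1 n _); have s2 := small _ _ l2 (near near2 n _).
have mn w (l : BB -> R) : measurable_fun setT l -> measurable_fun setT (fun x => K * `|Q w n x - l x|).
  by move=> ml; apply: measurable_funM => //; apply: measurableT_comp => //; exact: measurable_funB.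
have sn w (l : BB -> R) : measurable_fun setT l ->
    sqnorm m2 (fun x => K * `|Q w n x - l x|) = ((K ^+ 2)%:E * sqnorm m2 (fun x => Q w n x - l x)%R)%E.
  move=> ml; rewrite sqnormZ; last by apply: measurableT_comp => //; exact: measurable_funB.
  by congr (_ * _)%E; apply: eq_integral => x _; rewrite real_normK// num_real.
apply: (@le_trans _ _ (sqnorm m2 (fun x => K * `|Q w1 n x - L (e 0%N) x.1| + K * `|Q w2 n x - L (e 0%N) x.2|))).
  apply: le_sqnorm.
  - rewrite FE; apply: measurable_funB; first exact: wave_measurable.
    exact: (wave_measurable m1 m2').
  - by apply: measurable_funD; exact: mn.
  move=> x; rewrite FE; apply: le_trans (ler_norm _).
  exact: (wave_lipschitz (Q w1 n) (Q w2 n) (fun x => L (e 0%N) x.1) (fun x => L (e 0%N) x.2) x).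
apply: (le_trans (sqnormD m2 (mn _ _ m1) (mn _ _ m2'))).
rewrite (sn _ _ m1) (sn _ _ m2').
apply: (@le_trans _ _ (2%:E * ((K ^+ 2)%:E * (8 * s * dl ^+ 2 + 2 * dl)%:E) +
    2%:E * ((K ^+ 2)%:E * (8 * s * dl ^+ 2 + 2 * dl)%:E))%E).
  have kk : (0 <= (K ^+ 2)%:E)%E by rewrite lee_fin sqr_ge0.
  have t0 : (0 <= (2 : R)%:E)%E by rewrite lee_fin.
  apply: leeD.
    by apply: lee_wpmul2l => //; apply: lee_wpmul2l => //; exact: s1.
  by apply: lee_wpmul2l => //; apply: lee_wpmul2l => //; exact: s2.
rewrite -!EFinM -EFinD lee_fin.
have d1 : dl <= 1 by rewrite ge_min lexx.
have d2 : dl * (4 * K ^+ 2 * (8 * s + 2) + 1) <= eps.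
  by rewrite -ler_pdivlMr// ge_min lexx orbT.
apply: le_trans d2.
have dd : dl ^+ 2 <= dl by rewrite expr2 ler_piMl// ltW.
have k2 : 0 <= K ^+ 2 * s by rewrite mulr_ge0 ?sqr_ge0// ltW.
have := ler_wpM2l k2 dd; have := sqr_ge0 K; have := ltW d0.
set a := K ^+ 2; set b := dl ^+ 2; move=> q1 q2 q3.
apply: (@le_trans _ _ (32 * (a * s * b) + 8 * a * dl)).
  by rewrite le_eqVlt; apply/orP; left; apply/eqP; ring.
apply: (@le_trans _ _ (32 * (a * s * dl) + 8 * a * dl + dl)); first by lra.
by rewrite le_eqVlt; apply/orP; left; apply/eqP; ring.
Unshelve. all: by end_near. Qed.

End extension.

(** * Complex-valued functions in L^2 *)

Section complex_parts.
Context {R : realType}.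
Local Notation C := (complex R).
Local Notation Re := (@complex.Re R).
Local Notation Im := (@complex.Im R).
Local Notation normc := (@complex.ComplexField.Normc.normc R).

Lemma ReM (x y : C) : Re (x * y) = Re x * Re y - Im x * Im y. Proof. by case: x y => [a b] [c d]. Qed.
Lemma ImM (x y : C) : Im (x * y) = Re x * Im y + Im x * Re y. Proof. by case: x y => [a b] [c d]. Qed.
Lemma ReD (x y : C) : Re (x + y) = Re x + Re y. Proof. by case: x y => [a b] [c d]. Qed.
Lemma ImD (x y : C) : Im (x + y) = Im x + Im y. Proof. by case: x y => [a b] [c d]. Qed.
Lemma ReC (x : C) : Re (x^*) = Re x. Proof. by case: x. Qed.
Lemma ImC (x : C) : Im (x^*) = - Im x. Proof. by case: x. Qed.
Lemma eqC (x y : C) : Re x = Re y -> Im x = Im y -> x = y.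
Proof. by case: x y => [a b] [c d] /= -> ->. Qed.
Lemma Re_sum (I : Type) (r : seq I) (F : I -> C) : Re (\sum_(i <- r) F i) = \sum_(i <- r) Re (F i).
Proof. exact: (big_morph Re ReD). Qed.
Lemma Im_sum (I : Type) (r : seq I) (F : I -> C) : Im (\sum_(i <- r) F i) = \sum_(i <- r) Im (F i).
Proof. exact: (big_morph Im ImD). Qed.
Lemma normc_sqr (x : C) : normc x ^+ 2 = Re x ^+ 2 + Im x ^+ 2.
Proof. by case: x => a b; rewrite /= sqr_sqrtr// addr_ge0// sqr_ge0. Qed.
Lemma normc_triangle (x y : C) : normc (x + y) <= normc x + normc y.
Proof.
rewrite -ler_sqr ?nnegrE ?addr_ge0 ?sqrtr_ge0//; do ?by case: (x) (y) (x + y) => [? ?] [? ?] [? ?]; rewrite ?addr_ge0 ?sqrtr_ge0.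
rewrite sqrrD !normc_sqr ReD ImD.
have h : Re x * Re y + Im x * Im y <= normc x * normc y.
  have n0 : 0 <= normc x * normc y by case: (x) (y) => [? ?] [? ?]; rewrite mulr_ge0 ?sqrtr_ge0.
  have [le0|gt0] := leP (Re x * Re y + Im x * Im y) 0; first exact: le_trans le0 n0.
  rewrite -ler_sqr ?nnegrE ?(ltW gt0)// exprMn !normc_sqr.
  have := sqr_ge0 (Re x * Im y - Im x * Re y); set a := Re x; set b := Im x; set c := Re y; set d := Im y.
  by rewrite -subr_ge0; congr (0 <= _); ring.
rewrite -mulr_natr; lra.
Qed.
Lemma normc_nneg (x : C) : 0 <= normc x.
Proof. by case: x => a b; exact: sqrtr_ge0. Qed.

End complex_parts.

Section complex_integral.
Context d (T : measurableType d) (R : realType) (m : probability T R).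
Local Notation C := (complex R).
Local Notation Re := (@complex.Re R).
Local Notation Im := (@complex.Im R).
Local Notation normc := (@complex.ComplexField.Normc.normc R).
Implicit Types f g : T -> C.

Definition cmeasurable f := measurable_fun setT (Re \o f) /\ measurable_fun setT (Im \o f).
Definition cintegrable f := m.-integrable setT (EFin \o (Re \o f)) /\ m.-integrable setT (EFin \o (Im \o f)).

Lemma Rintegral_sum (I : Type) (r : seq I) (c : I -> R) (F : I -> T -> R) :
  (forall i, m.-integrable setT (EFin \o F i)) ->
  m.-integrable setT (EFin \o (fun x => \sum_(i <- r) c i * F i x)) /\
  \int[m]_x (\sum_(i <- r) c i * F i x) = \sum_(i <- r) c i * \int[m]_x F i x.
Proof.
move=> Fi; elim: r => [|i r [IH1 IH2]].
  rewrite big_nil (_ : (fun x => _) = cst 0); last by apply/funext => x; rewrite big_nil.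
  by split; [exact: finite_measure_integrable_cst|rewrite Rintegral_cst// mul0r].
have ci := integrableZl_fin (c i) (Fi i).
rewrite big_cons (_ : (fun x => _) = (fun x => c i * F i x + \sum_(j <- r) c j * F j x)); last first.
  by apply/funext => x; rewrite big_cons.
split; first by have := integrableD measurableT ci IH1; exact.
by rewrite (RintegralD measurableT ci IH1) (RintegralZl _ measurableT (Fi i)) IH2.
Qed.

Lemma cintegral_sum (I : Type) (r : seq I) (c : I -> R) (F : I -> T -> C) :
  (forall i, cintegrable (F i)) ->
  cintegral m (fun x => \sum_(i <- r) (c i)%:C%C * F i x) = \sum_(i <- r) (c i)%:C%C * cintegral m (F i).
Proof.
move=> Fi; have [_ r1] := Rintegral_sum r c (fun i => (Fi i).1).
have [_ r2] := Rintegral_sum r c (fun i => (Fi i).2).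
apply: eqC.
  rewrite Re_sum /=; under [RHS]eq_bigr do rewrite /= mul0r subr0.
  rewrite -[RHS]r1; apply: eq_Rintegral => x _; rewrite Re_sum.
  by apply: eq_bigr => i _; rewrite ReM /= mul0r subr0.
rewrite Im_sum /=; under [RHS]eq_bigr do rewrite /= mul0r addr0.
rewrite -[RHS]r2; apply: eq_Rintegral => x _; rewrite Im_sum.
by apply: eq_bigr => i _; rewrite ImM /= mul0r addr0.
Qed.

(** The square of the L^2 norm of a complex function. *)
Definition csq f := sqnorm m (normc \o f).

Lemma csqE f : csq f = (\int[m]_x (Re (f x) ^+ 2 + Im (f x) ^+ 2)%:E)%E.
Proof. by apply: eq_integral => x _; rewrite /= normc_sqr. Qed.

Lemma cmeasurable_normc f : cmeasurable f -> measurable_fun setT (normc \o f).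
Proof.
move=> [m1 m2]; rewrite (_ : _ \o _ = (fun x => Num.sqrt (Re (f x) ^+ 2 + Im (f x) ^+ 2))); last first.
  by apply/funext => x /=; case: (f x).
apply: (@measurableT_comp _ _ _ _ _ _ (@Num.sqrt R)).
  by apply: continuous_measurable_fun; exact: sqrt_continuous.
by apply: measurable_funD; exact: measurable_funX.
Qed.

Lemma cL2P f : cL2 m f <-> cmeasurable f /\ (csq f < +oo)%E.
Proof.
have le1 : cmeasurable f -> (sqnorm m (Re \o f) <= csq f)%E /\ (sqnorm m (Im \o f) <= csq f)%E.
  move=> mf; have mn := cmeasurable_normc mf; have [m1 m2] := mf.
  split; apply: le_sqnorm => // x; rewrite -ler_sqr ?nnegrE// real_normK ?num_real//= ger0_norm ?normc_nneg//;
    by rewrite normc_sqr ?lerDl ?lerDr sqr_ge0.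
split.
  move=> [/Lfun_sqnorm[m1 s1] /Lfun_sqnorm[m2 s2]]; split=> //.
  have e1 : measurable_fun setT (fun x => (Re (f x) ^+ 2)%:E) by apply/measurable_EFinP; exact: measurable_funX.
  have e2 : measurable_fun setT (fun x => (Im (f x) ^+ 2)%:E) by apply/measurable_EFinP; exact: measurable_funX.
  rewrite csqE; under eq_integral do rewrite EFinD.
  rewrite ge0_integralD//; first exact: lte_add_pinfty.
    by move=> x _; rewrite lee_fin sqr_ge0.
  by move=> x _; rewrite lee_fin sqr_ge0.
move=> [mf s]; have [l1 l2] := le1 mf; have [m1 m2] := mf.
by split; apply: sqnorm_Lfun => //; [exact: le_lt_trans l1 s|exact: le_lt_trans l2 s].
Qed.

Lemma cL2norm_le f g (M : R) : 0 <= M -> cL2 m f -> (csq g <= M%:E * csq f)%E ->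
  (cL2norm m g <= (Num.sqrt M)%:E * cL2norm m f)%E.
Proof.
move=> M0 /cL2P[mf sf] h.
have key (N : \bar R) : (0 <= N)%E -> (N `^ 2 = csq f)%E -> (cL2norm m g <= (Num.sqrt M)%:E * N)%E.
  case: N => [n n0 E|_ E|//]; last by move: sf; rewrite -E poweRyr// ltxx.
  rewrite -EFinM; apply: (Lnorm2_le m (normc \o g) (mulr_ge0 (sqrtr_ge0 _) n0)).2.
  rewrite -/(csq g) exprMn sqr_sqrtr// EFinM; apply: (le_trans h).
  by rewrite -E poweR_EFin powR_mulrn.
by apply: key; [exact: Lnorm_ge0|exact: (Lnorm2_sqnorm m (normc \o f))].
Qed.

Lemma csqD f g : cmeasurable f -> cmeasurable g ->
  (csq (fun x => f x + g x)%R <= 2%:E * csq f + 2%:E * csq g)%E.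
Proof.
move=> mf mg; apply: (le_trans _ (sqnormD m (cmeasurable_normc mf) (cmeasurable_normc mg))).
have mfg : cmeasurable (fun x => f x + g x).
  by split; [rewrite (_ : _ \o _ = (Re \o f) \+ (Re \o g))|rewrite (_ : _ \o _ = (Im \o f) \+ (Im \o g))];
    do ?[by apply/funext => x /=; rewrite ?ReD ?ImD];
    apply: measurable_funD; do ?[exact: mf.1|exact: mf.2|exact: mg.1|exact: mg.2].
apply: le_sqnorm; first exact: cmeasurable_normc.
  by apply: measurable_funD; exact: cmeasurable_normc.
move=> x /=; rewrite !ger0_norm ?addr_ge0 ?normc_nneg//.
exact: normc_triangle.
Qed.

Lemma cmeasurableD f g : cmeasurable f -> cmeasurable g -> cmeasurable (fun x => f x + g x).
Proof.
move=> [f1 f2] [g1 g2]; split.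
  rewrite (_ : _ \o _ = (Re \o f) \+ (Re \o g)); first exact: measurable_funD.
  by apply/funext => x /=; rewrite ReD.
rewrite (_ : _ \o _ = (Im \o f) \+ (Im \o g)); first exact: measurable_funD.
by apply/funext => x /=; rewrite ImD.
Qed.

Lemma cmeasurableM f g : cmeasurable f -> cmeasurable g -> cmeasurable (fun x => f x * g x).
Proof.
move=> [f1 f2] [g1 g2]; split.
  rewrite (_ : _ \o _ = (fun x => Re (f x) * Re (g x) - Im (f x) * Im (g x))).
    by apply: measurable_funB; exact: measurable_funM.
  by apply/funext => x /=; rewrite ReM.
rewrite (_ : _ \o _ = (fun x => Re (f x) * Im (g x) + Im (f x) * Re (g x))).
  by apply: measurable_funD; exact: measurable_funM.
by apply/funext => x /=; rewrite ImM.
Qed.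

Lemma cmeasurableC f : cmeasurable f -> cmeasurable (fun x => (f x)^*).
Proof.
move=> [f1 f2]; split.
  by rewrite (_ : _ \o _ = Re \o f)//; apply/funext => x /=; rewrite ReC.
rewrite (_ : _ \o _ = (fun x => - Im (f x))); first exact: measurableT_comp.
by apply/funext => x /=; rewrite ImC.
Qed.

Lemma cmeasurable_expi (p : T -> R) : measurable_fun setT p -> cmeasurable (fun x => expi (p x)).
Proof.
move=> mp; split; first exact: measurable_cos_comp.
rewrite (_ : _ \o _ = (fun x => cos (p x - pi / 2))); last first.
  by apply/funext => x /=; rewrite cos_subpihalf.
by apply: measurable_cos_comp; exact: measurable_funB.
Qed.

Lemma cmeasurable_real (p : T -> R) : measurable_fun setT p -> cmeasurable (fun x => (p x)%:C%C).
Proof. by move=> mp; split; [exact: mp|exact: measurable_cst]. Qed.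

Lemma cintegralZ (a : C) f : cintegrable f ->
  cintegrable (fun x => a * f x) /\ cintegral m (fun x => a * f x) = a * cintegral m f.
Proof.
move=> [i1 i2].
have j1 := integrableZl_fin (Re a) i1; have j2 := integrableZl_fin (Im a) i2.
have k1 := integrableZl_fin (Re a) i2; have k2 := integrableZl_fin (Im a) i1.
have e1 : Re \o (fun x => a * f x) = (fun x => Re a * Re (f x) - Im a * Im (f x)).
  by apply/funext => x; rewrite /= ReM.
have e2 : Im \o (fun x => a * f x) = (fun x => Re a * Im (f x) + Im a * Re (f x)).
  by apply/funext => x; rewrite /= ImM.
split.
  by rewrite /cintegrable e1 e2; split;
    [have := integrableB measurableT j1 j2; exact|have := integrableD measurableT k1 k2; exact].
apply: eqC.
  rewrite ReM /= -(RintegralZl _ measurableT i1) -(RintegralZl _ measurableT i2).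
  rewrite -(RintegralB measurableT j1 j2); apply: eq_Rintegral => x _; by rewrite ReM.
rewrite ImM /= -(RintegralZl _ measurableT i1) -(RintegralZl _ measurableT i2).
rewrite -(RintegralD measurableT k1 k2); apply: eq_Rintegral => x _; by rewrite ImM.
Qed.

End complex_integral.

(** * Weyl translations and the Weyl operator of a sum of waves *)

Section weyl_translation.
Context {R : realType} {H B : completeNormedModType R}.
Variables (dot : H -> H -> R) (inc : H -> B) (mu : R -> probability (borelType B) R).
Hypothesis hW : abstract_wiener dot inc mu.
Local Notation C := (complex R).
Local Notation Re := (@complex.Re R).
Local Notation Im := (@complex.Im R).
Local Notation BT := (borelType B).
Local Notation RT := (measurableTypeR R).
Local Notation L := (dual_fun dot inc).
Let hH : hilbert_axioms dot := aw_hilbert hW.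
Variables (h : R) (e : H).
Hypotheses (h0 : 0 < h) (eB : in_dual dot inc e) (ee : dot e e = 1).
Local Notation muh := (mu (h / 2)).
Let h20 : 0 < h / 2. Proof. by rewrite divr_gt0. Qed.
Let hn0 : h != 0. Proof. by rewrite gt_eqF. Qed.
Implicit Types f g : BT -> C.

(** The Weyl quantization of the wave exp (i (al x1 + be xi1)). *)
Definition translation (al be : R) f (y : BT) : C :=
  expi (al * L e y + al * be * h / 2) * (expR (- be * L e y - h * be ^+ 2 / 2))%:C%C *
  f (wshift inc e (h * be) y).

Lemma cmeasurable_wshift t f : cmeasurable f -> cmeasurable (fun y => f (wshift inc e t y)).
Proof.
move=> [m1 m2]; have mw := measurable_wshift inc e t.
by split; [exact: (measurableT_comp m1 mw)|exact: (measurableT_comp m2 mw)].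
Qed.

Lemma cmeasurable_translation al be f : cmeasurable f -> cmeasurable (translation al be f).
Proof.
move=> mf; have ml := dual_fun_measurable hW e.
apply: cmeasurableM; last exact: cmeasurable_wshift.
apply: cmeasurableM; first by apply: cmeasurable_expi; apply: measurable_funD => //; exact: measurable_funM.
apply: cmeasurable_real; apply: measurableT_comp => //.
by apply: measurable_funB => //; exact: measurable_funM.
Qed.

(** The exponential weight squared is the Cameron-Martin density of the shift,
    so translations are isometries. *)
Lemma csq_translation al be f : cmeasurable f -> csq muh (translation al be f) = csq muh f.
Proof.
move=> mf; rewrite !csqE.
have mF : measurable_fun setT (fun y : BT => (Re (f y) ^+ 2 + Im (f y) ^+ 2)%:E).
  by apply/measurable_EFinP; apply: measurable_funD; apply: measurable_funX; [exact: mf.1|exact: mf.2].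
have F0 y : (0 <= (Re (f y) ^+ 2 + Im (f y) ^+ 2)%:E)%E by rewrite lee_fin addr_ge0// sqr_ge0.
rewrite [RHS](cameron_martin hW eB ee h20 (h * be) mF F0).
apply: eq_integral => y _; rewrite -EFinM; congr EFin.
have -> : cm_weight dot inc e (h / 2) (h * be) y = expR (- be * L e y - h * be ^+ 2 / 2) ^+ 2.
  by rewrite /cm_weight [RHS]expr2 -expRD; congr expR; field.
rewrite /translation !ReM !ImM /=; have := cos2Dsin2 (al * L e y + al * be * h / 2).
set c := cos _; set s := sin _; set r := expR _; set a := Re _; set b := Im _ => cs.
transitivity ((c ^+ 2 + s ^+ 2) * ((a ^+ 2 + b ^+ 2) * r ^+ 2)); first by ring.
by rewrite cs mul1r.
Qed.

Definition weyl_operator (ks : seq (R * (R * R))) f (y : BT) : C :=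
  \sum_(k <- ks) (k.1)%:C%C * translation k.2.1 k.2.2 f y.

Lemma csq_weyl_operator ks : exists2 M : R, 0 <= M & forall f, cmeasurable f ->
  cmeasurable (weyl_operator ks f) /\ (csq muh (weyl_operator ks f) <= M%:E * csq muh f)%E.
Proof.
elim: ks => [|k ks [M M0 hM]].
  exists 0 => // f mf.
  have -> : weyl_operator [::] f = (fun y => (0 : R)%:C%C) by apply/funext => y; rewrite /weyl_operator big_nil.
  split; first exact: cmeasurable_real.
  rewrite mul0e csqE; under eq_integral do rewrite /= expr0n /= addr0.
  by rewrite integral0.
exists (2 * k.1 ^+ 2 + 2 * M); first by apply: addr_ge0; apply: mulr_ge0 => //; exact: sqr_ge0.
move=> f mf; have [mA hA] := hM f mf.
have mT := cmeasurable_translation k.2.1 k.2.2 mf.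
have mk : cmeasurable (fun y : BT => (k.1)%:C%C * translation k.2.1 k.2.2 f y).
  by apply: cmeasurableM => //; exact: cmeasurable_real.
have -> : weyl_operator (k :: ks) f = fun y => (k.1)%:C%C * translation k.2.1 k.2.2 f y + weyl_operator ks f y.
  by apply/funext => y; rewrite /weyl_operator big_cons.
split; first exact: cmeasurableD.
apply: (le_trans (csqD muh mk mA)).
have -> : csq muh (fun y => (k.1)%:C%C * translation k.2.1 k.2.2 f y) = ((k.1 ^+ 2)%:E * csq muh f)%E.
  rewrite -(csq_translation k.2.1 k.2.2 mf) !csqE -ge0_integralZl//.
  - by apply: eq_integral => y _; rewrite -EFinM; congr EFin; rewrite ReM ImM /=; ring.
  - by apply/measurable_EFinP; apply: measurable_funD; apply: measurable_funX; [exact: mT.1|exact: mT.2].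
  - by move=> y _; rewrite lee_fin addr_ge0// sqr_ge0.
  - by rewrite lee_fin sqr_ge0.
have c0 : (0 <= csq muh f)%E by exact: sqnorm_ge0.
apply: (@le_trans _ _ (2%:E * ((k.1 ^+ 2)%:E * csq muh f) + 2%:E * (M%:E * csq muh f))%E).
  by apply: leeD => //; exact: lee_wpmul2l.
have p1 : (0 <= (2 * k.1 ^+ 2)%:E)%E by rewrite lee_fin; apply: mulr_ge0 => //; exact: sqr_ge0.
have p2 : (0 <= (2 * M)%:E)%E by rewrite lee_fin; exact: mulr_ge0.
rewrite (EFinD (2 * k.1 ^+ 2) (2 * M)) (ge0_muleDl _ p1 p2).
by rewrite (EFinM 2 (k.1 ^+ 2)) (EFinM 2 M) -!muleA.
Qed.

Lemma weyl_operator_bounded ks : cL2_bounded_operator muh (weyl_operator ks).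
Proof.
have [M M0 hM] := csq_weyl_operator ks; split.
- move=> f /cL2P[mf sf]; have [mA hA] := hM f mf; apply/cL2P; split=> //.
  have ff : csq muh f \is a fin_num by rewrite ge0_fin_numE// sqnorm_ge0.
  by apply: (le_lt_trans hA); rewrite -(fineK ff) -EFinM ltry.
- move=> c f g _ _; apply: aeW => y; rewrite /weyl_operator mulr_sumr -big_split /=.
  apply: eq_bigr => k _; rewrite /translation; ring.
- exists (Num.sqrt M) => f fL; have [mf _] := (cL2P muh f).1 fL.
  by apply: cL2norm_le => //; exact: (hM f mf).2.
Qed.

Definition translated_product (al be : R) f g (y : BT) : C :=
  expi (al * L e y) * (f (wshift inc e (h / 2 * be) y) * (g (wshift inc e (- (h / 2 * be)) y))^*).

(** The Cameron-Martin shift by half of the translation distributes it evenly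
    over the two functions; the first order terms of all exponents cancel, and
    a constant Gaussian factor is left. *)
Lemma translation_inner al be f g : cmeasurable f -> cmeasurable g ->
  let q := expR (- (h / 4 * be ^+ 2)) in
  cintegrable muh (translated_product al be f g) ->
  cintegrable muh (fun y => translation al be f y * (g y)^*) /\
  cL2inner muh (translation al be f) g = q%:C%C * cintegral muh (translated_product al be f g).
Proof.
move=> mf mg q ii.
set F := fun y => translation al be f y * (g y)^*; set G := translated_product al be f g.
have mF : cmeasurable F by apply: cmeasurableM; [exact: cmeasurable_translation|exact: cmeasurableC].
(* half of the shift by h be, backwards *)
pose t := - (h / 2 * be).
have w0 y : 0 <= cm_weight dot inc e (h / 2) t y by exact: cm_weight_ge0.
have mw := measurable_cm_weight hW e (h / 2) t.
have cm := @cameron_martin _ _ _ _ _ _ hW e (h / 2) eB ee h20 t.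
have FG y : F (wshift inc e t y) * (cm_weight dot inc e (h / 2) t y)%:C%C = q%:C%C * G y.
  rewrite /F /G /translation /translated_product (dual_fun_wshift hW)// ee mulr1.
  have -> : wshift inc e (h * be) (wshift inc e t y) = wshift inc e (h / 2 * be) y.
    by rewrite /wshift -addrA -scalerDl; congr (_ + _ *: _); rewrite /t; field.
  have -> : al * (L e y + t) + al * be * h / 2 = al * L e y by rewrite /t; field.
  have -> : q%:C%C = (expR (- be * (L e y + t) - h * be ^+ 2 / 2))%:C%C *
      (cm_weight dot inc e (h / 2) t y)%:C%C :> C.
    rewrite -rmorphM /= /cm_weight -expRD; congr ((expR _)%:C%C); rewrite /t; field.
    exact: hn0.
  rewrite -/t; ring.
have [qi qE] := cintegralZ q%:C%C ii.
have Rt y : Re (F (wshift inc e t y)) * cm_weight dot inc e (h / 2) t y = Re (q%:C%C * G y).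
  by rewrite -FG ReM /= mulr0 subr0.
have It y : Im (F (wshift inc e t y)) * cm_weight dot inc e (h / 2) t y = Im (q%:C%C * G y).
  by rewrite -FG ImM /= mulr0 add0r.
split.
  split.
    apply: (integrable_transfer (measurable_wshift inc e t) mw w0 cm mF.1).2.
    by have := qi.1; congr (_.-integrable _ _); apply/funext => y; rewrite /= Rt.
  apply: (integrable_transfer (measurable_wshift inc e t) mw w0 cm mF.2).2.
  by have := qi.2; congr (_.-integrable _ _); apply/funext => y; rewrite /= It.
rewrite -qE; apply: eqC => /=.
  rewrite [LHS](Rintegral_transfer w0 cm mF.1); apply: eq_Rintegral => y _; exact: Rt.
rewrite [LHS](Rintegral_transfer w0 cm mF.2); apply: eq_Rintegral => y _; exact: It.
Qed.

Definition part (im : bool) (z : C) : R := if im then Im z else Re z.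

(** Each term is (coefficient, phase, (part of the first factor, part of the
    second one)), where [false] stands for the real part and [true] for the
    imaginary part. *)
Definition wave_terms (im : bool) : seq (R * R * (bool * bool)) :=
  if im then [:: (1, 0, (true, false)); (-1, 0, (false, true));
                 (1, - (pi / 2), (false, false)); (1, - (pi / 2), (true, true))]
  else [:: (1, 0, (false, false)); (1, 0, (true, true));
           (1, pi / 2, (true, false)); (-1, pi / 2, (false, true))].

(** The real and the imaginary part of exp (i t) x y^* as sums of real waves,
    a sine being a cosine with a shifted phase. *)
Lemma part_expi_mul im t (x y : C) : part im (expi t * (x * y^*)) =
  \sum_(j <- wave_terms im) j.1.1 * (cos (j.1.2 + t) * (part j.2.1 x * part j.2.2 y)).
Proof.
have hA : cos (pi / 2 + t) = - sin t by rewrite addrC cosDpihalf.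
have hB : cos (- (pi / 2) + t) = sin t by rewrite addrC cos_subpihalf.
have hC : cos (0 + t) = cos t by rewrite add0r.
case: x => a b; case: y => c d; case: im; rewrite /wave_terms !big_cons big_nil;
  rewrite [in RHS]/= ?hA ?hB !hC /part /=; ring.
Qed.

Lemma expiD (a b : R) : expi a * expi b = expi (a + b) :> C.
Proof. by apply: eqC; rewrite ?ReM ?ImM /= ?cosD ?sinD //; ring. Qed.

Lemma part_cintegral d (T : measurableType d) (m : probability T R) im (F : T -> C) :
  part im (cintegral m F) = \int[m]_x part im (F x).
Proof. by case: im. Qed.

Lemma part_real im (r : R) (z : C) : part im (r%:C%C * z) = r * part im z.
Proof. by case: im; case: z => a b /=; rewrite mul0r ?subr0 ?addr0. Qed.

Lemma part_eq (x y : C) : (forall im, part im x = part im y) -> x = y.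
Proof. by move=> xy; apply: eqC; [exact: (xy false)|exact: (xy true)]. Qed.

Lemma part_integrable d (T : measurableType d) (m : probability T R) (F : T -> C) :
  (forall im, m.-integrable setT (EFin \o (fun x => part im (F x)))) -> cintegrable m F.
Proof. by move=> iF; split; [exact: (iF false)|exact: (iF true)]. Qed.

Section weyl_identity.
Variables (u : seq H) (phi psi : H -> C).
Hypotheses (ou : orthonormal_seq dot u) (ud : {in u, forall a, in_dual dot inc a}).
Hypotheses (Sphi : S_half dot h u phi) (Spsi : S_half dot h u psi).
Local Notation n := (size u).
Local Notation TT := (n.-tuple RT).
Local Notation X := (coords dot inc u).
Local Notation gam := (gaussian (h / 2) n).
Local Notation m2 := (mu2 mu (h / 2)).

Let kap : R := (pi * h) `^ (- n%:R / 4).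
Let kap0 : 0 < kap. Proof. by rewrite powR_gt0// mulr_gt0// pi_gt0. Qed.

Let gammaE (f : H -> C) im y : part im (gamma_half dot h u f y) =
  kap * expR (- dot y y / (2 * h)) * part im (f y).
Proof. exact: part_real. Qed.

Let sch (f : H -> C) im : S_half dot h u f -> schwartz_on dot u (fun y => part im (gamma_half dot h u f y)).
Proof. by case: im => -[]. Qed.

Let master al be (j : R * R * (bool * bool)) := master_formula hW h0 eB ee ou ud al be j.1.2 kap0
  (gammaE phi j.2.1) (gammaE psi j.2.2) (sch j.2.1 Sphi) (sch j.2.2 Spsi).

Let Kj al be (j : R * R * (bool * bool)) := weyl_kernel dot inc h e u al be j.1.2
  (fun y => part j.2.1 (phi y)) (fun y => part j.2.2 (psi y)).
Let Sj al be (j : R * R * (bool * bool)) := shifted_product dot inc h e u al be j.1.2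
  (fun y => part j.2.1 (phi y)) (fun y => part j.2.2 (psi y)).

Lemma part_wigner al be im x :
  part im (expi (al * L e x.1 + be * L e x.2) * wignerB dot inc mu h u phi psi x) =
  \sum_(j <- wave_terms im) j.1.1 * Kj al be j x.
Proof.
rewrite /wignerB /wignerE !(tpiB_coords hW)//.
set z := lincomb (X x.1); set zeta := lincomb (X x.2); set th := al * _ + _.
set I := fun c : TT => _.
have IE (t : R) im' c : part im' (expi t * I c) = \sum_(j <- wave_terms im') j.1.1 *
    (cos (j.1.2 + t - 2 * dot zeta (lincomb c) / h) *
     (part j.2.1 (phi (z + lincomb c)) * part j.2.2 (psi (z - lincomb c)))).
  rewrite /I /= -[expi _ * phi _ * _]mulrA [expi t * _]mulrA expiD part_expi_mul.
  by apply: eq_bigr => j _; rewrite !mulNr addrA.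
have iI (j : R * R * (bool * bool)) (t : R) : gam.-integrable setT (EFin \o (fun c => cos (j.1.2 + t - 2 * dot zeta (lincomb c) / h) *
     (part j.2.1 (phi (z + lincomb c)) * part j.2.2 (psi (z - lincomb c))))).
  by have [h1 _ _ _] := master al be j; exact: (h1 (j.1.2 + t) (X x.1) (X x.2)).
have iC : cintegrable gam I.
  apply: part_integrable => im'.
  have [ii _] := Rintegral_sum (wave_terms im') (fun j => j.1.1) (fun j => iI j 0).
  have := ii; congr (_.-integrable _ _); apply/funext => c; congr EFin.
  rewrite -IE; congr part; rewrite (_ : expi 0 = 1) ?mul1r//.
  by apply: eqC; rewrite /= ?cos0 ?sin0.
rewrite mulrCA part_real -(cintegralZ (expi th) iC).2 part_cintegral.
transitivity (expR (dot zeta zeta / h) * \int[gam]_c \sum_(j <- wave_terms im) j.1.1 *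
    (cos (j.1.2 + th - 2 * dot zeta (lincomb c) / h) *
     (part j.2.1 (phi (z + lincomb c)) * part j.2.2 (psi (z - lincomb c))))).
  by congr (_ * _); apply: eq_Rintegral => c _; exact: IE.
rewrite (Rintegral_sum (wave_terms im) (fun j => j.1.1) (fun j => iI j th)).2 mulr_sumr.
apply: eq_bigr => j _; rewrite mulrCA; congr (_ * _).
rewrite /Kj /weyl_kernel -/z -/zeta; congr (_ * _).
by apply: eq_Rintegral => c _; rewrite /th addrA.
Qed.

Lemma cmeasurable_cylinder (f : H -> C) : S_half dot h u f ->
  cmeasurable (f \o tpiB dot inc mu (h / 2) u : BT -> C).
Proof.
move=> Sf.
have m im : measurable_fun setT (fun y : BT => part im (f (lincomb (X y)))).
  have ms := schwartz_measurable (sch im Sf).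
  have mt : measurable_fun setT (fun c : TT => part im (f (lincomb c))).
    rewrite (_ : (fun c => _) = fun c : TT => kap^-1 * expR (tnorm2 c / (2 * h)) *
        part im (gamma_half dot h u f (lincomb c))).
      apply: measurable_funM => //; apply: measurable_funM => //; apply: measurableT_comp => //.
      by apply: measurable_funM => //; exact: measurable_tnorm2.
    apply/funext => c; rewrite gammaE (dot_lincomb_norm hH ou).
    set E := expR (tnorm2 c / _); set E' := expR (- _ / _).
    have EE : E * E' = 1 by rewrite /E /E' -expRD -mulrDl subrr mul0r expR0.
    transitivity ((kap^-1 * kap) * (E * E') * part im (f (lincomb c))); last by ring.
    by rewrite EE mulVf ?gt_eqF// !mul1r.
  exact: (measurableT_comp mt (measurable_coords hW (u := u))).
have E y : (f \o tpiB dot inc mu (h / 2) u) y = f (lincomb (X y)) by rewrite /= (tpiB_coords hW).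
split.
  by rewrite (_ : _ \o _ = fun y : BT => part false (f (lincomb (X y)))); [exact: m|apply/funext => y; rewrite /= -E].
by rewrite (_ : _ \o _ = fun y : BT => part true (f (lincomb (X y)))); [exact: m|apply/funext => y; rewrite /= -E].
Qed.

(** The master formula for each of the real waves of [part_expi_mul]. *)
Theorem translation_weyl al be :
  let A := translation al be (phi \o tpiB dot inc mu (h / 2) u) in
  let g := psi \o tpiB dot inc mu (h / 2) u in
  let F x := expi (al * L e x.1 + be * L e x.2) * wignerB dot inc mu h u phi psi x in
  [/\ cintegrable m2 F, cintegrable muh (fun y => A y * (g y)^*) &
      cintegral m2 F = cL2inner muh A g].
Proof.
move=> A g F.
have iK j : m2.-integrable setT (EFin \o Kj al be j) by have [_ ? _ _] := master al be j.
have iS j : muh.-integrable setT (EFin \o Sj al be j) by have [_ _ ? _] := master al be j.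
have iF : cintegrable m2 F.
  apply: part_integrable => im.
  have [ii _] := Rintegral_sum (wave_terms im) (fun j => j.1.1) iK.
  have := ii; congr (_.-integrable _ _); apply/funext => x; congr EFin.
  by rewrite part_wigner.
have tS im y : part im (translated_product al be (phi \o tpiB dot inc mu (h / 2) u) g y) =
    \sum_(j <- wave_terms im) j.1.1 * Sj al be j y.
  by rewrite /translated_product part_expi_mul /g /= !(tpiB_coords hW).
have iT : cintegrable muh (translated_product al be (phi \o tpiB dot inc mu (h / 2) u) g).
  apply: part_integrable => im.
  have [ii _] := Rintegral_sum (wave_terms im) (fun j => j.1.1) iS.
  have := ii; congr (_.-integrable _ _); apply/funext => x; congr EFin.
  by rewrite tS.
have [iA EA] := translation_inner (cmeasurable_cylinder Sphi) (cmeasurable_cylinder Spsi) iT.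
split=> //; rewrite EA; apply: part_eq => im; rewrite part_real !part_cintegral.
transitivity (\int[m2]_x \sum_(j <- wave_terms im) j.1.1 * Kj al be j x).
  by apply: eq_Rintegral => x _; rewrite part_wigner.
transitivity (expR (- (h / 4 * be ^+ 2)) * \int[muh]_y \sum_(j <- wave_terms im) j.1.1 * Sj al be j y); last first.
  by congr (_ * _); apply: eq_Rintegral => y _; rewrite tS.
rewrite (Rintegral_sum _ _ iK).2 (Rintegral_sum _ _ iS).2 mulr_sumr.
apply: eq_bigr => j _; rewrite mulrCA; congr (_ * _).
by have [_ _ _ ->] := master al be j.
Qed.

(** When the sines cancel, the real symbol is a sum of complex exponentials,
    and the identity holds term by term. *)
Lemma weyl_operator_inner ks :
  (forall x y : R, \sum_(k <- ks) k.1 * sin (k.2.1 * x + k.2.2 * y) = 0) ->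
  cL2inner muh (weyl_operator ks (phi \o tpiB dot inc mu (h / 2) u)) (psi \o tpiB dot inc mu (h / 2) u) =
  weyl_form dot inc mu h
    (fun x => \sum_(k <- ks) k.1 * cos (k.2.1 * L e x.1 + k.2.2 * L e x.2)) u phi psi.
Proof.
move=> ks0; rewrite /weyl_form /cL2inner.
have tw (k : R * (R * R)) := translation_weyl k.2.1 k.2.2.
have i1 (k : R * (R * R)) : cintegrable m2 (fun x => expi (k.2.1 * L e x.1 + k.2.2 * L e x.2) *
    wignerB dot inc mu h u phi psi x) by have [? _ _] := tw k.
have i2 (k : R * (R * R)) : cintegrable muh (fun y =>
    translation k.2.1 k.2.2 (phi \o tpiB dot inc mu (h / 2) u) y * ((psi \o tpiB dot inc mu (h / 2) u) y)^*).
  by have [_ ? _] := tw k.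
transitivity (cintegral muh (fun y => \sum_(k <- ks) (k.1)%:C%C *
    (translation k.2.1 k.2.2 (phi \o tpiB dot inc mu (h / 2) u) y * ((psi \o tpiB dot inc mu (h / 2) u) y)^*))).
  congr cintegral; apply/funext => y; rewrite /weyl_operator mulr_suml.
  by apply: eq_bigr => k _; rewrite mulrA.
transitivity (cintegral m2 (fun x => \sum_(k <- ks) (k.1)%:C%C *
    (expi (k.2.1 * L e x.1 + k.2.2 * L e x.2) * wignerB dot inc mu h u phi psi x))).
  rewrite (cintegral_sum ks (fun k => k.1) i2) (cintegral_sum ks (fun k => k.1) i1).
  by apply: eq_bigr => k _; have [_ _ ->] := tw k.
congr cintegral; apply/funext => x; under eq_bigr do rewrite mulrA.
rewrite -mulr_suml; congr (_ * _); apply: eqC.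
  by rewrite Re_sum; apply: eq_bigr => k _; rewrite ReM /= mul0r subr0.
rewrite Im_sum -[RHS](ks0 (L e x.1) (L e x.2)).
by apply: eq_bigr => k _; rewrite ImM /= mul0r addr0.
Qed.

End weyl_identity.

Theorem weyl_operatorP ks :
  (forall x y : R, \sum_(k <- ks) k.1 * sin (k.2.1 * x + k.2.2 * y) = 0) ->
  is_weyl_operator dot inc mu h
    (fun x => \sum_(k <- ks) k.1 * cos (k.2.1 * L e x.1 + k.2.2 * L e x.2)) (weyl_operator ks).
Proof.
move=> ks0; split; first exact: weyl_operator_bounded.
by move=> u phi psi ou ud Sphi Spsi; exact: weyl_operator_inner.
Qed.

End weyl_translation.

(** * The first Hermite function *)

Section negativity.
Context {R : realType} {H B : completeNormedModType R}.
Variables (dot : H -> H -> R) (inc : H -> B) (mu : R -> probability (borelType B) R).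
Hypothesis hW : abstract_wiener dot inc mu.
Local Notation C := (complex R).
Local Notation Re := (@complex.Re R).
Local Notation Im := (@complex.Im R).
Local Notation BT := (borelType B).
Local Notation RT := (measurableTypeR R).
Local Notation L := (dual_fun dot inc).
Let hH : hilbert_axioms dot := aw_hilbert hW.
Variables (h : R) (e : H).
Hypotheses (h0 : 0 < h) (eB : in_dual dot inc e) (ee : dot e e = 1).
Local Notation muh := (mu (h / 2)).
Local Notation N := (normal_prob 0 (Num.sqrt (h / 2))).
Let h20 : 0 < h / 2. Proof. by rewrite divr_gt0. Qed.

(** The first Hermite function, up to normalisation. *)
Definition hermite1 (y : BT) : C := (L e y)%:C%C.

Let ml : measurable_fun setT (L e : BT -> RT) := dual_fun_measurable hW e.

Lemma hermite1_cL2 : cL2 muh hermite1.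
Proof.
apply/cL2P; split; first exact: cmeasurable_real.
rewrite csqE (_ : (\int[_]_x _)%E = sqnorm muh (L e : BT -> R)).
  by rewrite (sqnorm_dual_fun hW h20 eB) ltry.
by apply: eq_integral => y _; rewrite /hermite1 /= expr0n addr0.
Qed.

Lemma Rintegral_coord (G : RT -> R) : N.-integrable setT (EFin \o G) ->
  muh.-integrable setT (EFin \o (fun y => G (L e y))) /\
  \int[muh]_y G (L e y) = \int[N]_x G x.
Proof.
move=> iG; apply: (Rintegral_pullback (T1 := RT) (m1 := N) (p := L e : BT -> RT)) => //.
move=> F mF F0.
have oe : orthonormal_seq dot [:: e] by move=> [|i] [|j] //= _ _; rewrite ee.
have ed : {in [:: e], forall a, in_dual dot inc a} by move=> w; rewrite inE => /eqP ->.
have mG : measurable_fun setT (fun t : (size [:: e]).-tuple RT => F (tnth t ord0)).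
  by apply: (measurableT_comp mF); exact: measurable_tnth.
have E := ge0_integral_coords hW h20 oe ed mG (fun t => F0 _).
have E2 := ge0_integral_gaussianS (h / 2) mG (fun t => F0 _).
transitivity (\int[muh]_y F (tnth (coords dot inc [:: e] y) ord0))%E; last first.
  by apply: eq_integral => y _; rewrite tnth_mktuple.
rewrite E E2; apply: eq_integral => x _.
rewrite (_ : (fun t => _) = cst (F x)); last by apply/funext.
by rewrite integral_cst// [X in (_ * X)%E]probability_setT mule1.
Qed.

Lemma part_translated_hermite al be im y :
  part im (translated_product dot inc h e al be hermite1 hermite1 y) =
  (if im then sin (al * L e y) else cos (al * L e y)) * (L e y ^+ 2 - (h / 2 * be) ^+ 2).
Proof.
rewrite /translated_product /hermite1 !(dual_fun_wshift hW)// ee.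
by case: im => /=; ring.
Qed.

Let integrable_trig (im : bool) al be : N.-integrable setT (EFin \o (fun x : RT =>
  (if im then sin (al * x) else cos (al * x)) * (x ^+ 2 - (h / 2 * be) ^+ 2))).
Proof.
have [i2 _] := normal_x2_cos h20 0.
have ic := integrable_cos_normal (h / 2) 0 0.
have ii := integrableD measurableT i2 (integrableZl_fin ((h / 2 * be) ^+ 2) ic).
apply: (intble_le _ ii) => [|x].
  apply: measurable_funM; last by apply: measurable_funB => //; exact: measurable_funX.
  case: im; last by apply: measurable_cos_comp; exact: measurable_funM.
  rewrite (_ : (fun x : RT => sin (al * x)) = (fun x : RT => cos (al * x - pi / 2))).
    by apply: measurable_cos_comp; apply: measurable_funB => //; exact: measurable_funM.
  by apply/funext => x; rewrite cos_subpihalf.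
rewrite /= !mul0r add0r cos0 !mulr1 normrM.
apply: (@le_trans _ _ (1 * `|x ^+ 2 - (h / 2 * be) ^+ 2|)).
  apply: ler_wpM2r => //; case: im; last exact: cos_norm_le1.
  by rewrite ler_norml sin_geN1 sin_le1.
rewrite mul1r; apply: (le_trans (ler_normB _ _)).
by rewrite !ger0_norm ?sqr_ge0.
Qed.

Let integrable_translated al be :
  cintegrable muh (translated_product dot inc h e al be hermite1 hermite1).
Proof.
apply: part_integrable => im.
have [ii _] := Rintegral_coord (integrable_trig im al be).
have := ii; congr (_.-integrable _ _); apply/funext => y; congr EFin.
by rewrite part_translated_hermite.
Qed.

Let inner al be := cL2inner muh (translation dot inc h e al be hermite1) hermite1.

(** After symmetrisation the integrand is cos (al L) (L^2 - (h be / 2)^2), an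
    integral in one normal variable. *)
Lemma translation_hermite_re al be : Re (inner al be) =
  h / 2 * (1 - h / 2 * (al ^+ 2 + be ^+ 2)) * expR (- (h / 4 * (al ^+ 2 + be ^+ 2))).
Proof.
have mg : cmeasurable hermite1 by have [] := (cL2P muh hermite1).1 hermite1_cL2.
have [_ E0] := translation_inner hW h0 eB ee mg mg (integrable_translated al be).
rewrite /inner E0 -[Re _]/(part false _) part_real part_cintegral.
have [_ E] := Rintegral_coord (integrable_trig false al be).
have -> : \int[muh]_y part false (translated_product dot inc h e al be hermite1 hermite1 y) =
    \int[N]_x (cos (al * x) * (x ^+ 2 - (h / 2 * be) ^+ 2)).
  by rewrite -E; apply: eq_Rintegral => y _; rewrite part_translated_hermite.
have [i2 E2] := normal_x2_cos h20 al.
have ic := integrable_cos_normal (h / 2) 0 al.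
transitivity (expR (- (h / 4 * be ^+ 2)) * (\int[N]_x (x ^+ 2 * cos (al * x)) -
    \int[N]_x ((h / 2 * be) ^+ 2 * cos (0 + al * x)))).
  congr (_ * _); rewrite -(RintegralB measurableT i2 (integrableZl_fin _ ic)).
  by apply: eq_Rintegral => x _; rewrite add0r; ring.
rewrite E2 (RintegralZl _ measurableT ic) (normal_charfun h20) cos0 mul1r.
have -> : expR (- (h / 2 * al ^+ 2 / 2)) = expR (- (h / 4 * al ^+ 2)) by congr expR; field.
have -> : expR (- (h / 4 * (al ^+ 2 + be ^+ 2))) = expR (- (h / 4 * al ^+ 2)) * expR (- (h / 4 * be ^+ 2)).
  by rewrite -expRD; congr expR; ring.
by field.
Qed.

(** The imaginary part is an integral of sin (al L), so opposite waves cancel.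
    *)
Lemma translation_hermite_imN al be : Im (inner (- al) (- be)) = - Im (inner al be).
Proof.
have mg : cmeasurable hermite1 by have [] := (cL2P muh hermite1).1 hermite1_cL2.
have [_ E1] := translation_inner hW h0 eB ee mg mg (integrable_translated al be).
have [_ E2] := translation_inner hW h0 eB ee mg mg (integrable_translated (- al) (- be)).
rewrite /inner E1 E2 -![Im _]/(part true _) !part_real !part_cintegral sqrrN -[RHS]mulrN; congr (_ * _).
have ii := (integrable_translated al be).2.
rewrite -mulN1r -(RintegralZl _ measurableT ii); apply: eq_Rintegral => y _.
transitivity (-1 * part true (translated_product dot inc h e al be hermite1 hermite1 y)); last by [].
by rewrite !part_translated_hermite [LHS]/= [- al * _]mulNr sinN [h / 2 * - be]mulrN sqrrN; ring.
Qed.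

Lemma weyl_operator_hermite ks :
  cL2inner muh (weyl_operator dot inc h e ks hermite1) hermite1 = \sum_(k <- ks) (k.1)%:C%C * inner k.2.1 k.2.2.
Proof.
have mg : cmeasurable hermite1 by have [] := (cL2P muh hermite1).1 hermite1_cL2.
have i2 (k : R * (R * R)) : cintegrable muh (fun y =>
    translation dot inc h e k.2.1 k.2.2 hermite1 y * (hermite1 y)^*).
  by have [? _] := translation_inner hW h0 eB ee mg mg (integrable_translated k.2.1 k.2.2).
rewrite -(cintegral_sum ks (fun k => k.1) i2); congr cintegral; apply/funext => y.
by rewrite /weyl_operator mulr_suml; apply: eq_bigr => k _; rewrite mulrA.
Qed.

End negativity.

(** * The positive symbol and the sign of its quantization *)

Section symbol.
Variables (R : realType) (h : R).
Hypothesis h0 : 0 < h.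

Let x1 : R := expR (- 1).
Definition symbol_freq : R := 2 / Num.sqrt h.
(** Half of the gap (3 x - 1) (1 + x) at x = exp (-1), so that the sum
    computed in [symbol_waves_negative] stays negative. *)
Definition symbol_shift : R := (3 * x1 - 1) * (1 + x1) / 2.
(** The expansion of the product of cosines into waves, with each wave split
    into two opposite ones so that the corresponding sines cancel. *)
Definition symbol_waves : seq (R * (R * R)) := let a := symbol_freq in
  [:: (1 + symbol_shift, (0, 0)); (1 / 2, (a, 0)); (1 / 2, (- a, 0)); (1 / 2, (0, a)); (1 / 2, (0, - a));
      (1 / 4, (a, a)); (1 / 4, (- a, - a)); (1 / 4, (a, - a)); (1 / 4, (- a, a))].

Lemma symbol_freq2 : symbol_freq ^+ 2 = 4 / h.
Proof. by rewrite /symbol_freq expr_div_n sqr_sqrtr ?ltW// -natrX. Qed.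

Lemma symbol_waves_odd (J : R -> R -> R) : (forall a b, J (- a) (- b) = - J a b) ->
  \sum_(k <- symbol_waves) k.1 * J k.2.1 k.2.2 = 0.
Proof.
move=> JN; rewrite /symbol_waves; set a := symbol_freq.
have J0 : J 0 0 = 0 by have := JN 0 0; rewrite oppr0; lra.
have := JN a 0; have := JN 0 a; have := JN a a; have := JN a (- a).
rewrite oppr0 opprK => j4 j3 j2 j1.
rewrite !big_cons big_nil [LHS]/= J0 j1 j2 j3 j4; ring.
Qed.

Lemma symbol_waves_cos (x y : R) : \sum_(k <- symbol_waves) k.1 * cos (k.2.1 * x + k.2.2 * y) =
  symbol_shift + (1 + cos (symbol_freq * x)) * (1 + cos (symbol_freq * y)).
Proof.
rewrite /symbol_waves; set a := symbol_freq; rewrite !big_cons big_nil [LHS]/= !mul0r !mulNr !addr0 !add0r -!opprD.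
rewrite cos0 [- (a * x) + a * y]addrC !cosN.
have -> : cos (a * y - a * x) = cos (a * x - a * y) by rewrite -cosN opprB.
rewrite cosD cosB; lra.
Qed.

(** From exp (- 1 / 8) >= 7 / 8 and three squarings, rounded down to rational
    numbers that are still large enough. *)
Lemma exp_third : 1 < 3 * x1.
Proof.
(* x1 is r^8 *)
pose r : R := expR (- (1 / 8)).
have r7 : 7 / 8 <= r by have := expR_ge1Dx (- (1 / 8) : R); rewrite /r; lra.
have -> : x1 = ((r ^+ 2) ^+ 2) ^+ 2 by rewrite /x1 /r !expr2 -!expRD; congr expR; field.
have sq (x y : R) : 0 <= x -> x <= y -> x ^+ 2 <= y ^+ 2 by move=> x0 xy; rewrite lerXn2r ?nnegrE// (le_trans x0).
have h1 : (49 / 64 : R) <= r ^+ 2 by have := @sq (7 / 8) r; rewrite !expr2; lra.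
have h2 : (2401 / 4096 : R) <= (r ^+ 2) ^+ 2 by have := @sq (49 / 64) (r ^+ 2); rewrite [(49 / 64) ^+ 2]expr2; lra.
have := @sq (2401 / 4096) ((r ^+ 2) ^+ 2); rewrite [(2401 / 4096) ^+ 2]expr2; lra.
Qed.

Lemma symbol_shift_gt0 : 0 < symbol_shift.
Proof.
have x0 : 0 < x1 by exact: expR_gt0.
apply: divr_gt0 => //; apply: mulr_gt0; last exact: addr_gt0.
by rewrite subr_gt0; exact: exp_third.
Qed.

Lemma symbol_waves_gt0 (x y : R) : 0 < \sum_(k <- symbol_waves) k.1 * cos (k.2.1 * x + k.2.2 * y).
Proof.
rewrite symbol_waves_cos; apply: ltr_wpDr; last exact: symbol_shift_gt0.
by apply: mulr_ge0; [have := cos_geN1 (symbol_freq * x)|have := cos_geN1 (symbol_freq * y)]; lra.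
Qed.

Lemma symbol_waves_negative :
  \sum_(k <- symbol_waves) k.1 * (h / 2 * (1 - h / 2 * (k.2.1 ^+ 2 + k.2.2 ^+ 2)) *
    expR (- (h / 4 * (k.2.1 ^+ 2 + k.2.2 ^+ 2)))) < 0.
Proof.
have hn : h != 0 by rewrite gt_eqF.
rewrite /symbol_waves !big_cons big_nil [X in X < _]/= !sqrrN expr0n /= !addr0 !add0r symbol_freq2.
have -> : h / 4 * (4 / h) = 1 by field.
have -> : h / 4 * (4 / h + 4 / h) = 1 + 1 by field.
have -> : h / 2 * (4 / h) = 2 by field.
have -> : h / 2 * (4 / h + 4 / h) = 4 by field.
rewrite !mulr0 oppr0 expR0 addr0 !mulr1 opprD expRD -/x1 /symbol_shift.
have x0 : 0 < x1 by exact: expR_gt0.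
have x3 : 0 < 3 * x1 - 1 by rewrite subr_gt0 exp_third.
have p : 0 < h * ((3 * x1 - 1) * (1 + x1)) by rewrite mulr_gt0// mulr_gt0// addr_gt0.
rewrite -oppr_gt0; have : 0 < h * ((3 * x1 - 1) * (1 + x1)) / 4 by rewrite divr_gt0.
by congr (0 < _); field.
Qed.

End symbol.

Theorem proposition1p9 (R : realType) (H B : completeNormedModType R)
    (dot : H -> H -> R) (inc : H -> B) (mu : R -> probability (borelType B) R)
    (hW : abstract_wiener dot inc mu) (h : R) (h0 : 0 < h) :
  exists (m : nat) (e : nat -> H) (eps : nat -> R) (F : H * H -> R),
    [/\ (2 <= m)%N,
        hilbert_basis dot e /\ (forall j, in_dual dot inc (e j)),
        (forall j, 0 <= eps j) /\ cvgn (series (fun j => eps j ^+ 2)),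
        symbol_class m e eps F /\ (forall z, 0 < F z) &
    exists (Ft : B * B -> R) (A : (B -> complex R) -> (B -> complex R))
      (g : B -> complex R),
      [/\ stochastic_extension2 dot inc mu h 2 F Ft,
          stochastic_extension2 dot inc mu (h / 2) 2 F Ft,
          (exists M : R, forall x, `|Ft x| <= M) /\
          is_weyl_operator dot inc mu h Ft A,
          cL2 (mu (h / 2)) g &
          cL2inner (mu (h / 2)) (A g) g < 0]].
Proof.
have hH := aw_hilbert hW; have h20 : 0 < h / 2 by rewrite divr_gt0.
have [e [eb eB]] := exists_hilbert_basis hH (in_dual0 hW) (in_dual_lin hW) (aw_dual_dense hW).
have oe := eb.1; have ee : dot (e 0%N) (e 0%N) = 1 by rewrite oe.
pose ks := symbol_waves h.
have odd_waves (x y : R) : \sum_(k <- ks) k.1 * sin (k.2.1 * x + k.2.2 * y) = 0.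
  apply: (@symbol_waves_odd R h (fun al be => sin (al * x + be * y))) => al be.
  by rewrite !mulNr -opprD sinN.
exists 2%N, e, (fun j => (j == 0%N)%:R), (cos_symbol dot e ks); split=> //.
- split=> //.
  apply/cvg_ex; exists 1; apply: (@cvg_trans _ ((fun=> 1 : R) @ \oo)); last exact: cvg_cst.
  apply: near_eq_cvg; exists 1%N => // -[|n] //= _.
  by rewrite /series /= big_nat_recl//= expr1n big1 ?addr0// => i _; rewrite expr0n.
- split; first exact: cos_symbol_class.
  by move=> z; exact: symbol_waves_gt0.
exists (cos_extension dot inc e ks), (weyl_operator dot inc h (e 0%N) ks), (hermite1 dot inc (e 0%N)).
split.
- exact: (cos_symbol_extension hW h0 ks (eB 0%N)).
- exact: (cos_symbol_extension hW h20 ks (eB 0%N)).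
- split.
    exists (\sum_(k <- ks) `|k.1|) => x; apply: (le_trans (ler_norm_sum _ _ _)); apply: ler_sum => k _.
    by rewrite normrM ler_piMr// cos_norm_le1.
  exact: (weyl_operatorP hW h0 (eB 0%N) ee odd_waves).
- exact: (hermite1_cL2 hW h0 (eB 0%N)).
rewrite (weyl_operator_hermite hW h0 (eB 0%N) ee) ltcE; apply/andP; split.
  apply/eqP/esym; rewrite Im_sum [RHS]/=.
  rewrite -[RHS](@symbol_waves_odd R h _ (translation_hermite_imN hW h0 (eB 0%N) ee)).
  by apply: eq_bigr => k _; rewrite ImM /= mul0r addr0.
rewrite Re_sum; have := symbol_waves_negative h0; congr (_ < _).
apply: eq_bigr => k _; rewrite ReM [in RHS]/= mul0r subr0; congr (_ * _).
exact: (esym (translation_hermite_re hW h0 (eB 0%N) ee k.2.1 k.2.2)).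
Qed.
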